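(* Let $(G,H,V)$ be one of the triples (Sp), (O), (R), (U) described in the context, with $V=U\odot W$, and let $r$ be an integer with $0\le r\le \frac12\dim V$ in cases (Sp), (O) and $0\le r\le\min\{p,q\}$ in cases (R), (U). (1) If $G=\mathrm{Sp}_{2n}(\mathbb F)$ or $G=\mathrm O_n(\overline{\mathbb F})$, then the $H$-orbits in $\mathrm{Gr}_G(r)$ are parameterized by the integral 4-tuple of $H$-invariants $(r_U,r_W,a,b)$; that is, $S,S'\in\mathrm{Gr}_G(r)$ lie in the same $H$-orbit if and only if $(r_U(S),r_W(S),a(S),b(S))=(r_U(S'),r_W(S'),a(S'),b(S'))$. (2) If $G=\mathrm O(p,q)$ or $G=\mathrm U(p,q)$, then the $H$-orbits in $\mathrm{Gr}_G(r)$ are parameterized by the integral 5-tuple of $H$-invariants $(r_U,r_W,a,b_U,b_W)$; that is, $S,S'\in\mathrm{Gr}_G(r)$ lie in the same $H$-orbit if and only if their 5-tuples are equal. (3) In all cases the $H$-orbit of $S\in\mathrm{Gr}_G(r)$ is isomorphic to $H/H_S$, where $H_S=\{h\in H: h(S)=S\}$, and $H_S$ is described as follows. Let $\mathcal B_U$ and $\mathcal B_W$ be bases of $U$ and $W$ adapted to $S$ as described in the context. Then $h\in H_S$ if and only if $h=h_U\times h_W$ with $h_U\in G(U)$ and $h_W\in G(W)$ such that: with respect to $\mathcal B_U$, $$h_U=\begin{bmatrix}A_{11}&*&*&*&*&*\\ &A_{22}&A_{23}&*&*&*\\ & &A_{33}&0&*&*\\ & & &A_{44}&*&*\\ & & &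 &A_{55}&*\\ & & & & &A_{66}\end{bmatrix},$$ with respect to $\mathcal B_W$, $$h_W=\begin{bmatrix}B_{11}&*&*&*&*&*\\ &B_{22}&B_{23}&*&*&*\\ & &B_{33}&0&*&*\\ & & &B_{44}&*&*\\ & & & &B_{55}&*\\ & & & & &B_{66}\end{bmatrix},$$ and $$\begin{bmatrix}A_{22}&A_{23}\\ &A_{33}\end{bmatrix}=\begin{bmatrix}B_{22}&B_{23}\\ &B_{33}\end{bmatrix}.$$ (4) $\dim H_S$ equals $$\begin{aligned}&\tfrac12\Big[\dim G(U)+\dim G(W)-\dim G\Big(\tfrac{\mathrm{Rad}(\mathbf P_US)^\perp\cap U}{\mathrm{Rad}(\mathbf P_US)}\Big)-\dim G\Big(\tfrac{\mathrm{Rad}(\mathbf P_WS)^\perp\cap W}{\mathrm{Rad}(\mathbf P_WS)}\Big)\Big]\\ &+\dim G\Big(\tfrac{(\mathbf P_US)^\perp\cap U}{\mathrm{Rad}(\mathbf P_US)}\Big)+\dim G\Big(\tfrac{(\mathbf P_WS)^\perp\cap W}{\mathrm{Rad}(\mathbf P_WS)}\Big)+\dim G\Big(\tfrac{\mathbf P_US}{\mathrm{Rad}(\mathbf P_US)}\Big)\\ &+\tfrac12\big[\dim \mathrm{GL}(S\cap U)+\dim\mathrm{GL}(S\cap W)\big]-\dim\mathrm{Hom}\Big(\tfrac{\mathrm{Rad}(\mathbf P_US)}{S\cap U},\tfrac{\mathbf P_US}{\mathrm{Rad}(\mathbf P_US)}\Big).\end{aligned}$$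
   Context: $V$ is a finite-dimensional vector space over a field $K$ with a nondegenerate form $B$; for a space $X$ with a nondegenerate form, $G(X)$ is its isometry group. $\perp$ refers to $B$, and $V=U\odot W$ means $V=U\oplus W$ and $U\perp W$. Always $G=G(V)$ and $H=G(U)\times G(W)\subset G$. The cases are: (Sp) $K=\mathbb F$ an infinite field, $B$ symplectic (nondegenerate alternating bilinear), $\dim V=2n$, $\dim U=2m$, $0<m<n$; $G=\mathrm{Sp}_{2n}(\mathbb F)$, $H=\mathrm{Sp}_{2m}(\mathbb F)\times\mathrm{Sp}_{2n-2m}(\mathbb F)$. (O) $K=\overline{\mathbb F}$ algebraically closed of characteristic $\ne2$, $B$ nondegenerate symmetric, $\dim V=n$, $\dim U=m$, $0<m<n$; $G=\mathrm O_n(\overline{\mathbb F})$, $H=\mathrm O_m(\overline{\mathbb F})\times\mathrm O_{n-m}(\overline{\mathbb F})$. (R) $K=\mathbb R$, $B$ nondegenerate symmetric of signature $(p,q)$, $B|_U$ of signature $(p_1,q_1)$, $B|_W$ of signature $(p-p_1,q-q_1)$, $0<p_1<p$, $0<q_1<q$; $G=\mathrm O(p,q)$, $H=\mathrm O(p_1,q_1)\times\mathrm O(p-p_1,q-q_1)$. (U) $K=\mathbb C$, $B$ nondegenerate Hermitian, with the same signature conventions and conditions as in (R); $G=\mathrm U(p,q)$, $H=\mathrm U(p_1,q_1)\times\mathrm U(p-p_1,q-q_1)$. $S\subseteq V$ is isotropic if $S\perp S$; $\mathrm{Gr}_G(r)$ is the set (projective variety) of $r$-dimensional isotropic subspaces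 of $V$. $\mathrm{Rad}(X)=X\cap X^\perp$. $\mathbf P_US=(S+W)\cap U$ and $\mathbf P_WS=(S+U)\cap W$ are the projections of $S$. The quotients $\frac{\mathbf P_US}{\mathrm{Rad}(\mathbf P_US)}$, $\frac{\mathrm{Rad}(\mathbf P_US)^\perp\cap U}{\mathrm{Rad}(\mathbf P_US)}$, $\frac{(\mathbf P_US)^\perp\cap U}{\mathrm{Rad}(\mathbf P_US)}$ (and their $W$-analogues) carry the nondegenerate forms induced by $B$. Invariants of $S\in\mathrm{Gr}_G(r)$: $r_U(S)=\dim(S\cap U)$; $r_W(S)=\dim(S\cap W)$; $a(S)=\dim\frac{\mathrm{Rad}(\mathbf P_US)}{S\cap U}=\dim\frac{\mathrm{Rad}(\mathbf P_WS)}{S\cap W}$; $b(S)=\dim\frac{\mathbf P_US}{\mathrm{Rad}(\mathbf P_US)}=\dim\frac{\mathbf P_WS}{\mathrm{Rad}(\mathbf P_WS)}$. In cases (R), (U): $b_U(S)$ (resp. $b_W(S)$) is the dimension of a maximal positive definite (resp. negative definite) subspace of $\mathbf P_US$; equivalently of a maximal negative definite (resp. positive definite) subspace of $\mathbf P_WS$; and $b=b_U+b_W$. Adapted bases (write $r_U,r_W,a,b$ for the invariants of $S$). $\mathcal B_U=\{\hat u_1,\dots,\hat u_{\dim U}\}$ is a basis of $U$ such that each of $S\cap U\subseteq \mathrm{Rad}(\mathbf P_US)\subseteq\mathbf P_US\subseteq\mathrm{Rad}(\mathbf P_US)^\perp\cap U\subseteq(S\cap U)^\perp\cap U\subseteq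 U$ is spanned by the first few vectors of $\mathcal B_U$, and $\hat u_i\perp\mathbf P_US$ for $r_U+a+b+1\le i\le\dim U-r_U-a$. For $i=1,\dots,a+b$ choose $\hat w_{r_W+i}\in\mathbf P_WS$ with $\hat u_{r_U+i}+\hat w_{r_W+i}\in S$, and extend these to a basis $\mathcal B_W=\{\hat w_1,\dots,\hat w_{\dim W}\}$ of $W$ such that each of $S\cap W\subseteq \mathrm{Rad}(\mathbf P_WS)\subseteq\mathbf P_WS\subseteq\mathrm{Rad}(\mathbf P_WS)^\perp\cap W\subseteq(S\cap W)^\perp\cap W\subseteq W$ is spanned by the first few vectors of $\mathcal B_W$, and $\hat w_i\perp\mathbf P_WS$ for $r_W+a+b+1\le i\le\dim W-r_W-a$. In the block matrices, the diagonal block sizes are $r_U,\,a,\,b,\,\dim U-2r_U-2a-b,\,a,\,r_U$ for $h_U$ and $r_W,\,a,\,b,\,\dim W-2r_W-2a-b,\,a,\,r_W$ for $h_W$; blank blocks are zero; matrices act on coordinate columns. Here $A_{11},A_{66}\in\mathrm{GL}_{r_U}(K)$ determine each other, $A_{22},A_{55}\in\mathrm{GL}_a(K)$ determine each other, $A_{33}\in G\big(\frac{\mathbf P_US}{\mathrm{Rad}(\mathbf P_US)}\big)$ and $A_{44}\in G\big(\frac{(\mathbf P_US)^\perp\cap U}{\mathrm{Rad}(\mathbf P_US)}\big)$; similarly for the $B_{ij}$ with $W$ in place of $U$. Dimensions of groups are dimensions as algebraic groups over $K$ in cases (Sp), (O), and real dimensions in cases (R), (U); $\dim\mathrm{Hom}$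 and $\dim\mathrm{GL}$ in (4) are computed in the same sense (so real dimension in case (U)). *)

(* Defs.v *)
From HB Require Import structures.
From mathcomp Require Import all_boot all_order all_algebra.
From mathcomp Require Import boolp classical_sets functions cardinality reals.
From mathcomp Require Import complex.
From mathcomp Require Import mpoly.

Set Implicit Arguments.
Unset Strict Implicit.
Unset Printing Implicit Defensive.

Import Order.TTheory GRing.Theory Num.Theory.

Local Open Scope classical_set_scope.
Local Open Scope ring_scope.

Section AlgebraicDimension.
Variables (F : fieldType) (N : nat).

(* The restrictions to A of the polynomials f_0, ..., f_(d-1), seen in the
   coordinate ring F[x_0, ..., x_(N-1)] / I(A), are algebraically independent
   over F. *)
Definition alg_indep_on (A : set ('I_N -> F)) (d : nat)
    (f : 'I_d -> {mpoly F[N]}) : Prop :=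
  forall P : {mpoly F[d]},
    (forall x, A x -> P.@[fun i => (f i).@[x]] = 0) -> P = 0.

(* Dimension of the Zariski closure of A in affine N-space: transcendence degree
   over F of the coordinate ring F[x_0, ..., x_(N-1)] / I(A).  More than N
   polynomials in N variables are always dependent, hence the range of d.
   For the groups of F-points considered here, which are Zariski dense in the
   algebraic group they come from, this is the dimension of the algebraic
   group; over F = R it is the dimension as a real algebraic set, hence as a
   Lie group. *)
Definition zdim (A : set ('I_N -> F)) : nat :=
  \max_(d < N.+1 | `[< exists f : 'I_d -> {mpoly F[N]}, alg_indep_on A f >]) d.

End AlgebraicDimension.

Definition coords (K : fieldType) (E : vectType K) (x : E) :
    'I_(\dim (fullv : {vspace E})) -> K :=
  fun i => coord (vbasis fullv) i x.

Definition dim_over (K : fieldType) (E : vectType K) (A : set E) : nat :=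
  zdim (@coords K E @` A).

Definition real_coords (R : rcfType) (E : vectType R[i]) (x : E) :
    'I_(\dim (fullv : {vspace E}) + \dim (fullv : {vspace E})) -> R :=
  fun k => match fintype.split k with
           | inl i => complex.Re (coords x i)
           | inr i => complex.Im (coords x i)
           end.

Definition real_dim (R : rcfType) (E : vectType R[i]) (A : set E) : nat :=
  zdim (@real_coords R E @` A).

Section Forms.
Variables (K : fieldType) (eps : bool) (theta : {rmorphism K -> K}).

(* An element is injective, hence invertible, as soon as f is nondegenerate. *)
Definition isog (E : vectType K) (f : {hermitian E for eps & theta}) :
    set 'End(E) :=
  [set g | isometry f f g].

Variables (V : vectType K) (B : {hermitian V for eps & theta}).
Implicit Types (U W S X Y : {vspace V}).

Section Restriction.
Variable X : {vspace V}.

Definition resform (x y : subvs_of X) : K := B (vsval x) (vsval y).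

Fact resform_zmodl y : zmod_morphism (resform^~ y).
Proof. by move=> x x'; rewrite /resform linearB linearBl. Qed.
Fact resform_zmodr x : zmod_morphism (resform x).
Proof. by move=> y y'; rewrite /resform !linearB. Qed.
Fact resform_scalel y : scalable_for *%R (resform^~ y).
Proof. by move=> c x; rewrite /resform linearZ /= linearZl_LR. Qed.
Fact resform_scaler x : scalable_for (theta \; *%R) (resform x).
Proof. by move=> c y; rewrite /resform !linearZ. Qed.
HB.instance Definition _ := isBilinear.Build K (subvs_of X) (subvs_of X) K
  *%R (theta \; *%R) resform
  resform_zmodl resform_zmodr resform_scalel resform_scaler.

Fact resform_herm x y : resform x y = (-1) ^+ eps * theta (resform y x).
Proof. exact: hermC. Qed.
HB.instance Definition _ := isHermitianSesquilinear.Build K (subvs_of X)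
  eps theta resform resform_herm.

End Restriction.

Definition isogv X : set 'End(subvs_of X) := isog (@resform X).

Definition GLv X : set 'End(subvs_of X) := [set g | lker g == 0%VS].

Definition orthodecomp U W : Prop :=
  [/\ (U + W)%VS = fullv, (U :&: W)%VS = 0%VS & (U <= orthov B W)%VS].

(* For Y <= X, the quotient X / Y is modelled by the library's complement
   X :\: Y of Y in X, through the projection quo_map along Y.  If moreover
   Y <= Rad X, the restriction of B to the complement is the form induced by B
   on X / Y. *)
Definition quo X Y : {vspace V} := (X :\: Y)%VS.

Definition quo_map X Y (v : V) : subvs_of (quo X Y) :=
  vsproj (quo X Y) (addv_pi1 X Y v).

Definition isotropic S : Prop := (S <= orthov B S)%VS.

Definition Gr (r : nat) : set {vspace V} := [set S | isotropic S /\ \dim S = r].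

Definition Rad X : {vspace V} := (X :&: orthov B X)%VS.

(* [Proj U W S] is P_U S, and [Proj W U S] is P_W S. *)
Definition Proj U W S : {vspace V} := ((S + W) :&: U)%VS.

Definition inv_r U S : nat := \dim (S :&: U).

Definition inv_a U W S : nat := \dim (quo (Rad (Proj U W S)) (S :&: U)).

Definition inv_b U W S : nat := \dim (quo (Proj U W S) (Rad (Proj U W S))).

Definition is_dprod U W (h : 'End(V)) (hU : 'End(subvs_of U))
    (hW : 'End(subvs_of W)) : Prop :=
  (forall u, h (vsval u) = vsval (hU u)) /\
  (forall w, h (vsval w) = vsval (hW w)).

Definition Hgrp U W : set 'End(V) :=
  [set h | exists hU hW, [/\ isogv hU, isogv hW & @is_dprod U W h hU hW]].

Definition Horbit U W S : set {vspace V} :=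
  [set S' | exists2 h : 'End(V), Hgrp U W h & S' = (h @: S)%VS].

Definition Hstab U W S : set 'End(V) :=
  [set h | Hgrp U W h /\ (h @: S)%VS = S].

Definition translate (h : 'End(V)) (C : set 'End(V)) : set 'End(V) :=
  [set (h \o c)%VF | c in C].

Definition Hcosets U W S : set (set 'End(V)) :=
  [set translate h (Hstab U W S) | h in Hgrp U W].

Definition orbit_iso_cosets U W S : Prop :=
  exists phi : set 'End(V) -> {vspace V},
    set_bij (Hcosets U W S) (Horbit U W S) phi /\
    (forall h C, Hgrp U W h -> Hcosets U W S C ->
       phi (translate h C) = (h @: phi C)%VS).

Definition spanned_by_first (e : seq V) X : Prop :=
  exists k, X = <<take k e>>%VS.

Definition flag_basis U W S (e : seq V) : Prop :=
  let P := Proj U W S in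
  [/\ basis_of U e,
      spanned_by_first e (S :&: U)%VS /\ spanned_by_first e (Rad P),
      spanned_by_first e P /\ spanned_by_first e (orthov B (Rad P) :&: U)%VS,
      spanned_by_first e (orthov B (S :&: U) :&: U)%VS &
      forall i, (inv_r U S + inv_a U W S + inv_b U W S <= i <
                 \dim U - inv_r U S - inv_a U W S)%N ->
        e`_i \in orthov B P].

Definition adapted U W S (eU eW : seq V) : Prop :=
  [/\ flag_basis U W S eU, flag_basis W U S eW &
      forall i, (i < inv_a U W S + inv_b U W S)%N ->
        eW`_(inv_r W S + i) \in Proj W U S /\
        eU`_(inv_r U S + i) + eW`_(inv_r W S + i) \in S].

Definition mx_in_basis U (e : (\dim U).-tuple V) (g : 'End(subvs_of U)) :
    'M[K]_(\dim U) :=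
  \matrix_(i, j) coord e i (vsval (g (vsproj U e`_j))).

(* Block (k, l), counted from 0, of M cut according to the sizes s. *)
Definition block n (M : 'M[K]_n) (s : seq nat) (k l : nat) :
    'M[K]_(nth 0%N s k, nth 0%N s l) :=
  \matrix_(i, j)
    if insub (sumn (take k s) + i)%N is Some i' then
      if insub (sumn (take l s) + j)%N is Some j' then M i' j' else 0
    else 0.

(* A is the matrix, in the basis of X / Y given by the classes of
   e_o, ..., e_(o+n-1), of an element of G(X / Y). *)
Definition mx_isog_quo X Y (e : seq V) (o n : nat) (A : 'M[K]_n) : Prop :=
  exists2 g, isogv g &
    forall j : 'I_n,
      g (quo_map X Y e`_(o + j)) =
      \sum_(i < n) A i j *: quo_map X Y e`_(o + i).

(* The sizes for W are obtained from the a and b of the U side, as they are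
   shared by both matrices. *)
Definition block_sizes (dimX rX a b : nat) : seq nat :=
  [:: rX; a; b; dimX - (rX.*2 + a.*2 + b); a; rX]%N.

Definition block_shape U W S (a b : nat) (e : (\dim U).-tuple V)
    (M : 'M[K]_(\dim U)) : Prop :=
  let r := inv_r U S in
  let s := block_sizes (\dim U) r a b in
  let P := Proj U W S in
  [/\ (forall k l, (l < k < 6)%N -> block M s k l = 0) /\ block M s 2 3 = 0,
      block M s 0 0 \in unitmx /\ block M s 5 5 \in unitmx,
      block M s 1 1 \in unitmx /\ block M s 4 4 \in unitmx,
      mx_isog_quo P (Rad P) e (r + a) (block M s 2 2) &
      mx_isog_quo (orthov B P :&: U)%VS (Rad P) e (r + a + b)
        (block M s 3 3)].

Definition levi_block n (M : 'M[K]_n) (rX a b : nat) : 'M[K]_(a + b) :=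
  let s := block_sizes n rX a b in
  block_mx (block M s 1 1) (block M s 1 2) 0 (block M s 2 2).

Definition Hstab_description U W S : Prop :=
  forall (eU : (\dim U).-tuple V) (eW : (\dim W).-tuple V),
  adapted U W S eU eW ->
  let a := inv_a U W S in
  let b := inv_b U W S in
  let rU := inv_r U S in
  let rW := inv_r W S in
  let sU := block_sizes (\dim U) rU a b in
  let sW := block_sizes (\dim W) rW a b in
  (forall h : 'End(V), Hstab U W S h <->
     exists hU hW,
       let MU := mx_in_basis eU hU in
       let MW := mx_in_basis eW hW in
       [/\ isogv hU /\ isogv hW,
           is_dprod h hU hW,
           @block_shape U W S a b eU MU,
           @block_shape W U S a b eW MW &
           levi_block MU rU a b = levi_block MW rW a b]) /\
  (forall h h' hU hU' hW hW',
     Hstab U W S h -> Hstab U W S h' ->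
     is_dprod h hU hW -> is_dprod h' hU' hW' ->
     let MU := mx_in_basis eU hU in
     let MU' := mx_in_basis eU hU' in
     let MW := mx_in_basis eW hW in
     let MW' := mx_in_basis eW hW' in
     [/\ block MU sU 0 0 = block MU' sU 0 0 <->
           block MU sU 5 5 = block MU' sU 5 5,
         block MU sU 1 1 = block MU' sU 1 1 <->
           block MU sU 4 4 = block MU' sU 4 4,
         block MW sW 0 0 = block MW' sW 0 0 <->
           block MW sW 5 5 = block MW' sW 5 5 &
         block MW sW 1 1 = block MW' sW 1 1 <->
           block MW sW 4 4 = block MW' sW 4 4]).

Definition Hstab_dim_formula (dim : forall E : vectType K, set E -> nat)
    U W S : Prop :=
  let PU := Proj U W S in
  let PW := Proj W U S in
  let dG X : rat := (dim _ (@isogv X))%:R in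
  let dGL X : rat := (dim _ (@GLv X))%:R in
  let dHom X Y : rat := (dim _ [set: 'Hom(subvs_of X, subvs_of Y)])%:R in
  (dim _ (Hstab U W S))%:R =
    2^-1 * (dG U + dG W
            - dG (quo (orthov B (Rad PU) :&: U)%VS (Rad PU))
            - dG (quo (orthov B (Rad PW) :&: W)%VS (Rad PW)))
    + dG (quo (orthov B PU :&: U)%VS (Rad PU))
    + dG (quo (orthov B PW :&: W)%VS (Rad PW))
    + dG (quo PU (Rad PU))
    + 2^-1 * (dGL (S :&: U)%VS + dGL (S :&: W)%VS)
    - dHom (quo (Rad PU) (S :&: U)%VS) (quo PU (Rad PU)).

End Forms.

Arguments isogv {K eps theta V} B X.

Section Signature.
Variables (K : numFieldType) (eps : bool) (theta : {rmorphism K -> K}).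
Variables (V : vectType K) (B : {hermitian V for eps & theta}).
Implicit Types (U W S X Y : {vspace V}).

Definition pos_definite Y : Prop :=
  forall v, v \in Y -> v != 0 -> 0 < B v v.

Definition neg_definite Y : Prop :=
  forall v, v \in Y -> v != 0 -> B v v < 0.

Definition pos_index X : nat :=
  \max_(d < (\dim X).+1 |
    `[< exists Y, [/\ (Y <= X)%VS, pos_definite Y & \dim Y = d] >]) d.

Definition neg_index X : nat :=
  \max_(d < (\dim X).+1 |
    `[< exists Y, [/\ (Y <= X)%VS, neg_definite Y & \dim Y = d] >]) d.

Definition has_signature X (p q : nat) : Prop :=
  pos_index X = p /\ neg_index X = q.

Definition inv_bU U W S : nat := pos_index (Proj U W S).
Definition inv_bW U W S : nat := neg_index (Proj U W S).

End Signature.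

Section Conclusions.
Variables (K : fieldType) (eps : bool) (theta : {rmorphism K -> K}).
Variables (V : vectType K) (B : {hermitian V for eps & theta}).
Variables (U W : {vspace V}) (r : nat).

Definition classified_by (T : Type) (inv : {vspace V} -> T) : Prop :=
  forall S S', Gr B r S -> Gr B r S' -> (Horbit B U W S S' <-> inv S = inv S').

Definition inv4 (S : {vspace V}) : nat * nat * nat * nat :=
  (inv_r U S, inv_r W S, inv_a B U W S, inv_b B U W S).

Definition stabilizers_described
    (dim : forall E : vectType K, set E -> nat) : Prop :=
  forall S, Gr B r S ->
    [/\ orbit_iso_cosets B U W S,
        Hstab_description B U W S &
        Hstab_dim_formula B dim U W S].

End Conclusions.

Definition inv5 (K : numFieldType) (eps : bool) (theta : {rmorphism K -> K})
    (V : vectType K) (B : {hermitian V for eps & theta}) (U W S : {vspace V}) :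
    nat * nat * nat * nat * nat :=
  (inv_r U S, inv_r W S, inv_a B U W S, inv_bU B U W S, inv_bW B U W S).

(* Main.v *)
(* The restriction of B to U and minus its restriction to W agree on the two projections of
   an isotropic S.  Lifting a basis of S and completing the radical part to hyperbolic pairs
   gives bases of U and W in which the Gram matrix is standard and S is spanned by vectors of
   three kinds: u, w, and u + w with u and w of the same index.  Two subspaces with the same
   invariants have frames with the same Gram matrices, so the linear map between the frames
   lies in H; in the indefinite cases the signatures of U, W and P_U S determine those of the
   diagonal blocks (Sylvester's law of inertia).  For h = h_U x h_W, h S = S means that h_U
   and h_W preserve the flags of S and that they induce the same map through the graph of the
   correspondence between P_U S modulo S meet U and P_W S modulo S meet W; the blocks on
   dual parts of a flag are determined by each other.

   For the dimension, call d the dimension of a family of functions s on T when s contains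
   d algebraically independent polynomials and the polynomials of degree D in s span a space
   of dimension O(D^d).  Noether normalization shows that d exists, and rational maps with
   nonvanishing denominators do not increase it.  If g - 1 is invertible, g lies in the
   stabilizer if and only if y = (g - 1)^-1 satisfies the affine equations
   B(yu, v) + B(u, yv) = -B(u, v), y U <= U, y W <= W, y S <= S.  This chart, which unlike the
   Cayley transform also exists in characteristic 2, and finitely many of its translates
   cover the group, whose dimension is thus that of the space of skew x preserving U, W and S.
   In a frame the entries B(x e_i, e_j) reduce this last dimension to a count. *)
Require Import Defs.
From HB Require Import structures.
From mathcomp Require Import all_boot all_order all_algebra.
From mathcomp Require Import boolp classical_sets functions cardinality reals.
From mathcomp Require Import complex.
From mathcomp Require Import mpoly.
From mathcomp Require Import zify ring lra.

Set Implicit Arguments.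
Unset Strict Implicit.
Unset Printing Implicit Defensive.

Import Order.TTheory GRing.Theory Num.Theory.

Local Open Scope classical_set_scope.
Local Open Scope ring_scope.

(** * Dimension of parametrized sets *)

(** [zdim] speaks of points over a field that is only infinite, so the argument works with functions
    on an arbitrary parameter type. An upper bound ([growth]) and a lower bound ([indep]) travel in
    opposite directions along a rational parametrization, which replaces the dimension theory of
    varieties. Coordinates over F of spaces over K, linked by [iota : F -> K], treat dimensions over
    K and real dimensions of complex groups at once. The four cases enter only through a few
    parameters: a splitting of Gram matrices as h + h^* (half of the matrix, or its upper triangle
    when the form is alternating, which keeps characteristic 2), standard Gram matrices [J t n],
    diagonal isometries of these without eigenvalue 1, and the number of coordinates of a scalar
    allowed on the diagonal of a skew matrix. The diagonal isometries assemble to some g0 in the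
    stabilizer with g0 - 1 invertible, which ensures that the chart is not empty. G(X) itself is the
    stabilizer of 0 for the decomposition of X as X and 0, so one count yields every isometry group
    in the dimension formula. *)

Section PolynomialFunctions.
Variable F : fieldType.
Implicit Types T J : Type.

(* [deg_le s D f]: f is a polynomial of degree at most D in the functions s j. *)
Inductive deg_le T J (s : J -> T -> F) : nat -> (T -> F) -> Prop :=
| deg_cst c D f : (forall t, f t = c) -> deg_le s D f
| deg_add D f g h : deg_le s D f -> deg_le s D g ->
    (forall t, h t = f t + g t) -> deg_le s D h
| deg_mulvar D j f h : deg_le s D f -> (forall t, h t = s j t * f t) ->
    deg_le s D.+1 h.

Section Closure.
Variables (T J : Type) (s : J -> T -> F).

Lemma deg_le_ext D f g : deg_le s D f -> f =1 g -> deg_le s D g.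
Proof.
move=> Df eqfg; apply: (deg_add Df (g := fun=> 0)); first exact: deg_cst.
by move=> t; rewrite addr0 eqfg.
Qed.

Lemma deg_leW D D' f : (D <= D')%N -> deg_le s D f -> deg_le s D' f.
Proof.
move=> leD Df; elim: Df D' leD => {D f} [c D f fc|D f g h _ IHf _ IHg hE|D j f h _ IH hE] D' leD.
- exact: deg_cst fc.
- by apply: deg_add hE; [apply: IHf|apply: IHg].
- by case: D' leD => // D' leD; apply: deg_mulvar hE; apply: IH.
Qed.

Lemma deg_le_var j : deg_le s 1 (s j).
Proof.
by apply: (@deg_mulvar _ _ s 0 j (fun=> 1)) => [|t]; [exact: deg_cst|rewrite mulr1].
Qed.

Lemma deg_leM D D' f g : deg_le s D f -> deg_le s D' g ->
  deg_le s (D + D') (fun t => f t * g t).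
Proof.
move=> Df; elim: Df D' g => {D f} [c D f fc|D f g h _ IHf _ IHg hE|D j f h _ IH hE] D' g' Dg.
- suff: deg_le s D' (fun t => f t * g' t) by apply: deg_leW; rewrite leq_addl.
  elim: Dg => {D' g'} [c' D' f' fc'|D' f1 g1 h1 _ IHf _ IHg hE|D' j f1 h _ IH hE].
  + by apply: (@deg_cst _ _ _ (c * c')) => t; rewrite fc fc'.
  + by apply: deg_add IHf IHg _ => t; rewrite hE mulrDr.
  + by apply: deg_mulvar IH _ => t; rewrite hE mulrCA.
- by apply: deg_add (IHf _ _ Dg) (IHg _ _ Dg) _ => t; rewrite hE mulrDl.
- by apply: (deg_mulvar (IH _ _ Dg)) => t; rewrite hE mulrA.
Qed.

Lemma deg_leZ D c f : deg_le s D f -> deg_le s D (fun t => c * f t).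
Proof. by move=> Df; apply: (@deg_leM 0 D (fun=> c)) => //; exact: deg_cst. Qed.

Lemma deg_le_sum (I : Type) (r : seq I) (P : pred I) D (f : I -> T -> F) :
  (forall i, P i -> deg_le s D (f i)) ->
  deg_le s D (fun t => \sum_(i <- r | P i) f i t).
Proof.
move=> Df; elim: r => [|i r IH]; first by apply: (@deg_cst _ _ _ 0) => t; rewrite big_nil.
case Pi: (P i); last by apply: deg_le_ext IH _ => t; rewrite big_cons Pi.
by apply: (deg_add (Df i Pi) IH) => t; rewrite big_cons Pi.
Qed.

Lemma deg_le_prod (I : Type) (r : seq I) (D : I -> nat) (f : I -> T -> F) :
  (forall i, deg_le s (D i) (f i)) ->
  deg_le s (\sum_(i <- r) D i) (fun t => \prod_(i <- r) f i t).
Proof.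
move=> Df; elim: r => [|i r IH]; first by apply: (@deg_cst _ _ _ 1) => t; rewrite big_nil.
rewrite big_cons; apply: deg_le_ext (deg_leM (Df i) IH) _ => t.
by rewrite big_cons.
Qed.

Lemma deg_leX D f n : deg_le s D f -> deg_le s (n * D) (fun t => f t ^+ n).
Proof.
move=> Df; elim: n => [|n IH]; first by apply: (@deg_cst _ _ _ 1).
by rewrite mulSn; apply: deg_le_ext (deg_leM Df IH) _ => t; rewrite exprS.
Qed.

Lemma deg_le_pull T' (phi : T' -> T) D f : deg_le s D f ->
  deg_le (fun j t => s j (phi t)) D (f \o phi).
Proof.
elim=> {D f} [c D f fc|D f g h _ IHf _ IHg hE|D j f h _ IH hE].
- by apply: (@deg_cst _ _ _ c) => t /=.
- by apply: deg_add IHf IHg _ => t /=.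
- by apply: deg_mulvar IH _ => t /=; apply: hE.
Qed.

(** Clears denominators: if each s'_j is a polynomial in s divided by q, one factor q pays for each
    variable, so q^D times a polynomial of degree D in s' has degree at most D k in s. *)
Lemma deg_le_subst J' (s' : J' -> T -> F) (q : T -> F) k D f :
  deg_le s k q -> (forall j, deg_le s k (fun t => q t * s' j t)) ->
  deg_le s' D f -> deg_le s (D * k) (fun t => q t ^+ D * f t).
Proof.
move=> Dq Ds'; elim=> {D f} [c D f fc|D f g h _ IHf _ IHg hE|D j f h _ IH hE].
- apply: deg_le_ext (deg_leZ c (deg_leX D Dq)) _ => t.
  by rewrite fc mulrC.
- by apply: deg_add IHf IHg _ => t; rewrite hE mulrDr.
- rewrite mulSn; apply: deg_le_ext (deg_leM (Ds' j) IH) _ => t.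
  by rewrite hE exprS; ring.
Qed.

Lemma deg_le_comp J' (s' : J' -> T -> F) k D f :
  (forall j, deg_le s k (s' j)) -> deg_le s' D f -> deg_le s (D * k) f.
Proof.
move=> Ds' Df.
have := @deg_le_subst J' s' (fun=> 1) k D f _ _ Df.
have D1 : deg_le s k (fun=> 1) by exact: deg_cst.
move=> /(_ D1) H; apply: deg_le_ext (H _) _ => [j|t].
  by apply: deg_le_ext (Ds' j) _ => t; rewrite mul1r.
by rewrite expr1n mul1r.
Qed.

End Closure.

Lemma deg_le_monomial T N (s : 'I_N -> T -> F) (m : 'X_{1..N}) :
  deg_le s (mdeg m) (fun t => \prod_i s i t ^+ m i).
Proof.
rewrite mdegE; apply: deg_leW (deg_le_prod _ (D := fun i => (m i * 1)%N) _) => //.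
  by apply: leq_sum => i _; rewrite muln1.
by move=> i; apply/deg_leX/deg_le_var.
Qed.

Lemma deg_le_meval T N (s : 'I_N -> T -> F) (p : {mpoly F[N]}) :
  deg_le s (msize p) (fun t => p.@[fun i => s i t]).
Proof.
apply: (@deg_le_ext _ _ _ _ (fun t =>
  \sum_(m <- msupp p | m \in msupp p) p@_m * \prod_i s i t ^+ m i)).
  apply: deg_le_sum => m pm; apply: deg_leZ.
  by apply: deg_leW (deg_le_monomial s m); exact/ltnW/msize_mdeg_lt.
by move=> t; rewrite mevalE -big_seq.
Qed.

Lemma meval_deg_le T N (s : 'I_N -> T -> F) D f : deg_le s D f ->
  exists p : {mpoly F[N]}, forall t, f t = p.@[fun i => s i t].
Proof.
elim=> {D f} [c D f fc|D f g h _ [p pE] _ [q qE] hE|D j f h _ [p pE] hE].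
- by exists c%:MP => t; rewrite mevalC fc.
- by exists (p + q) => t; rewrite mevalD hE pE qE.
- by exists ('X_j * p) => t; rewrite mevalM mevalXU hE pE.
Qed.

(** The spanning functions need not be polynomial; only the members of Q are expanded in them. This
    freedom lets spanning families be divided by denominators and extended by zero from a piece of a
    cover. *)
Definition bspan T (Q : (T -> F) -> Prop) n : Prop :=
  exists (I : finType) (e : I -> T -> F), (#|I| <= n)%N /\
    forall f, Q f -> exists c : I -> F, forall t, f t = \sum_i c i * e i t.

(** An upper bound for the dimension, as [indep] is a lower bound; [growth_indep] makes the d of
    [isdim] unique. *)
Definition growth T J (s : J -> T -> F) d : Prop :=
  exists C, forall D, bspan (deg_le s D) (C * D.+1 ^ d).

Definition indep T J (s : J -> T -> F) d : Prop :=
  exists (k : nat) (f : 'I_d -> T -> F), (forall i, deg_le s k (f i)) /\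
    forall P : {mpoly F[d]}, (forall t, P.@[fun i => f i t] = 0) -> P = 0.

Definition isdim T J (s : J -> T -> F) d : Prop := growth s d /\ indep s d.

Lemma bspanW T (Q Q' : (T -> F) -> Prop) n n' : (n <= n')%N ->
  (forall f, Q' f -> Q f) -> bspan Q n -> bspan Q' n'.
Proof.
move=> len QQ' [I [e [cI eP]]]; exists I, e; split; first exact: leq_trans len.
by move=> f /QQ'/eP.
Qed.

Lemma bspan_free (I : finType) T (Q : (T -> F) -> Prop) n (f : I -> T -> F) :
  bspan Q n -> (forall i, Q (f i)) ->
  (forall c : I -> F, (forall t, \sum_i c i * f i t = 0) -> c =1 fun=> 0) ->
  (#|I| <= n)%N.
Proof.
move=> [J [e [cJ eP]]] Qf ffree; apply: leq_trans cJ.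
have [c cP] := choice (fun i => eP _ (Qf i)).
pose M : 'M[F]_(#|I|, #|J|) := \matrix_(i, j) c (enum_val i) (enum_val j).
suff /eqP <- : row_free M by exact: rank_leq_col.
rewrite -kermx_eq0; apply/eqP/row_matrixP => k; rewrite row0.
set v := row k _.
have vM : v *m M = 0 by apply/eqP; rewrite -sub_kermx row_sub.
apply/rowP => i; rewrite [RHS]mxE.
suff /ffree/(_ (enum_val i)) : forall t, \sum_i v 0 (enum_rank i) * f i t = 0.
  by rewrite /= enum_valK.
move=> t.
under eq_bigr => j _ do rewrite cP mulr_sumr.
rewrite exchange_big big1 // => j _ /=.
have /rowP/(_ (enum_rank j)) := vM; rewrite !mxE => vM0.
transitivity ((\sum_j0 v 0 j0 * M j0 (enum_rank j)) * e j t); last by rewrite vM0 mul0r.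
rewrite mulr_suml (reindex _ (onW_bij _ (@enum_rank_bij I))) /=.
by apply: eq_bigr => i0 _; rewrite [M _ _]mxE !enum_rankK mulrA.
Qed.

(** The monomials with exponents at most E in d' independent functions of degree k are linearly
    independent, number (E + 1)^d' and have degree at most E d' k. If d < d', they outnumber C (E d'
    k + 1)^d for large E. *)
Lemma growth_indep T J (s : J -> T -> F) d d' :
  growth s d -> indep s d' -> (d' <= d)%N.
Proof.
move=> [C CP] [k [f [fk find]]]; rewrite leqNgt; apply/negP => ltdd'.
(* This E satisfies (E + 1)^d E = C ((E + 1)(d' k + 1))^d, which is at least C (E d' k + 1)^d and
   less than (E + 1)^(d + 1). *)
pose E := (C * (d' * k).+1 ^ d)%N; pose I := {ffun 'I_d' -> 'I_E.+1}.
pose m (a : I) : 'X_{1..d'} := [multinom (a i : nat) | i < d'].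
have minj : injective m.
  move=> a b /mnmP eqm; apply/ffunP => i; apply/val_inj.
  by have := eqm i; rewrite !mnmE.
pose g (a : I) t := \prod_i f i t ^+ m a i.
have := @bspan_free I T _ _ g (CP (E * d' * k)%N) _ _.
have gk (a : I) : deg_le s (E * d' * k) (g a).
  have mE : (mdeg (m a) <= E * d')%N.
    rewrite mdegE; apply: leq_trans (_ : \sum_(i < d') E <= _)%N.
      by apply: leq_sum => i _; rewrite mnmE -ltnS.
    by rewrite sum_nat_const card_ord mulnC.
  apply: deg_leW (deg_le_comp fk (deg_le_monomial f (m a))).
  by rewrite leq_mul2r mE orbT.
have gfree (c : I -> F) : (forall t, \sum_a c a * g a t = 0) -> c =1 fun=> 0.
  move=> c0 b; pose P : {mpoly F[d']} := \sum_a c a *: 'X_[m a].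
  have /(congr1 (mcoeff (m b))) : P = 0.
    apply: find => t; rewrite -[RHS](c0 t) raddf_sum /=.
    by apply: eq_bigr => a _; rewrite mevalZ mevalX.
  rewrite mcoeff0 raddf_sum /= (bigD1 b) //= big1 ?addr0 => [|a neab].
    by rewrite mcoeffZ mcoeffX eqxx mulr1.
  by rewrite mcoeffZ mcoeffX (inj_eq minj) (negPf neab) mulr0.
move=> /(_ gk gfree); rewrite card_ffun !card_ord; apply/negP; rewrite -ltnNge.
apply: leq_trans (_ : E.+1 ^ d.+1 <= _)%N; last by rewrite leq_pexp2l.
rewrite expnSr; apply: leq_ltn_trans (_ : E.+1 ^ d * E < _)%N; last first.
  by rewrite ltn_pmul2l ?expn_gt0.
have -> : (E.+1 ^ d * E = C * (E.+1 * (d' * k).+1) ^ d)%N.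
  by rewrite {2}/E mulnCA -expnMn.
rewrite leq_mul2l; apply/orP; right.
have: (E * d' * k < E.+1 * (d' * k).+1)%N by nia.
case: (d) => [|d1]; first by rewrite !expn0.
by rewrite leq_exp2r.
Qed.

End PolynomialFunctions.

(** * Noether normalization *)

Section NoetherNormalization.
Variable F : fieldType.
Hypothesis Finf : forall l : seq F, exists x, x \notin l.

Lemma horner_neq0 (p : {poly F}) : p != 0 -> exists x, p.[x] != 0.
Proof.
move=> p0; have [l [ul sl]] : exists l : seq F, uniq l /\ size l = size p.
  elim: (size p) => [|n [l [ul sl]]]; first by exists [::].
  by have [x xl] := Finf l; exists (x :: l); rewrite /= xl ul sl.
apply: contrapT => /forallNP px; have := max_poly_roots p0 _ ul.
rewrite sl ltnn => H; suff: false by []; apply: H.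
by apply/allP => x _; rewrite rootE; apply: contrapT => /negP; apply: px.
Qed.

Lemma meval_neq0 N (P : {mpoly F[N]}) : P != 0 -> exists v, P.@[v] != 0.
Proof.
elim: N P => [|N IH] P P0.
  exists (fun=> 0); rewrite (nvar0_mpolyC P) mevalC.
  by apply: contraNneq P0 => P0; rewrite (nvar0_mpolyC P) P0.
have [m0 m0P] : exists m, P@_m != 0.
  apply: contrapT => /forallNP H; move/negP: P0; apply; apply/eqP/mpolyP => m; rewrite mcoeff0.
  by apply/eqP; apply: contrapT => /negP; apply: H.
(* [res] forgets the exponent of the last variable, and q k is the coefficient of its k-th power in
   P. *)
pose res (m : 'X_{1..N.+1}) : 'X_{1..N} := [multinom m (widen_ord (leqnSn N) i) | i < N].
pose k0 := m0 ord_max.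
pose q k := \sum_(m <- msupp P | m ord_max == k) P@_m *: 'X_[F, res m].
have resE (m : 'X_{1..N.+1}) : m ord_max = k0 -> res m = res m0 -> m = m0.
  move=> mk /mnmP mm; apply/mnmP => i; have [iN|iN] := ltnP i N.
    have := mm (Ordinal iN); rewrite !mnmE.
    by rewrite (_ : widen_ord _ _ = i) //; apply/val_inj.
  by rewrite (_ : i = ord_max) //; apply/val_inj/eqP; rewrite eqn_leq iN -ltnS ltn_ord.
have qk0 : (q k0)@_(res m0) = P@_m0.
  rewrite raddf_sum big_mkcond (bigD1_seq m0) ?msupp_uniq ?mcoeff_msupp //=.
  rewrite eqxx mcoeffZ mcoeffX eqxx mulr1 big1 ?addr0 // => m mm.
  case: eqP => // mk; rewrite mcoeffZ mcoeffX; case: eqP => [/(resE _ mk)/eqP|_]; last by rewrite mulr0.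
  by rewrite (negPf mm).
have {qk0} /IH[v qv] : q k0 != 0.
  by apply: contraNneq m0P => q0; rewrite -qk0 q0 mcoeff0.
pose p : {poly F} := \sum_(m <- msupp P) (P@_m * \prod_i v i ^+ res m i) *: 'X^(m ord_max).
have /horner_neq0[x px] : p != 0.
  apply: contraNneq qv => /(congr1 (coefp k0)) /=; rewrite coef0 coef_sum => <-.
  rewrite raddf_sum big_mkcond /=; apply/eqP/eq_bigr => m _.
  by rewrite coefZ coefXn eq_sym; case: eqP => _; rewrite ?mulr0 // mulr1 mevalZ mevalX.
exists (fun i : 'I_N.+1 => if insub (i : nat) is Some j then v j else x).
apply: contraNneq px; rewrite mevalE => <-; rewrite horner_sum; apply/eqP/eq_bigr => m _.
rewrite hornerZ hornerXn big_ord_recr /= insubF ?ltnn // mulrA; congr (_ * _ * _).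
apply: eq_bigr => i _; rewrite mnmE; congr (_ ^+ _).
have iN : (widen_ord (leqnSn N) i < N)%N by rewrite /= ltn_ord.
by rewrite (insubT (fun k => (k < N)%N) iN); congr v; apply/val_inj.
Qed.

(* [weighted z s m D]: combinations of the z^j f, j < m, with f polynomial in s and
   j + deg f <= D. *)
Inductive weighted T J (z : T -> F) (s : J -> T -> F) (m : nat) : nat -> (T -> F) -> Prop :=
| weighted0 D f : (forall t, f t = 0) -> weighted z s m D f
| weighted_term j D' D f h : (j < m)%N -> (j + D' <= D)%N -> deg_le s D' f ->
    (forall t, h t = z t ^+ j * f t) -> weighted z s m D h
| weightedD D f g h : weighted z s m D f -> weighted z s m D g ->
    (forall t, h t = f t + g t) -> weighted z s m D h.

Section Weighted.
Variables (T J : Type) (z : T -> F) (s : J -> T -> F).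

Lemma weighted_ext m D f g : weighted z s m D f -> f =1 g -> weighted z s m D g.
Proof.
move=> wf fg; apply: (weightedD wf (g := fun=> 0)); first exact: weighted0.
by move=> t; rewrite addr0 fg.
Qed.

Lemma weightedW m m' D D' f : (m <= m')%N -> (D <= D')%N ->
  weighted z s m D f -> weighted z s m' D' f.
Proof.
move=> lem + wf; elim: wf D' => {D f} [D f f0|j E D f h jm jE Ef hE|D f g h _ IHf _ IHg hE] D' leD.
- exact: weighted0.
- by apply: weighted_term Ef hE; [apply: leq_trans lem|apply: leq_trans leD].
- by apply: weightedD hE; [apply: IHf|apply: IHg].
Qed.

Lemma weightedM m m' D D' f f' : weighted z s m D f -> weighted z s m' D' f' ->
  weighted z s (m + m').-1 (D + D') (fun t => f t * f' t).
Proof.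
move=> wf; elim: wf f' D' => {D f} [D f f0|j E D f h jm jE Ef hE|D f g h _ IHf _ IHg hE] f' D' wf'.
- by apply: weighted0 => t; rewrite f0 mul0r.
- elim: wf' => {D' f'} [D' f' f0|j' E' D' f' h' jm' jE' Ef' hE'|D' f1 g1 h1 _ IHf _ IHg hE1].
  + by apply: weighted0 => t; rewrite f0 mulr0.
  + apply: (@weighted_term _ _ _ _ _ (j + j') (E + E') _ (fun t => f t * f' t)); [lia|lia| |].
      exact: deg_leM.
    by move=> t; rewrite hE hE' exprD; ring.
  + by apply: weightedD IHf IHg _ => t; rewrite hE1 mulrDr.
- by apply: weightedD (IHf _ _ wf') (IHg _ _ wf') _ => t; rewrite hE mulrDl.
Qed.

Lemma weightedM_deg m D D' f g : weighted z s m D f -> deg_le s D' g ->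
  weighted z s m (D + D') (fun t => f t * g t).
Proof.
move=> wf Dg; have := weightedM wf (m' := 1) (f' := g) (D' := D').
rewrite addn1; apply; apply: (@weighted_term _ _ _ _ _ 0 D' _ g) => // t.
by rewrite mul1r.
Qed.

(** Multiplication by z raises the power by one; z^m, when it appears, is replaced by means of the
    relation, at the price of one degree. *)
Lemma weighted_reduce m D f : (0 < m)%N -> weighted z s m m (fun t => z t ^+ m) ->
  weighted z s m D f -> weighted z s m D.+1 (fun t => z t * f t).
Proof.
move=> m0 zm; elim=> {D f} [D f f0|j E D f h jm jE Ef hE|D f g h _ IHf _ IHg hE].
- by apply: weighted0 => t; rewrite f0 mulr0.
- have [jm'|] := ltnP j.+1 m.
    by apply: (weighted_term jm' _ Ef) => [|t]; [rewrite addSn|rewrite hE exprS mulrA].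
  move=> mj; have {jm mj}jE1 : j.+1 = m by apply/eqP; rewrite eqn_leq jm mj.
  apply: weighted_ext (weightedW (leqnn _) _ (weightedM_deg zm Ef)) _.
    by rewrite -jE1 addSn.
  by move=> t; rewrite hE -jE1 exprS mulrA.
- by apply: weightedD IHf IHg _ => t; rewrite hE mulrDr.
Qed.

Lemma bspan_weighted m D n : bspan (deg_le s D) n -> bspan (weighted z s m D) (m * n).
Proof.
move=> [I [e [cI eP]]].
exists ('I_m * I)%type, (fun (ji : 'I_m * I) t => z t ^+ ji.1 * e ji.2 t); split.
  by rewrite card_prod card_ord leq_mul2l cI orbT.
move=> f; move: {-2}D (leqnn D) => D0 leD0 wf.
elim: wf leD0 => {D0 f} [D0 f f0|j E D0 f h jm jE Ef hE|D0 f g h _ IHf _ IHg hE] leD0.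
- by exists (fun=> 0) => t; rewrite big1 ?f0 // => i _; rewrite mul0r.
- have [|c cE] := eP f; first by apply: deg_leW Ef; lia.
  exists (fun ji : 'I_m * I => (ji.1 == Ordinal jm)%:R * c ji.2) => t.
  rewrite (eq_bigr (fun ji : 'I_m * I => (ji.1 == Ordinal jm)%:R * c ji.2 *
     (z t ^+ ji.1 * e ji.2 t))) //.
  rewrite -(pair_bigA _ (fun j0 i => (j0 == Ordinal jm)%:R * c i * (z t ^+ j0 * e i t))) /=.
  rewrite (bigD1 (Ordinal jm)) //= [X in _ + X]big1 ?addr0 => [|j' /negPf ->]; last first.
    by rewrite big1 // => i _; rewrite !mul0r.
  by rewrite hE cE mulr_sumr; apply: eq_bigr => i _; rewrite eqxx mul1r mulrCA.
- have [c cE] := IHf leD0; have [c' cE'] := IHg leD0.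
  exists (fun i => c i + c' i) => t; rewrite hE cE cE' -big_split /=.
  by apply: eq_bigr => i _; rewrite mulrDl.
Qed.

(** The bound m D on the powers of z may depend on the degree: m D = D + 1 when z is one more free
    variable, a constant when z satisfies a monic equation. *)
Lemma deg_le_weighted J' (s' : J' -> T -> F) (m : nat -> nat) :
  (forall D, 0 < m D <= m D.+1)%N ->
  (forall j, exists w c, deg_le s 1 w /\ forall t, s' j t = w t + c * z t) ->
  (forall D f, weighted z s (m D) D f -> weighted z s (m D.+1) D.+1 (fun t => z t * f t)) ->
  forall D f, deg_le s' D f -> weighted z s (m D) D f.
Proof.
move=> mD s'E zw D f; elim=> {D f} [c D f fc|D f g h _ IHf _ IHg hE|D j f h _ IH hE].
- apply: (@weighted_term _ _ _ _ _ 0 0 D f) => //; last by move=> t; rewrite mul1r.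
    by case/andP: (mD D).
  exact: deg_cst fc.
- exact: weightedD IHf IHg hE.
have [w [c [Dw sE]]] := s'E j.
apply: (weightedD (f := fun t => w t * f t) (g := fun t => c * (z t * f t))).
- have := weightedM_deg IH Dw; rewrite addn1 => /(@weightedW _ (m D.+1) _ D.+1) wf.
  apply: weighted_ext (wf _ _) _ => //; first by case/andP: (mD D).
  by move=> t; rewrite mulrC.
- have Dc : deg_le s 0 (fun=> c) by exact: deg_cst.
  have := weightedM_deg (zw _ _ IH) Dc; rewrite addn0 => wf.
  by apply: weighted_ext wf _ => t; rewrite mulrC.
by move=> t; rewrite hE sE; ring.
Qed.

End Weighted.

Lemma growth_weighted T J J' (s : J -> T -> F) (s' : J' -> T -> F) z m d :
  (forall D f, deg_le s' D f -> weighted z s m D f) -> growth s d -> growth s' d.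
Proof.
move=> s's [C CP]; exists (m * C)%N => D; rewrite -mulnA.
by apply: bspanW (leqnn _) _ (bspan_weighted z m (CP D)); apply: s's.
Qed.

Lemma growth_free T N (s : 'I_N -> T -> F) : growth s N.
Proof.
elim: N s => [|N IH] s.
  exists 1%N => D; exists unit, (fun _ _ => 1); split; first by rewrite card_unit expn0 muln1.
  move=> f; elim=> {D f} [c D f fc|D f g h _ [c cE] _ [c' cE'] hE|D [] //].
    by exists (fun=> c) => t; rewrite big_const card_unit /= mulr1 addr0 fc.
  exists (fun u => c u + c' u) => t; rewrite hE cE cE' -big_split.
  by apply: eq_bigr => i _; rewrite mulrDl.
have [C CP] := IH (fun i => s (lift ord0 i)).
exists C => D; rewrite expnS mulnCA.
apply: bspanW (leqnn _) _ (bspan_weighted (s ord0) D.+1 (CP D)).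
apply: (@deg_le_weighted _ _ _ _ _ s succn) => [D'|j|D' f] /=.
- by rewrite /= leqnSn.
- have [->|] := eqVneq j ord0.
    by exists (fun=> 0), 1; split=> [|t]; [exact: deg_cst|rewrite add0r mul1r].
  rewrite eq_sym => /unlift_some[j' -> _].
  exists (s (lift ord0 j')), 0; split=> [|t]; first exact: (deg_le_var (fun i => s (lift ord0 i)) j').
  by rewrite mul0r addr0.
suff H m D0 g z' (s' : 'I_N -> T -> F) : weighted z' s' m D0 g ->
  weighted z' s' m.+1 D0.+1 (fun t => z' t * g t) by exact: H.
elim=> {D' D0 f g} [D' f f0|j E D' f h jm jE Ef hE|D' f g h _ IHf _ IHg hE].
- by apply: weighted0 => t; rewrite f0 mulr0.
- by apply: (@weighted_term _ _ _ _ _ j.+1 E _ f) => // t; rewrite hE exprS mulrA.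
- by apply: weightedD IHf IHg _ => t; rewrite hE mulrDr.
Qed.

Lemma indep_comp T J J' (s : J -> T -> F) (s' : J' -> T -> F) k d :
  (forall j, deg_le s k (s' j)) -> indep s' d -> indep s d.
Proof.
move=> s's [l [f [fl find]]]; exists (l * k)%N, f; split=> // i.
exact: deg_le_comp (fl i).
Qed.

(** Substituting s_i = w_i + l_i z in a monomial leaves the pure power of z, with the value of the
    monomial at l as its coefficient; every other term has a lower power of z. *)
Lemma monomial_lead T N N' (s : 'I_N -> T -> F) (s' : 'I_N' -> T -> F) z (l : 'I_N -> F)
    (w : 'I_N -> T -> F) (m : 'X_{1..N}) :
  (forall i, deg_le s' 1 (w i)) -> (forall i t, s i t = w i t + l i * z t) ->
  exists g, weighted z s' (mdeg m) (mdeg m) g /\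
    forall t, \prod_i s i t ^+ m i = (\prod_i l i ^+ m i) * z t ^+ mdeg m + g t.
Proof.
move=> Dw sE.
pose lead n c f := exists g, weighted z s' n n g /\ forall t, f t = c * z t ^+ n + g t.
have leadM n n' c c' f f' : lead n c f -> lead n' c' f' ->
    lead (n + n')%N (c * c') (fun t => f t * f' t).
  move=> [g [wg gE]] [g' [wg' gE']].
  exists (fun t => z t ^+ n * (c * g' t) + (z t ^+ n' * (c' * g t) + g t * g' t)); split; last first.
    by move=> t; rewrite gE gE' exprD; ring.
  have wz a b D f1 e : weighted z s' a D f1 ->
      weighted z s' (b + a) (b + D) (fun t => z t ^+ b * (e * f1 t)).
    elim=> {D f1} [D f1 f10|j E D f1 h jm jE Ef hE|D f1 g1 h _ IHf _ IHg hE].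
    - by apply: weighted0 => t; rewrite f10 !mulr0.
    - apply: (@weighted_term _ _ _ _ _ (b + j) E _ (fun t => e * f1 t)); [lia|lia| |].
        exact: deg_leZ.
      by move=> t; rewrite hE exprD; ring.
    - by apply: weightedD IHf IHg _ => t; rewrite hE; ring.
  apply: weightedD; first exact: (wz n' n n' g' c wg').
    apply: weightedD; first by rewrite addnC; exact: (wz n n' n g c' wg).
      apply: weightedW (weightedM wg wg') => //; first exact: leq_pred.
    by move=> t.
  by move=> t.
have lead0 f : (forall t, f t = 1) -> lead 0%N 1 f.
  move=> fE; exists (fun=> 0); split; first exact: weighted0.
  by move=> t; rewrite fE mul1r addr0.
have leadX n i : lead n (l i ^+ n) (fun t => s i t ^+ n).
  elim: n => [|n IH]; first exact: lead0.
  have : lead 1%N (l i) (s i).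
    exists (w i); split; last by move=> t; rewrite sE addrC.
    by apply: (@weighted_term _ _ _ _ _ 0 1 1 (w i)) => // t; rewrite mul1r.
  move=> /leadM/(_ IH); rewrite add1n exprS => -[g [wg gE]]; exists g; split=> // t.
  by rewrite -gE exprS.
rewrite mdegE; elim: (index_enum _) => [|i r [g [wg gE]]].
  have [//|g [wg gE]] := lead0 (fun t => \prod_(i <- [::]) s i t ^+ m i).
    by move=> t; rewrite big_nil.
  by exists g; rewrite !big_nil; split=> // t.
have := leadM _ _ _ _ _ _ (leadX (m i) i) (ex_intro _ g (conj wg gE)).
move=> [g' [wg' gE']]; exists g'; rewrite !big_cons; split=> // t.
by rewrite big_cons gE'.
Qed.

Lemma weightedZ T J (s : J -> T -> F) z m D c f :
  weighted z s m D f -> weighted z s m D (fun t => c * f t).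
Proof.
move=> wf; have Dc : deg_le s 0 (fun=> c) by exact: deg_cst.
have := weightedM_deg wf Dc; rewrite addn0 => wf'.
by apply: weighted_ext wf' _ => t; rewrite mulrC.
Qed.

Lemma weighted_sum T J (s : J -> T -> F) z m D (I : eqType) (r : seq I) (f : I -> T -> F) :
  (forall i, i \in r -> weighted z s m D (f i)) ->
  weighted z s m D (fun t => \sum_(i <- r) f i t).
Proof.
elim: r => [|i r IH] wf; first by apply: weighted0 => t; rewrite big_nil.
apply: (weightedD (wf i (mem_head _ _)) (IH _)) => [j jr|t]; last by rewrite big_cons.
by apply: wf; rewrite inE jr orbT.
Qed.

(* If P(s) = 0 with P of degree n, then after a linear change of variables away from the
   zeros of the leading form of P, one variable z satisfies a monic equation of degree n. *)
Theorem noether_normalization T N (s : 'I_N -> T -> F) (t0 : T) : exists d, isdim s d.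
Proof.
elim: N s => [|N IH] s.
  exists 0; split; first exact: growth_free.
  exists 0, (fun _ _ => 0); split=> [[]//|P /(_ t0)].
  by rewrite (nvar0_mpolyC P) mevalC => ->.
have [sfree|] := pselect (forall P : {mpoly F[N.+1]},
    (forall t, P.@[fun i => s i t] = 0) -> P = 0).
  exists N.+1; split; first exact: growth_free.
  by exists 1%N, s; split=> // i; exact: deg_le_var.
move=> /existsNP[P] /not_implyP[Ps /eqP P0].
have [n nP] : exists n, msize P = n.+1 by exists (msize P).-1; rewrite -mpolySpred.
(* The leading form of P. At a point l where it does not vanish, the substitution s = w + l z makes
   P monic in z up to a constant. *)
pose Pn : {mpoly F[N.+1]} := \sum_(m <- msupp P | mdeg m == n) P@_m *: 'X_[m].
have /meval_neq0[l Pnl] : Pn != 0.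
  have := mlead_deg P0; rewrite nP => -[mn].
  have : P@_(mlead P) != 0 by rewrite mleadc_eq0.
  apply: contraNneq => /(congr1 (mcoeff (mlead P))); rewrite mcoeff0 raddf_sum /= => <-.
  rewrite big_mkcond (bigD1_seq (mlead P)) ?msupp_uniq ?mlead_supp //= mn eqxx.
  rewrite mcoeffZ mcoeffX eqxx mulr1 big1 ?addr0 // => m mm.
  by case: eqP => // _; rewrite mcoeffZ mcoeffX (negPf mm) mulr0.
(* A nonzero constant P would not vanish at the point t0 of T. *)
have n0 : (0 < n)%N.
  rewrite lt0n; apply/eqP => n0; move: nP; rewrite n0 => /eqP/msize_poly1P[c c0 Pc].
  by have := Ps t0; rewrite Pc mevalC; apply/eqP.
have [i0 li0] : exists i, l i != 0.
  apply: contrapT => /forallNP l0; move/negP: Pnl; apply.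
  rewrite raddf_sum /= big1 // => m /eqP mn; rewrite mevalZ mevalX.
  have [i mi] : exists i, (0 < m i)%N.
    apply: contrapT => /forallNP m0; move: n0; rewrite -mn mdegE big1 // => i _.
    by apply/eqP; rewrite -leqn0 leqNgt; apply/negP/m0.
  rewrite (bigD1 i) //=; have /negP/negPn/eqP -> := l0 i.
  by rewrite expr0n eqn0Ngt mi mul0r mulr0.
(* With this z the function w_i0 vanishes, so that z and the N remaining w_i generate the same
   functions as s. *)
pose z t := s i0 t / l i0; pose w i t := s i t - l i * z t.
pose s' k := w (lift i0 k).
have Dw i : deg_le s' 1 (w i).
  have [->|] := eqVneq i i0.
    by apply: (@deg_cst _ _ _ _ 0) => t; rewrite /w /z mulrC divfK ?subrr.
  rewrite eq_sym => /unlift_some[k -> _]; exact: (deg_le_var s' k).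
have sE i t : s i t = w i t + l i * z t by rewrite subrK.
have [g gP] := choice (fun m => monomial_lead m Dw sE).
(* The relation P(s) = 0 solved for z^n: G collects all terms other than Pn(l) z^n, and these carry
   powers of z below n. *)
have zn : weighted z s' n n (fun t => z t ^+ n).
  pose G t := \sum_(m <- msupp P) P@_m *
     (if mdeg m == n then g m t else (\prod_i l i ^+ m i) * z t ^+ mdeg m + g m t).
  have wG : weighted z s' n n G.
    apply: weighted_sum => m mP; have := msize_mdeg_lt mP; rewrite nP ltnS => mn.
    apply: weightedZ; have [mE|mE] := eqVneq (mdeg m) n.
      by rewrite -mE; case: (gP m).
    have mlt : (mdeg m < n)%N by rewrite ltn_neqAle mE.
    apply: (weightedD (f := fun t => \prod_i l i ^+ m i * z t ^+ mdeg m) (g := g m)) => //.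
      apply: (@weighted_term _ _ _ _ _ (mdeg m) 0 n (fun=> \prod_i l i ^+ m i)) => //.
      - by rewrite addn0.
      - exact: deg_cst.
      - by move=> t; rewrite mulrC.
    by apply: weightedW (proj1 (gP m)).
  apply: weighted_ext (weightedZ (- (Pn.@[l])^-1) wG) _ => t.
  have := Ps t; rewrite mevalE.
  have -> : \sum_(m <- msupp P) P@_m * \prod_i s i t ^+ m i = Pn.@[l] * z t ^+ n + G t.
    rewrite raddf_sum /= [X in X * _]big_mkcond mulr_suml -big_split; apply: eq_bigr => m _ /=.
    rewrite (proj2 (gP m)); case: eqP => [->|_]; last by rewrite mul0r add0r.
    by rewrite mevalZ mevalX mulrDr mulrA.
  by move=> /(canRL (addKr _)) ->; rewrite addr0 mulrN mulNr opprK mulKf.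
have [d [s'growth s'indep]] := IH s'; exists d; split; last first.
  apply: (@indep_comp _ _ _ s s' 1 d _ s'indep) => k.
  apply: (deg_add (deg_le_var s (lift i0 k)) (deg_leZ (- l (lift i0 k) / l i0) (deg_le_var s i0))).
  by move=> t; rewrite /s' /w /z; ring.
apply: (@growth_weighted _ _ _ s' s z n d _ s'growth).
apply: (@deg_le_weighted _ _ _ _ _ s (fun=> n)) => [D|j|D f wf].
- by rewrite n0 leqnn.
- by exists (w j), (l j).
- exact: weighted_reduce.
Qed.

End NoetherNormalization.

(** * Dimension under rational maps, covers and open conditions *)

Section DimensionCalculus.
Variable F : fieldType.

(** q^D turns functions of degree D in s' into functions of degree D k in s; after division of the
    spanning family by q^D, only the constant has grown, by the factor (k + 1)^d. *)
Lemma growth_rational T J J' (s : J -> T -> F) (s' : J' -> T -> F) (q : T -> F) k d :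
  (forall t, q t != 0) -> deg_le s k q ->
  (forall j, deg_le s k (fun t => q t * s' j t)) -> growth s d -> growth s' d.
Proof.
move=> q0 Dq Ds' [C CP]; exists (C * k.+1 ^ d)%N => D.
have [I [e [cI eP]]] := CP (D * k)%N.
exists I, (fun i t => e i t / q t ^+ D); split.
  apply: leq_trans cI _; rewrite -mulnA leq_mul2l -expnMn; apply/orP; right.
  case: (d) => // d1; rewrite leq_exp2r //; nia.
move=> f Df; have [c cE] := eP _ (deg_le_subst Dq Ds' Df).
exists c => t; have := cE t => /(congr1 (fun x => x / q t ^+ D)).
rewrite mulrAC mulfV ?expf_neq0 // mul1r => ->.
by rewrite mulr_suml; apply: eq_bigr => i _; rewrite mulrA.
Qed.

Lemma growth_comp T J J' (s : J -> T -> F) (s' : J' -> T -> F) k d :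
  (forall j, deg_le s k (s' j)) -> growth s d -> growth s' d.
Proof.
move=> Ds'; apply: (@growth_rational _ _ _ _ _ (fun=> 1) k) => [t||j].
- exact: oner_neq0.
- exact: deg_cst.
- by apply: deg_le_ext (Ds' j) _ => t; rewrite mul1r.
Qed.

Lemma isdim_equiv T J J' (s : J -> T -> F) (s' : J' -> T -> F) k k' d :
  (forall j, deg_le s k (s' j)) -> (forall j, deg_le s' k' (s j)) ->
  isdim s d -> isdim s' d.
Proof. by move=> ss' s's [gs is_]; split; [apply: growth_comp gs|apply: indep_comp is_]. Qed.

Lemma growth_pull T T' J (s : J -> T -> F) (phi : T' -> T) d :
  growth s d -> growth (fun j t => s j (phi t)) d.
Proof.
move=> [C CP]; exists C => D; have [I [e [cI eP]]] := CP D.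
exists I, (fun i t => e i (phi t)); split=> // f Df.
suff [g [Dg gE]] : exists g, deg_le s D g /\ forall t, f t = g (phi t).
  by have [c cE] := eP g Dg; exists c => t; rewrite gE cE.
elim: Df => {D f CP I e cI eP} [c D f fc|D f g h _ [f' [Df fE]] _ [g' [Dg gE]] hE|D j f h _ [f' [Df fE]] hE].
- by exists (fun=> c); split=> //; exact: deg_cst.
- exists (fun t => f' t + g' t); split; first exact: deg_add Df Dg _.
  by move=> t; rewrite hE fE gE.
- exists (fun t => s j t * f' t); split; first exact: deg_mulvar Df _.
  by move=> t; rewrite hE fE.
Qed.

Lemma growth_surj T T' J (s : J -> T -> F) (phi : T' -> T) d :
  (forall t, exists t', phi t' = t) -> growth (fun j t => s j (phi t)) d -> growth s d.
Proof.
move=> /choice[psi psiK] [C CP]; exists C => D; have [I [e [cI eP]]] := CP D.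
exists I, (fun i t => e i (psi t)); split=> // f /(deg_le_pull phi)/eP[c cE].
by exists c => t; rewrite -cE /= psiK.
Qed.

(** The spanning families of the pieces are extended by zero and put together, so the constants add
    up while the exponent stays. Membership in the list goes by position, X having no decidable
    equality. *)
Lemma growth_cover T J (s : J -> T -> F) (X : Type) (l : seq X) (A : X -> T -> Prop) d :
  (forall t, exists2 n, (n < size l)%N & forall x0, A (nth x0 l n) t) ->
  (forall x, growth (fun j (t : {t | A x t}) => s j (sval t)) d) -> growth s d.
Proof.
move=> cov gA.
suff [C CP] : exists C, forall D, exists (I : finType) (e : I -> T -> F),
    (#|I| <= C * D.+1 ^ d)%N /\ forall f, deg_le s D f -> exists c : I -> F,
    forall t, (exists2 n, (n < size l)%N & forall x0, A (nth x0 l n) t) ->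
      f t = \sum_i c i * e i t.
  exists C => D; have [I [e [cI eP]]] := CP D; exists I, e; split=> // f /eP[c cE].
  by exists c => t; apply: cE.
elim: l {cov} => [|x l [C CP]].
  by exists 0%N => D; exists void, (fun _ _ => 0); split=> [|f _];
    [rewrite card_void|exists (fun=> 0) => t [n]].
have [C' CP'] := gA x; exists (C + C')%N => D.
have [I [e [cI eP]]] := CP D; have [I' [e' [cI' eP']]] := CP' D.
pose ex t : {t | A x t} + {~ A x t} :=
  match pselect (A x t) with left h => inleft (exist _ t h) | right h => inright h end.
have exT t (h : A x t) : exists h', ex t = inleft (exist _ t h').
  by rewrite /ex; case: pselect => // h'; exists h'.
have exF t : ~ A x t -> exists h, ex t = inright h.
  by rewrite /ex; case: pselect => // h _; exists h.
exists (I + I')%type, (fun i t => match i, ex t with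
  | inl i, inright _ => e i t | inr i, inleft t' => e' i t' | _, _ => 0 end); split.
  by rewrite card_sum mulnDl leq_add.
move=> f Df; have [c cE] := eP f Df.
have [c' cE'] := eP' _ (deg_le_pull (fun t : {t | A x t} => sval t) Df).
exists (fun i => match i with inl i => c i | inr i => c' i end) => t [n nl An].
rewrite big_sumType /=; have [Axt|nAxt] := pselect (A x t).
  have [h ->] := exT t Axt; rewrite big1 ?add0r => [|i _]; last by rewrite mulr0.
  exact: (cE' (exist _ t h)).
have [h ->] := exF t nAxt; rewrite [X in _ + X]big1 ?addr0 => [|i _]; last by rewrite mulr0.
apply: cE; case: n nl An => [_ /(_ x)//|n nl An]; by exists n.
Qed.

Lemma isdim_zdim N T (A : set ('I_N -> F)) (s : T -> 'I_N -> F) d :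
  (forall t, A (s t)) -> (forall x, A x -> exists t, s t = x) ->
  isdim (fun i t => s t i) d -> zdim A = d.
Proof.
move=> sA As [gs [k [f [fk find]]]].
have toA e (f' : 'I_e -> {mpoly F[N]}) : alg_indep_on A f' -> indep (fun i t => s t i) e.
  move=> f'ind; exists (\max_i msize (f' i))%N, (fun i t => (f' i).@[s t]); split.
    by move=> i; apply: deg_leW (deg_le_meval (fun i t => s t i) (f' i)); exact: leq_bigmax.
  by move=> P P0; apply: f'ind => x /As[t <-].
(* The maximum in [zdim] runs over d at most N; functions of N variables have growth N, which puts d
   in this range. *)
have dN : (d < N.+1)%N.
  by rewrite ltnS; apply: (growth_indep (growth_free (fun i t => s t i))); exists k, f.
apply/eqP; rewrite /zdim eqn_leq; apply/andP; split.
  by apply/bigmax_leqP => e /asboolP[f' /toA]; exact: growth_indep.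
apply: (@leq_bigmax_cond _ _ (fun i : 'I_N.+1 => i : nat) (Ordinal dN)).
apply/asboolP.
have [p pE] := choice (fun i => meval_deg_le (fk i)).
exists p => P P0; apply: find => t; rewrite -[RHS](P0 _ (sA t)).
by apply: meval_eq => i; rewrite pE.
Qed.

Hypothesis Finf : forall l : seq F, exists x, x \notin l.

Lemma isdim_exists T (J : finType) (s : J -> T -> F) (t0 : T) : exists d, isdim s d.
Proof.
have [d ds] := noether_normalization Finf (fun i : 'I_#|J| => s (enum_val i)) t0.
exists d; apply: isdim_equiv ds => [j|i].
  by rewrite -(enum_rankK j); exact: (deg_le_var (fun i : 'I_#|J| => s (enum_val i))).
exact: deg_le_var.
Qed.

(** A relation P among the z_j, multiplied by q, vanishes at every point of affine space; over an
    infinite field the product is then zero, hence P is. *)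
Lemma isdim_open T (J : finType) (z : J -> T -> F) k (q : (J -> F) -> F) :
  deg_le (fun j v => v j) k q -> (exists v, q v != 0) ->
  (forall v, q v != 0 -> exists t, forall j, z j t = v j) -> isdim z #|J|.
Proof.
move=> Dq [v0 qv0] zq; split.
  apply: growth_comp (growth_free (fun i : 'I_#|J| => z (enum_val i))) => j.
  by rewrite -(enum_rankK j); exact: (deg_le_var (fun i : 'I_#|J| => z (enum_val i))).
exists 1%N, (fun i => z (enum_val i)); split=> [i|P P0]; first exact: deg_le_var.
have [p pE] : exists p : {mpoly F[#|J|]}, forall v, q v = p.@[fun i : 'I_#|J| => v (enum_val i)].
  have D' : forall j : J, deg_le (fun (i : 'I_#|J|) (v : J -> F) => v (enum_val i)) 1 (fun v => v j).
    move=> j; rewrite -(enum_rankK j).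
    exact: (deg_le_var (fun (i : 'I_#|J|) (v : J -> F) => v (enum_val i))).
  exact: meval_deg_le (deg_le_comp D' Dq).
have p0 : p != 0 by apply: contraNneq qv0 => p0; rewrite pE p0 meval0.
apply/eqP; apply: contraT => P0'; have := mulf_neq0 P0' p0.
move=> /(meval_neq0 Finf)[v]; rewrite mevalM mulf_eq0 negb_or => /andP[+ pv].
have [|t tE] := zq (fun j => v (enum_rank j)).
  by rewrite pE; under meval_eq => i do rewrite enum_valK.
by rewrite -(P0 t) => /negP[]; apply/eqP/meval_eq => i; rewrite tE enum_valK.
Qed.

Lemma deg_le_det T J (s : J -> T -> F) k n (A : T -> 'M[F]_n) :
  (forall i j, deg_le s k (fun t => A t i j)) -> deg_le s (n * k) (fun t => \det (A t)).
Proof.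
move=> DA; apply: deg_le_sum => u _; apply: deg_leZ.
have := @deg_le_prod _ _ _ s _ (index_enum _) (fun=> k) _ (fun i => DA i (perm.fun_of_perm u i)).
by apply: deg_leW; rewrite sum_nat_const card_ord.
Qed.

Lemma deg_le_adj T J (s : J -> T -> F) k n (A : T -> 'M[F]_n) i j :
  (forall i j, deg_le s k (fun t => A t i j)) -> deg_le s (n * k) (fun t => (\adj (A t)) i j).
Proof.
move=> DA; apply: (@deg_le_ext _ _ _ _ _ (fun t => cofactor (A t) j i)); last first.
  by move=> t; rewrite mxE.
apply: deg_leZ; apply: deg_leW (deg_le_det (k := k) _).
  by rewrite leq_mul2r leq_pred orbT.
by move=> i' j'; apply: deg_le_ext (DA _ _) _ => t; rewrite !mxE.
Qed.

Lemma deg_le_mulmx T J (s : J -> T -> F) k k' m n p (A : T -> 'M[F]_(m, n))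
    (B : T -> 'M[F]_(n, p)) i j :
  (forall i j, deg_le s k (fun t => A t i j)) ->
  (forall i j, deg_le s k' (fun t => B t i j)) ->
  deg_le s (k + k') (fun t => (A t *m B t) i j).
Proof.
move=> DA DB; apply: (@deg_le_ext _ _ _ _ _ (fun t => \sum_l A t i l * B t l j)).
  by apply: deg_le_sum => l _; apply: deg_leM.
by move=> t; rewrite mxE.
Qed.

(** Linear algebra in place of a noetherian argument: the f_x have coefficient vectors in a space of
    finite dimension, and a list whose vectors span as much as possible spans all of them. If all
    its members vanish at t, so does every f_x. *)
Lemma finite_zero_test T (Q : (T -> F) -> Prop) n X (f : X -> T -> F) :
  bspan Q n -> (forall x, Q (f x)) ->
  exists l : seq X, forall t, (exists x, f x t != 0) ->
    exists2 n, (n < size l)%N & forall x0, f (nth x0 l n) t != 0.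
Proof.
move=> [I [e [_ eP]]] Qf; have [c cE] := choice (fun x => eP _ (Qf x)).
pose r x : 'rV[F]_#|I| := \row_i c x (enum_val i).
pose P m := `[< exists l, \dim <<map r l>> = m >].
have exP : exists m, P m by exists (\dim <<map r [::]>>); apply/asboolP; exists [::].
have leP m : P m -> (m <= \dim {:'rV[F]_#|I|})%N.
  by move=> /asboolP[l <-]; apply/dimvS/subvf.
case: (ex_maxnP exP leP) => m /asboolP[l lm] max; exists l => t [x fx].
have rx : r x \in <<map r l>>%VS.
  have : P (\dim <<map r (x :: l)>>) by apply/asboolP; exists (x :: l).
  move=> /max; rewrite -lm => le.
  have : (<<map r l>> <= <<map r (x :: l)>>)%VS.
    by apply: sub_span => y yl; rewrite inE yl orbT.
  move=> /dimv_leqif_eq/geq_leqif; rewrite le => /esym/eqP ->.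
  by apply: memv_span; rewrite inE eqxx.
apply: contrapT => H; move/negP: fx; apply.
pose ev (v : 'rV[F]_#|I|) : F := \sum_i v 0 (enum_rank i) * e i t.
have fE y : f y t = ev (r y).
  by rewrite cE; apply: eq_bigr => i _; rewrite mxE enum_rankK.
have l0 v : v \in map r l -> ev v = 0.
  move=> /(nthP 0)[k]; rewrite size_map => kl; rewrite (nth_map x) // => <-; rewrite -fE.
  apply/eqP; apply: contrapT => fk; apply: H; exists k => // x0.
  by rewrite (set_nth_default x) //; apply/negP.
rewrite fE; have := coord_span (X := in_tuple (map r l)) rx => ->.
apply/eqP; rewrite /ev.
under eq_bigr => i _ do rewrite summxE mulr_suml.
rewrite exchange_big big1 //= => k _.
have /l0 : (map r l)`_k \in map r l by apply: mem_nth.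
rewrite /ev => ev0.
under eq_bigr => i _ do rewrite mxE -mulrA.
by rewrite -mulr_sumr ev0 mulr0.
Qed.

End DimensionCalculus.

(** * Dimension of groups of endomorphisms *)

Section WallChart.
Variables (F : fieldType) (m : nat).
Hypothesis Finf : forall l : seq F, exists x, x \notin l.
Variables (A Y : 'M[F]_m -> Prop).
Hypothesis AY : forall g, A g -> g - 1%:M \in unitmx -> Y (invmx (g - 1%:M)).
Hypothesis YA : forall y, Y y -> y \in unitmx -> A (1%:M + invmx y).
Hypothesis AM : forall g h, A g -> A h -> A (g *m h).
Hypothesis AV : forall g, A g -> g \in unitmx /\ A (invmx g).

Definition entries (P : 'M[F]_m -> Prop) (ij : 'I_m * 'I_m) (g : {g | P g}) : F :=
  sval g ij.1 ij.2.

Let Yu y := Y y /\ y \in unitmx.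

Let invmx_adj (y : 'M[F]_m) : y \in unitmx -> forall i j, \det y * invmx y i j = (\adj y) i j.
Proof.
move=> uy i j; rewrite /invmx uy mxE mulrA mulfV ?mul1r //.
by move: uy; rewrite unitmxE unitfE.
Qed.

(* y |-> 1 + y^-1 is a chart onto the set of the g in A with g - 1 invertible, and the
   translates of this set by finitely many elements of A cover A, because the functions
   g |-> det (g - h), h in A, span a space of finite dimension. *)
Theorem isdim_group d : (exists g0, A g0 /\ g0 - 1%:M \in unitmx) ->
  isdim (@entries Yu) d -> isdim (@entries A) d.
Proof.
move=> [g0 [Ag0 ug0]] [Ygrowth Yindep].
have invA h : A h -> h *m invmx h = 1%:M /\ invmx h *m h = 1%:M.
  by move=> /AV[uh _]; rewrite mulmxV ?mulVmx.
have Agrowth : growth (@entries A) d.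
  pose f (h : {h | A h}) (g : {g | A g}) := \det (sval g - sval h).
  have Df h : deg_le (@entries A) (m * 1) (f h).
    apply: deg_le_det => i j.
    apply: (deg_add (deg_le_var (@entries A) (i, j)) (deg_cst _ (c := - sval h i j) _ _)) => //.
    by move=> g; rewrite !mxE.
  have [n bn] : exists n, bspan (deg_le (@entries A) (m * 1)) n.
    have [C CP] : growth (@entries A) #|{: 'I_m * 'I_m}|.
      apply: growth_comp (growth_free (fun i => entries (enum_val i))) => j.
      rewrite -(enum_rankK j).
      exact: (deg_le_var (fun i : 'I_#|{: 'I_m * 'I_m}| => @entries A (enum_val i))).
    by eexists; apply: CP.
  have [l lP] := finite_zero_test bn Df.
  apply: (@growth_cover _ _ _ _ _ l (fun h g => f h g != 0)) => [[g Ag]|[h Ah]].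
    (* g lies in the piece of h = g g0^-1, because g - h = g g0^-1 (g0 - 1) is invertible. *)
    apply: lP; have Agg : A (g *m invmx g0) by apply: AM => //; case: (AV Ag0).
    exists (exist _ _ Agg); rewrite /f /=.
    have -> : g - g *m invmx g0 = g *m invmx g0 *m (g0 - 1%:M).
      by rewrite mulmxBr mulmx1 -mulmxA (invA _ Ag0).2 mulmx1.
    by rewrite -unitfE -unitmxE !unitmx_mul ug0 unitmx_inv !(AV _).1.
  have Aphi (y : {y | Yu y}) : A (h *m (1%:M + invmx (sval y))).
    by case: y => y [Yy uy]; apply: AM => //; apply: YA.
  have uphi (y : {y | Yu y}) : f (exist _ _ Ah) (exist _ _ (Aphi y)) != 0.
    case: (y) => y' [Yy uy]; rewrite /f /= mulmxDr mulmx1 addrC addKr.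
    by rewrite -unitfE -unitmxE unitmx_mul unitmx_inv uy (AV Ah).1.
  (* The translated chart y |-> h (1 + y^-1), onto the g with g - h invertible. *)
  pose phi (y : {y | Yu y}) : {g | f (exist _ _ Ah) g != 0} :=
    exist (fun g => f (exist _ _ Ah) g != 0) _ (uphi y).
  apply: (@growth_surj _ _ _ _ _ phi) => [[[g Ag] ug]|].
    have ugh : invmx h *m g - 1%:M \in unitmx.
      have -> : invmx h *m g - 1%:M = invmx h *m (g - h) by rewrite mulmxBr (invA _ Ah).2.
      by rewrite unitmx_mul unitmx_inv (AV Ah).1 unitmxE unitfE.
    have Agh : A (invmx h *m g) by apply: AM => //; case: (AV Ah).
    have Yy : Yu (invmx (invmx h *m g - 1%:M)) by split; [apply: AY|rewrite unitmx_inv].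
    exists (exist _ _ Yy); apply/eq_exist => /=; apply/eq_exist => /=.
    by rewrite invmxK addrC subrK mulmxA (invA _ Ah).1 mul1mx.
  have DY i j : deg_le (@entries Yu) 1 (fun y => sval y i j).
    exact: (deg_le_var (@entries Yu) (i, j)).
  apply: (@growth_rational _ _ _ _ _ _ (fun y => \det (sval y)) (m * 1) d _ _ _ Ygrowth).
  - by move=> [y [_ uy]] /=; rewrite -unitfE -unitmxE.
  - exact: deg_le_det.
  - move=> [i j]; rewrite /entries /=.
    (* The common denominator is det y: det y (1 + y^-1) = det y + adj y. *)
    apply: (@deg_le_ext _ _ _ _ _ (fun y => (h *m ((\det (sval y))%:M + \adj (sval y))) i j)).
      rewrite -[(m * 1)%N]add0n; apply: deg_le_mulmx => [i' j'|i' j']; first exact: deg_cst.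
      apply: (deg_add (f := fun y => (i' == j')%:R * \det (sval y)) (g := fun y => (\adj (sval y)) i' j')).
      + exact/deg_leZ/deg_le_det.
      + exact: deg_le_adj.
      + by move=> y; rewrite !mxE mulr_natl.
    move=> [y [_ uy]] /=.
    have -> : (\det y)%:M + \adj y = \det y *: (1%:M + invmx y).
      apply/matrixP => i' j'; rewrite [LHS]mxE [RHS]mxE [X in _ = _ * X]mxE -invmx_adj // mulrDr.
      by rewrite [1%:M _ _]mxE [_%:M _ _]mxE mulr_natr.
    by rewrite -scalemxAr mxE.
split=> //.
(* Lower bound: A has some dimension e by Noether normalization, and g |-> (g - 1)^-1 is rational,
   so the chart set has growth e and d <= e. With the upper bound e <= d, the independence in A is
   that of e. *)
have [e [gAe iAe]] := isdim_exists Finf (@entries A) (exist _ _ Ag0).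
suff le : (d <= e)%N.
  suff -> : d = e by [].
  by apply/eqP; rewrite eqn_leq le (growth_indep Agrowth iAe).
apply: (growth_indep _ Yindep).
pose T' := {g | A g /\ g - 1%:M \in unitmx}.
pose inc (g : T') : {g | A g} := exist _ _ (svalP g).1.
have Ypsi (g : T') : Yu (invmx (sval g - 1%:M)).
  by case: g => g [Ag ug]; split; [apply: AY|rewrite unitmx_inv].
apply: (@growth_surj _ _ _ _ _ (fun g : T' => exist _ _ (Ypsi g))) => [[y [Yy uy]]|].
  have Tg : A (1%:M + invmx y) /\ (1%:M + invmx y) - 1%:M \in unitmx.
    by split; [apply: YA|rewrite addrC addKr unitmx_inv].
  by exists (exist (fun g => A g /\ g - 1%:M \in unitmx) _ Tg); apply/eq_exist => /=; rewrite addrC addKr invmxK.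
apply: (@growth_rational _ _ _ _ _ _ (fun g : T' => \det (sval g - 1%:M)) (m * 1) _ _ _ _
  (growth_pull inc gAe)).
- by move=> [g [_ ug]] /=; rewrite -unitfE -unitmxE.
- apply: deg_le_det => i j.
  apply: (deg_add (deg_le_var (fun j t => entries j (inc t)) (i, j)) (deg_cst _ (c := - (1%:M : 'M[F]_m) i j) _ _)) => //.
  by move=> g; rewrite !mxE.
- move=> [i j]; rewrite /entries /=.
  apply: (@deg_le_ext _ _ _ _ _ (fun g : T' => (\adj (sval g - 1%:M)) i j)).
    apply: deg_le_adj => i' j'.
    apply: (deg_add (deg_le_var (fun j t => entries j (inc t)) (i', j')) (deg_cst _ (c := - (1%:M : 'M[F]_m) i' j') _ _)) => //.
    by move=> g; rewrite !mxE.
  by move=> [g [_ ug]] /=; rewrite invmx_adj.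
Qed.

End WallChart.

Section Reindexing.
Variable F : fieldType.

Lemma deg_le_factor T T' J (s : J -> T -> F) (phi : T' -> T) D f :
  deg_le (fun j t => s j (phi t)) D f ->
  exists g, deg_le s D g /\ forall t, f t = g (phi t).
Proof.
elim=> {D f} [c D f fc|D f g h _ [f' [Df fE]] _ [g' [Dg gE]] hE|D j f h _ [f' [Df fE]] hE].
- by exists (fun=> c); split=> //; exact: deg_cst.
- exists (fun t => f' t + g' t); split; first exact: deg_add Df Dg _.
  by move=> t; rewrite hE fE gE.
- exists (fun t => s j t * f' t); split; first exact: deg_mulvar Df _.
  by move=> t; rewrite hE fE.
Qed.

Lemma isdim_surj T T' J (s : J -> T -> F) (phi : T' -> T) d :
  (forall t, exists t', phi t' = t) ->
  isdim (fun j t => s j (phi t)) d <-> isdim s d.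
Proof.
move=> surj; split=> -[gs [k [f [fk find]]]]; split.
- exact: growth_surj gs.
- have [g gE] := choice (fun i => deg_le_factor (fk i)).
  exists k, g; split=> [i|P P0]; first by case: (gE i).
  by apply: find => t; rewrite -[RHS](P0 (phi t)); apply: meval_eq => i; case: (gE i).
- exact: growth_pull.
- exists k, (fun i t => f i (phi t)); split=> [i|P P0]; first exact: deg_le_pull.
  by apply: find => t; have [t' <-] := surj t; apply: P0.
Qed.

End Reindexing.

(** * Coordinates over a subfield *)

Section Coordinates.
Variables (F K : fieldType) (iota : {rmorphism F -> K}).
Hypothesis Finf : forall l : seq F, exists x, x \notin l.

(** A K-space seen as an F-space with a chosen basis [cvec]. It is used with F = K, and with the
    reals inside the complex numbers, where each basis vector v contributes v and i v. *)
Record coordinates (E : vectType K) := Coordinates {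
  csize : nat;
  cfun : E -> 'I_csize -> F;
  cvec : 'I_csize -> E;
  cfunD : forall x y i, cfun (x + y) i = cfun x i + cfun y i;
  cfunZ : forall a x i, cfun (iota a *: x) i = a * cfun x i;
  cfunE : forall x, x = \sum_i iota (cfun x i) *: cvec i;
  cfun_vec : forall i j, cfun (cvec i) j = (i == j)%:R }.

Arguments cfun {E} c x i : rename.
Arguments cvec {E} c i : rename.
Arguments cfunD {E} c x y i : rename.
Arguments cfunZ {E} c a x i : rename.
Arguments cfunE {E} c x : rename.
Arguments cfun_vec {E} c i j : rename.

Definition flinear (E : vectType K) (f : E -> F) : Prop :=
  (forall x y, f (x + y) = f x + f y) /\ (forall a x, f (iota a *: x) = a * f x).

Section OneSpace.
Variables (E : vectType K) (c : coordinates E).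

Lemma flinear_sum (f : E -> F) (J : finType) (a : J -> F) (x : J -> E) : flinear f ->
  f (\sum_j iota (a j) *: x j) = \sum_j a j * f (x j).
Proof.
move=> [fD fZ]; apply: (big_ind2 (fun x y => f x = y)) => [|x1 y1 x2 y2 <- <- //|j _].
  by have := fZ 0 0; rewrite scaler0 mul0r.
by rewrite fZ.
Qed.

Lemma flinear_cfun i : flinear (fun x => cfun c x i).
Proof. by split=> [x y|a x]; rewrite (cfunD, cfunZ). Qed.

Lemma flinearE (f : E -> F) x : flinear f -> f x = \sum_i cfun c x i * f (cvec c i).
Proof. by move=> fl; rewrite {1}[x](cfunE c) flinear_sum. Qed.

Lemma deg_le_flinear T (x : T -> E) (f : E -> F) : flinear f ->
  deg_le (fun i t => cfun c (x t) i) 1 (fun t => f (x t)).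
Proof.
move=> fl; apply: (@deg_le_ext _ _ _ _ _ (fun t => \sum_i f (cvec c i) * cfun c (x t) i)).
  by apply: deg_le_sum => i _; apply/deg_leZ/(deg_le_var (fun i t => cfun c (x t) i)).
by move=> t; rewrite (flinearE _ fl); apply: eq_bigr => i _; rewrite mulrC.
Qed.

Lemma cfun_inj x y : cfun c x =1 cfun c y -> x = y.
Proof.
by move=> xy; rewrite [x](cfunE c) [y](cfunE c); apply: eq_bigr => i _; rewrite xy.
Qed.

Lemma cfun_sum (a : 'I_(csize c) -> F) i : cfun c (\sum_j iota (a j) *: cvec c j) i = a i.
Proof.
rewrite (flinear_sum _ _ (flinear_cfun i)) (bigD1 i) //= cfun_vec eqxx mulr1 big1 ?addr0 //.
by move=> j /negPf ji; rewrite cfun_vec ji mulr0.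
Qed.

(** Matrix over F for the action on row vectors, hence the reversed product in [fmatrix_comp]. A
    complex endomorphism gives a real matrix of twice the size. *)
Definition fmatrix (g : 'End(E)) : 'M[F]_(csize c) := \matrix_(i, j) cfun c (g (cvec c i)) j.

Lemma fmatrix_row (g : 'End(E)) x :
  \row_i cfun c (g x) i = (\row_i cfun c x i) *m fmatrix g.
Proof.
apply/rowP => j; rewrite !mxE {1}[x](cfunE c) linear_sum /=.
transitivity (cfun c (\sum_i iota (cfun c x i) *: g (cvec c i)) j).
  by congr (cfun c _ j); apply: eq_bigr => i _; rewrite linearZ.
by rewrite (flinear_sum _ _ (flinear_cfun j)); apply: eq_bigr => i _; rewrite !mxE.
Qed.

Lemma fmatrix_comp (g h : 'End(E)) : fmatrix (g \o h)%VF = fmatrix h *m fmatrix g.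
Proof.
apply/row_matrixP => i; rewrite row_mul.
have -> : row i (fmatrix (g \o h)%VF) = \row_j cfun c (g (h (cvec c i))) j.
  by apply/rowP => j; rewrite !mxE comp_lfunE.
by rewrite fmatrix_row; congr (_ *m _); apply/rowP => j; rewrite !mxE.
Qed.

Lemma fmatrix1 : fmatrix \1%VF = 1%:M.
Proof. by apply/matrixP => i j; rewrite !mxE id_lfunE cfun_vec. Qed.

Lemma fmatrixD (g h : 'End(E)) : fmatrix (g + h) = fmatrix g + fmatrix h.
Proof. by apply/matrixP => i j; rewrite !mxE add_lfunE cfunD. Qed.

Lemma flinear_fmatrix (i j : 'I_(csize c)) : @flinear _ (fun g : 'End(E) => fmatrix g i j).
Proof.
split=> [g h|a g]; first by rewrite fmatrixD mxE.
by rewrite !mxE scale_lfunE cfunZ.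
Qed.

Lemma fmatrixN (g : 'End(E)) : fmatrix (- g) = - fmatrix g.
Proof.
apply/eqP; rewrite -addr_eq0 -fmatrixD addNr; apply/eqP/matrixP => i j.
by have := (flinear_fmatrix i j).2 0 0; rewrite scaler0 mul0r => ->; rewrite mxE.
Qed.

Lemma fmatrix_inj : injective fmatrix.
Proof.
move=> g h /matrixP gh; apply/lfunP => x; rewrite [x](cfunE c) !linear_sum /=.
apply: eq_bigr => i _; rewrite !linearZ /=; congr (_ *: _).
by apply: cfun_inj => j; have := gh i j; rewrite !mxE.
Qed.

Lemma fmatrix_unit (g : 'End(E)) : (fmatrix g \in unitmx) = (lker g == 0%VS).
Proof.
apply/idP/idP => [ug|kg].
  apply/eqP/vspaceP => x; rewrite memv_ker memv0; apply/eqP/eqP => [gx|->]; last by rewrite linear0.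
  apply: cfun_inj => i.
  have /rowP/(_ i) : \row_i cfun c x i = 0.
    apply: (can_inj (mulmxK ug)); rewrite mul0mx -fmatrix_row gx.
    by apply/rowP => j; rewrite !mxE; have := cfunZ c 0 0 j; rewrite scaler0 mul0r.
  by rewrite !mxE => ->; have := cfunZ c 0 0 i; rewrite scaler0 mul0r.
have := fmatrix1; rewrite -(lker0_compfV kg) fmatrix_comp => /mulmx1_unit[].
by [].
Qed.

Lemma fmatrixV (g : 'End(E)) : lker g == 0%VS -> fmatrix (g^-1)%VF = invmx (fmatrix g).
Proof.
move=> kg; have ug : fmatrix g \in unitmx by rewrite fmatrix_unit.
apply: (can_inj (mulKmx ug)); rewrite mulmxV // -fmatrix_comp.
by rewrite lker0_compVf // fmatrix1.
Qed.

End OneSpace.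

Definition ccoords (E : vectType K) (c : coordinates E) (P : E -> Prop) (i : 'I_(csize c))
  (x : {x | P x}) : F := cfun c (sval x) i.
Arguments ccoords {E} c P i x.

Section LinearSpaces.
Variables (E : vectType K) (c : coordinates E).

Lemma deg_le_cfun_affine T J (s : J -> T -> F) (I : finType) (v : I -> T -> F) (x0 : E)
    (b : I -> E) i : (forall i, deg_le s 1 (v i)) ->
  deg_le s 1 (fun t => cfun c (x0 + \sum_j iota (v j t) *: b j) i).
Proof.
move=> Dv; apply: (@deg_le_ext _ _ _ _ _ (fun t => cfun c x0 i + \sum_j cfun c (b j) i * v j t)).
  apply: (deg_add (f := fun=> cfun c x0 i) (g := fun t => \sum_j cfun c (b j) i * v j t)) => //.
    exact: deg_cst.
  by apply: deg_le_sum => j _; apply: deg_leZ.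
move=> t; rewrite cfunD (flinear_sum _ _ (flinear_cfun i)); congr (_ + _).
by apply: eq_bigr => j _; rewrite mulrC.
Qed.

(** The Phi_j are linear coordinates on L, with dual basis b, so x0 + L is an affine space and P the
    nonvanishing locus of q in it; [isdim_open] applies because q(x0) is nonzero. *)
Lemma isdim_affine_open (L P : E -> Prop) (x0 : E) (q : E -> F) k (J : finType)
    (Phi : J -> E -> F) :
  (forall x y a, L x -> L y -> L (x + iota a *: y)) ->
  (forall j, flinear (Phi j)) ->
  (forall x, L x -> (forall j, Phi j x = 0) -> x = 0) ->
  (forall v : J -> F, exists2 x, L x & forall j, Phi j x = v j) ->
  deg_le (fun i x => cfun c x i) k q -> q x0 != 0 ->
  (forall x, P x <-> L (x - x0) /\ q x != 0) ->
  isdim (ccoords c P) #|J|.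
Proof.
move=> LD Phil Linj Lsurj Dq qx0 PE.
have [b /all_and2[Lb Phib]] : {b : J -> E & forall j, L (b j) /\ forall i, Phi i (b j) = (i == j)%:R}.
  apply: (@choice _ _ (fun j x => L x /\ forall i, Phi i x = (i == j)%:R)) => j.
  by have [x Lx xE] := Lsurj (fun i => (i == j)%:R); exists x.
pose psi (v : J -> F) := \sum_j iota (v j) *: b j.
have [z0 Lz0 z0E] := Lsurj (fun=> 0).
have {z0 Lz0 z0E} L0 : L 0 by rewrite -(Linj _ Lz0 z0E).
have Lpsi v : L (psi v).
  rewrite /psi; elim/big_rec: _ => // j x _ Lx; rewrite addrC; exact: LD.
have Phipsi v i : Phi i (psi v) = v i.
  rewrite /psi flinear_sum // (bigD1 i) //= Phib eqxx mulr1 big1 ?addr0 // => j /negPf ij.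
  by rewrite Phib eq_sym ij mulr0.
have psiPhi x : L x -> psi (fun j => Phi j x) = x.
  move=> Lx; apply/eqP; rewrite -subr_eq0; apply/eqP; apply: Linj => [|j].
    have := LD _ _ (-1) (Lpsi (fun j => Phi j x)) Lx.
    by rewrite rmorphN1 scaleN1r.
  have := (Phil j).1 (psi (fun j => Phi j x)) (iota (-1) *: x).
  by rewrite (Phil j).2 mulN1r rmorphN1 scaleN1r Phipsi subrr.
pose z j (x : {x | P x}) := Phi j (sval x - x0).
have dz : isdim z #|J|.
  apply: (@isdim_open _ Finf _ _ _ _ (fun v => q (x0 + psi v))).
  - apply: (deg_le_comp (s' := fun i v => cfun c (x0 + psi v) i) (k := 1) (D := k)).
      by move=> i; apply: deg_le_cfun_affine => j; exact: (deg_le_var (fun j (v : J -> F) => v j)).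
    exact: (deg_le_pull (fun v => x0 + psi v) Dq).
  - exists (fun=> 0); rewrite /psi big1 ?addr0 // => j _.
    by rewrite rmorph0 scale0r.
  - move=> v qv; have Pv : P (x0 + psi v).
      by apply/PE; split=> //; rewrite addrC addKr.
    by exists (exist _ _ Pv) => j; rewrite /z /= addrC addKr Phipsi.
apply: (isdim_equiv (k := 1) (k' := 1)) dz => [i|j].
  apply: (@deg_le_ext _ _ _ _ _ (fun x => cfun c (x0 + psi (z^~ x)) i)).
    by apply: deg_le_cfun_affine => j; exact: deg_le_var.
  by move=> [x Px]; rewrite /z /= psiPhi; [rewrite addrC subrK|case: ((PE x).1 Px)].
apply: (deg_add (deg_le_flinear c (fun x : {x | P x} => sval x) (Phil j))
  (deg_cst _ (c := - Phi j x0) _ _)) => // -[x Px]; rewrite /z /=.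
have := (Phil j).1 x (iota (-1) *: x0).
by rewrite (Phil j).2 mulN1r rmorphN1 scaleN1r.
Qed.

Lemma zdim_coords (A : set E) d : isdim (ccoords c A) d -> zdim (cfun c @` A) = d.
Proof.
apply: (isdim_zdim (s := fun (x : {x | A x}) => cfun c (sval x))).
  by move=> [x Ax]; exists x.
by move=> _ [x Ax <-]; exists (exist _ x Ax).
Qed.

Lemma zdim_open (P : set E) q k x0 : deg_le (fun i x => cfun c x i) k q -> q x0 != 0 ->
  (forall x, P x <-> q x != 0) -> zdim (cfun c @` P) = csize c.
Proof.
move=> Dq qx0 Pq; apply: zdim_coords; suff: isdim (ccoords c P) #|{: 'I_(csize c)}| by rewrite card_ord.
apply: (@isdim_affine_open (fun=> True) _ x0 q k _ (fun i x => cfun c x i)) => //.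
- by move=> i; exact: flinear_cfun.
- move=> x _ x0'; rewrite [x](cfunE c) big1 // => i _.
  by rewrite x0' rmorph0 scale0r.
- by move=> v; exists (\sum_j iota (v j) *: cvec c j) => // j; rewrite cfun_sum.
- by move=> x; rewrite Pq; split=> // -[].
Qed.

Lemma zdim_setT : zdim (cfun c @` [set: E]) = csize c.
Proof.
apply: (@zdim_open _ (fun=> 1) 0 0); first exact: deg_cst.
- exact: oner_neq0.
- by move=> x; split=> // _; exact: oner_neq0.
Qed.

End LinearSpaces.

Section EndGroups.
Variables (E : vectType K) (c : coordinates E) (ce : coordinates 'End(E)).

Lemma deg_le_fmatrix T (x : T -> 'End(E)) i j :
  deg_le (fun i t => cfun ce (x t) i) 1 (fun t => fmatrix c (x t) i j).
Proof. exact: (deg_le_flinear ce x (flinear_fmatrix i j)). Qed.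

(** The linear map L from coordinates to matrix entries is injective, so R recovers the coordinates,
    even where the entries are more numerous, as for a complex endomorphism written as a real
    matrix. *)
Lemma deg_le_coords_fmatrix T (x : T -> 'End(E)) k :
  deg_le (fun ij t => fmatrix c (x t) ij.1 ij.2) 1 (fun t => cfun ce (x t) k).
Proof.
pose L : 'M[F]_(csize ce, _) := \matrix_k mxvec (fmatrix c (cvec ce k)).
have rL g : \row_k cfun ce g k *m L = mxvec (fmatrix c g).
  apply/rowP => l; rewrite mxE; have [i j] := mxvec_indexP l; rewrite mxvecE.
  rewrite (flinearE ce g (flinear_fmatrix i j)); apply: eq_bigr => k' _.
  by rewrite !mxE mxvecE mxE.
have freeL : row_free L.
  rewrite -kermx_eq0; apply/eqP/row_matrixP => k'; rewrite row0.
  set v := row k' _; have vL : v *m L = 0 by apply/eqP; rewrite -sub_kermx row_sub.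
  pose g := \sum_j iota (v 0 j) *: cvec ce j.
  have vE : v = \row_k cfun ce g k by apply/rowP => j; rewrite [RHS]mxE cfun_sum.
  move: vL; rewrite vE rL => g0; have -> : g = 0.
    apply: (@fmatrix_inj _ c); apply: (can_inj mxvecK); rewrite g0.
    apply/rowP => l; have [i j] := mxvec_indexP l; rewrite mxvecE mxE.
    by have := (flinear_fmatrix i j).2 0 0; rewrite scaler0 mul0r.
  by apply/rowP => j; rewrite !mxE; have := cfunZ ce 0 0 j; rewrite scaler0 mul0r.
have [R LR] := row_freeP freeL.
apply: (@deg_le_ext _ _ _ _ _ (fun t => \sum_l R l k * (mxvec (fmatrix c (x t))) 0 l)).
  apply: deg_le_sum => l _; apply: deg_leZ; have [i j] := mxvec_indexP l.
  apply: deg_le_ext (deg_le_var (fun ij t => fmatrix c (x t) ij.1 ij.2) (i, j)) _ => t.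
  by rewrite mxvecE.
move=> t; transitivity ((mxvec (fmatrix c (x t)) *m R) 0 k).
  by rewrite mxE; apply: eq_bigr => l _; rewrite mulrC.
by rewrite -rL -mulmxA LR mulmx1 mxE.
Qed.

Let Mset (P : 'End(E) -> Prop) (m : 'M[F]_(csize c)) := exists2 g, P g & fmatrix c g = m.

Lemma isdim_fmatrix P d : isdim (ccoords ce P) d <-> isdim (@entries F (csize c) (Mset P)) d.
Proof.
pose phi (g : {g | P g}) : {m | Mset P m} :=
  exist _ (fmatrix c (sval g)) (ex_intro2 _ _ (sval g) (svalP g) erefl).
have surj m : exists g, phi g = m.
  case: m => m [g Pg gm]; exists (exist _ g Pg); exact/eq_exist.
rewrite -(isdim_surj _ _ surj); split; apply: isdim_equiv => [ij|i].
- exact: deg_le_fmatrix.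
- exact: deg_le_coords_fmatrix.
- exact: deg_le_coords_fmatrix.
- exact: deg_le_fmatrix.
Qed.

Variables (A Y : 'End(E) -> Prop).
Hypothesis AY : forall g, A g -> lker (g - \1%VF) == 0%VS -> Y ((g - \1%VF)^-1)%VF.
Hypothesis YA : forall y, Y y -> lker y == 0%VS -> A (\1%VF + (y^-1)%VF).
Hypothesis AM : forall g h, A g -> A h -> A (g \o h)%VF.
Hypothesis AV : forall g, A g -> lker g == 0%VS /\ A (g^-1)%VF.
Hypothesis A1 : exists g0, A g0 /\ lker (g0 - \1%VF) == 0%VS.

Theorem isdim_End_group d :
  isdim (ccoords ce (fun y => Y y /\ lker y == 0%VS)) d -> isdim (ccoords ce A) d.
Proof.
move=> /isdim_fmatrix dY; apply/isdim_fmatrix.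
have sub1 g : fmatrix c g - 1%:M = fmatrix c (g - \1%VF).
  by rewrite fmatrixD fmatrixN fmatrix1.
apply: (@isdim_group _ _ Finf (Mset A) (Mset Y)).
- move=> _ [g Ag <-]; rewrite sub1 fmatrix_unit => ug.
  by exists ((g - \1%VF)^-1)%VF; [apply: AY|rewrite fmatrixV].
- move=> _ [y Yy <-]; rewrite fmatrix_unit => uy.
  by exists (\1%VF + (y^-1)%VF); [apply: YA|rewrite fmatrixD fmatrix1 fmatrixV].
- move=> _ _ [g Ag <-] [h Ah <-]; exists (h \o g)%VF; first exact: AM.
  exact: fmatrix_comp.
- move=> _ [g Ag <-]; have [kg Ag'] := AV Ag; rewrite fmatrix_unit; split=> //.
  by exists (g^-1)%VF => //; rewrite fmatrixV.
- have [g0 [Ag0 kg0]] := A1; exists (fmatrix c g0); split; first by exists g0.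
  by rewrite sub1 fmatrix_unit.
suff -> : (fun y : 'M_(csize c) => Mset Y y /\ y \in unitmx) =
    Mset (fun y => Y y /\ lker y == 0%VS) by [].
apply/funext => m; apply/propext; split=> [[[g Yg <-]]|[g [Yg kg] <-]].
  by rewrite fmatrix_unit => kg; exists g.
by split; [exists g|rewrite fmatrix_unit].
Qed.

(** The chart set Y is the translate of the linear space L by (g0 - 1)^-1, so the group has the
    dimension of L, on which the Phi_j are coordinates. *)
Lemma zdim_End_group (J : finType) (L : 'End(E) -> Prop) (Phi : J -> 'End(E) -> F) :
  (forall y, Y y -> forall y', Y y' <-> L (y' - y)) ->
  (forall x y a, L x -> L y -> L (x + iota a *: y)) ->
  (forall j, flinear (Phi j)) ->
  (forall x, L x -> (forall j, Phi j x = 0) -> x = 0) ->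
  (forall v : J -> F, exists2 x, L x & forall j, Phi j x = v j) ->
  zdim (cfun ce @` [set g | A g]) = #|J|.
Proof.
move=> YL LD Phil Linj Lsurj; apply: zdim_coords; apply: isdim_End_group.
have [g0 [Ag0 kg0]] := A1.
apply: (@isdim_affine_open _ ce L _ ((g0 - \1%VF)^-1)%VF
  (fun y => \det (fmatrix c y)) (csize c * 1) _ Phi) => //.
- by apply: deg_le_det => i j; exact: (deg_le_fmatrix (fun x : 'End(E) => x)).
- rewrite -unitfE -unitmxE fmatrixV // unitmx_inv fmatrix_unit //.
- move=> y; rewrite -(fmatrix_unit c) unitmxE unitfE.
  by rewrite (YL _ (AY Ag0 kg0)).
Qed.

Lemma zdim_GL : zdim (cfun ce @` [set g : 'End(E) | lker g == 0%VS]) = csize ce.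
Proof.
apply: (@zdim_open _ ce _ (fun y => \det (fmatrix c y)) (csize c * 1) \1%VF).
- by apply: deg_le_det => i j; exact: (deg_le_fmatrix (fun x : 'End(E) => x)).
- by rewrite fmatrix1 det1 oner_neq0.
- by move=> y; rewrite /= -(fmatrix_unit c) unitmxE unitfE.
Qed.

End EndGroups.
End Coordinates.

(** * Frames of isotropic subspaces *)

Section Families.
Variables (K : fieldType) (V : vectType K).

(** Families over finite types rather than sequences: the frames below are indexed by sums of types,
    one summand for each kind of vector. *)
Definition ffree (I : finType) (e : I -> V) : Prop :=
  forall c : I -> K, \sum_i c i *: e i = 0 -> forall i, c i = 0.

Definition fspan (I : finType) (e : I -> V) : {vspace V} := (\sum_i <[e i]>)%VS.

Definition fbasis (X : {vspace V}) (I : finType) (e : I -> V) : Prop :=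
  ffree e /\ fspan e = X.

Definition sumf (T I I' : Type) (e : I -> T) (e' : I' -> T) (i : I + I') :=
  match i with inl i => e i | inr i => e' i end.

Lemma mem_fspan (I : finType) (e : I -> V) i : e i \in fspan e.
Proof. by apply: (subvP (sumv_sup i _ (subvv _))) => //; exact: memv_line. Qed.

Lemma fspan_sum (I : finType) (e : I -> V) (c : I -> K) : \sum_i c i *: e i \in fspan e.
Proof. by apply: rpred_sum => i _; apply/rpredZ/mem_fspan. Qed.

Lemma fspanP (I : finType) (e : I -> V) v :
  v \in fspan e -> exists c : I -> K, v = \sum_i c i *: e i.
Proof.
move=> /memv_sumP[w ew ->].
have /choice[c cE] : forall i, exists k, w i = k *: e i.
  by move=> i; have /vlineP[k] := ew i isT; exists k.
by exists c; apply: eq_bigr => i _; rewrite cE.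
Qed.

Lemma fspan_sub (I : finType) (e : I -> V) (X : {vspace V}) : (forall i, e i \in X) -> (fspan e <= X)%VS.
Proof. by move=> eX; apply/subv_sumP => i _; rewrite -memvE. Qed.

Lemma fbasis_exists X : exists e : 'I_(\dim X) -> V, fbasis X e.
Proof.
exists (fun i => (vbasis X)`_i); have bX := vbasisP X; split.
  by move=> c; apply/freeP; exact: basis_free bX.
rewrite -[RHS](span_basis bX); apply/eqP; rewrite eqEsubv; apply/andP; split.
  by apply: fspan_sub => i; apply/memv_span/mem_nth; rewrite size_tuple.
apply/subvP => v /coord_span ->; exact: fspan_sum.
Qed.

Section Enum.
Variables (I : finType) (e : I -> V).

Let te : #|I|.-tuple V := [tuple e (enum_val i) | i < #|I|].

Let teE (i : 'I_#|I|) : te`_i = e (enum_val i).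
Proof. by rewrite -tnth_nth tnth_mktuple. Qed.

Let te_span : <<te>>%VS = fspan e.
Proof.
apply/eqP; rewrite eqEsubv; apply/andP; split.
  by apply/span_subvP => v /tnthP[i ->]; rewrite tnth_mktuple mem_fspan.
apply: fspan_sub => i; apply: memv_span; rewrite -(enum_rankK i) -teE mem_nth //.
by rewrite size_tuple.
Qed.

Let te_free : ffree e -> free te.
Proof.
move=> fe; apply/freeP => c c0 i; rewrite -(enum_valK i).
apply: (fe (fun i => c (enum_rank i))).
rewrite (reindex _ (onW_bij _ (@enum_val_bij I))) /= -[RHS]c0.
by apply: eq_bigr => j _; rewrite enum_valK teE.
Qed.

Lemma dim_fspan : ffree e -> \dim (fspan e) = #|I|.
Proof. by move=> /te_free; rewrite -te_span /free => /eqP ->; rewrite size_tuple. Qed.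

Lemma fbasis_free_card (X : {vspace V}) : ffree e -> (forall i, e i \in X) -> #|I| = \dim X -> fbasis X e.
Proof.
move=> fe eX cI; split=> //; apply/eqP; rewrite eqEdim fspan_sub //=.
by rewrite dim_fspan // cI.
Qed.

Lemma fbasis_card X : fbasis X e -> #|I| = \dim X.
Proof. by move=> [fe <-]; rewrite dim_fspan. Qed.

Lemma fbasis_lfun (W : vectType K) (f : I -> W) : ffree e ->
  exists g : 'Hom(V, W), forall i, g (e i) = f i.
Proof.
move=> /te_free fe.
have [g gE] := linear_of_free te [tuple f (enum_val i) | i < #|I|].
exists (linfun g) => i; rewrite lfunE /=.
have := gE fe; rewrite !size_tuple => /(_ erefl) /(congr1 (fun s => nth 0 s (enum_rank i))).
rewrite (nth_map 0) ?size_tuple // teE enum_rankK => ->.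
by rewrite -tnth_nth tnth_mktuple enum_rankK.
Qed.

End Enum.

Lemma ffree_sum (I I' : finType) (e : I -> V) (e' : I' -> V) :
  ffree e -> ffree e' -> (fspan e :&: fspan e' = 0)%VS -> ffree (sumf e e').
Proof.
move=> fe fe' ee' c; rewrite big_sumType /= => /eqP c0.
have : \sum_i c (inl i) *: e i \in (fspan e :&: fspan e')%VS.
  by rewrite memv_cap fspan_sum /=; move: c0; rewrite addr_eq0 => /eqP ->; rewrite memvN fspan_sum.
rewrite ee' memv0 => /eqP c1; move: c0; rewrite c1 add0r => /eqP c2.
by case=> i; [apply: (fe (fun i => c (inl i)))|apply: (fe' (fun i => c (inr i)))].
Qed.

Lemma fspan_sumf (I I' : finType) (e : I -> V) (e' : I' -> V) :
  fspan (sumf e e') = (fspan e + fspan e')%VS.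
Proof. by rewrite /fspan big_sumType. Qed.

Lemma fbasis_sum X Y (I I' : finType) (e : I -> V) (e' : I' -> V) :
  fbasis X e -> fbasis Y e' -> (X :&: Y = 0)%VS -> fbasis (X + Y)%VS (sumf e e').
Proof. by move=> [fe <-] [fe' <-] XY; split; [apply: ffree_sum|rewrite fspan_sumf]. Qed.

Lemma limg_fspan (W : vectType K) (g : 'Hom(V, W)) (I : finType) (e : I -> V) :
  (g @: fspan e)%VS = (\sum_i <[g (e i)]>)%VS.
Proof. by rewrite limg_sum; apply: eq_bigr => i _; rewrite limg_line. Qed.

End Families.

(** * Dual families and hyperbolic completion *)

Section SesquilinearFamilies.
Variables (K : fieldType) (eps : bool) (theta : {rmorphism K -> K}).
Hypothesis thetaK : involutive theta.
Variables (V : vectType K) (B : {hermitian V for eps & theta}).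
Implicit Types (X Y U : {vspace V}).

Lemma form_suml (I : finType) (c : I -> K) (f : I -> V) v :
  B (\sum_i c i *: f i) v = \sum_i c i * B (f i) v.
Proof. by rewrite linear_sumlz; apply: eq_bigr => i _; rewrite linearZl_LR. Qed.

Lemma form_sumr (I : finType) (c : I -> K) (f : I -> V) v :
  B v (\sum_i c i *: f i) = \sum_i theta (c i) * B v (f i).
Proof. by rewrite linear_sumr; apply: eq_bigr => i _; rewrite linearZr_LR. Qed.

Lemma herm_sym0 u v : B u v = 0 -> B v u = 0.
Proof. by move=> uv; apply/eqP; rewrite herm_eq0C uv. Qed.

Definition ndeg X : Prop := (X :&: orthov B X = 0)%VS.

Lemma ndegP X : ndeg X <-> (forall v, v \in X -> (forall x, x \in X -> B v x = 0) -> v = 0).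
Proof.
split=> [nX v vX v0|nX].
  by apply/eqP; rewrite -memv0 -nX memv_cap vX; apply/mem_orthovP.
apply/eqP; rewrite -subv0; apply/subvP => v; rewrite memv_cap memv0 => /andP[vX /mem_orthovP v0].
by apply/eqP/nX.
Qed.

(** Nondegeneracy gives full column rank to the matrix of pairings of a basis of X with e; the rows
    of a left inverse are the coordinates of d. *)
Lemma dual_family X (I : finType) (e : I -> V) : ndeg X -> (forall i, e i \in X) -> ffree e ->
  exists d : I -> V, (forall i, d i \in X) /\ forall i j, B (d i) (e j) = (i == j)%:R.
Proof.
move=> /ndegP nX eX fe; pose x i := (vbasis X)`_i.
have xX (i : 'I_(\dim X)) : x i \in X by apply/vbasis_mem/mem_nth; rewrite size_tuple.
pose G : 'M[K]_(\dim X, #|I|) := \matrix_(k, i) B (x k) (e (enum_val i)).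
have /row_fullP[D DG] : row_full G.
  rewrite /row_full -mxrank_tr; change (row_free G^T); rewrite -kermx_eq0.
  apply/eqP/row_matrixP => k; rewrite row0; set v := row k _.
  have vG : v *m G^T = 0 by apply/eqP; rewrite -sub_kermx row_sub.
  pose w := \sum_i theta (v 0 (enum_rank i)) *: e i.
  have w0 : w = 0.
    apply: nX => [|y yX]; first by apply: rpred_sum => i _; apply/rpredZ/eX.
    apply: herm_sym0; rewrite (coord_vbasis yX) form_suml big1 // => l _.
    suff -> : B (x l) w = 0 by rewrite mulr0.
    have /rowP/(_ l) := vG; rewrite !mxE => vG0; rewrite form_sumr -[RHS]vG0.
    rewrite (reindex _ (onW_bij _ (@enum_val_bij I))) /=.
    by apply: eq_bigr => i _; rewrite thetaK enum_valK !mxE.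
  apply/rowP => i; have := fe _ w0 (enum_val i); rewrite enum_valK => /eqP.
  by rewrite fmorph_eq0 => /eqP ->; rewrite mxE.
exists (fun i => \sum_k D (enum_rank i) k *: x k); split=> [i|i j].
  by apply: rpred_sum => k _; apply: rpredZ.
rewrite form_suml; have /matrixP/(_ (enum_rank i) (enum_rank j)) := DG.
rewrite !mxE (inj_eq enum_rank_inj) => <-; apply: eq_bigr => k _.
by rewrite mxE enum_rankK.
Qed.

(* d is dual to f and spans the same space. *)
Definition dual_pair (I : finType) (f d : I -> V) : Prop :=
  (forall i j, B (f i) (d j) = (i == j)%:R) /\
  forall v, (forall j, B v (d j) = 0) -> forall i, B v (f i) = 0.

(** v minus the sum of the B(v, d_i) f_i is orthogonal to every d_j, hence to every f_j: the
    orthogonal projection, although the f_i need not be orthogonal to each other. *)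
Lemma dual_pair_split X (I : finType) (f d : I -> V) : ndeg X ->
  (forall i, f i \in X) -> dual_pair f d ->
  let Y := (X :&: orthov B (fspan f))%VS in
  ndeg Y /\ forall (I' : finType) (g : I' -> V), fbasis Y g -> fbasis X (sumf f g).
Proof.
move=> /ndegP nX fX [fd df] Y.
have fY y i : y \in Y -> B y (f i) = 0.
  by rewrite memv_cap => /andP[_ /mem_orthovP]; apply; exact: mem_fspan.
have dec v : v \in X -> exists c y, y \in Y /\ v = \sum_i c i *: f i + y.
  move=> vX; exists (fun i => B v (d i)), (v - \sum_i B v (d i) *: f i).
  split; last by rewrite addrC subrK.
  rewrite memv_cap rpredB ?rpred_sum //=; last by move=> i _; apply: rpredZ.
  apply/mem_orthovP => _ /fspanP[c ->]; rewrite form_sumr big1 // => i _.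
  rewrite df ?mulr0 // => j; rewrite linearBl /= form_suml (bigD1 j) //= fd eqxx mulr1.
  by rewrite big1 ?addr0 ?subrr // => k /negPf kj; rewrite fd kj mulr0.
split.
  apply/ndegP => y yY y0; apply: nX => [|x /dec[c [z [zY ->]]]].
    by move: yY; rewrite memv_cap => /andP[].
  rewrite linearDr /= form_sumr y0 // addr0 big1 // => i _.
  by rewrite fY ?mulr0.
move=> I' g [fg gY]; split; last first.
  rewrite fspan_sumf gY; apply/eqP; rewrite eqEsubv subv_add fspan_sub //= capvSl /=.
  apply/subvP => v /dec[c [y [yY ->]]]; apply: memv_add => //; exact: fspan_sum.
apply: ffree_sum => //.
  move=> c c0 j; have := form_suml c f (d j).
  rewrite c0 linear0l (bigD1 j) //= fd eqxx mulr1 big1 ?addr0 // => k /negPf kj.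
  by rewrite fd kj mulr0.
rewrite gY; apply/eqP; rewrite -subv0; apply/subvP => v; rewrite memv_cap => /andP[vf vY].
rewrite memv0; apply/eqP/nX; first by move: vY; rewrite memv_cap => /andP[].
move=> x /dec[c [z [zY ->]]]; rewrite linearDr /= form_sumr big1 => [|i _]; last by rewrite fY ?mulr0.
rewrite add0r; have [c' ->] := fspanP vf.
rewrite form_suml big1 // => i _; rewrite (herm_sym0 (fY z i zY)) ?mulr0 //.
Qed.

(* Any Gram matrix of B is of the form h + h^*. *)
Hypothesis half : forall (I : finType) (y : I -> V), exists h : I -> I -> K,
  forall i j, B (y i) (y j) = h i j + (-1) ^+ eps * theta (h j i).

(** A dual family is corrected by vectors in the span of x. Its pairing with x is unchanged, and the
    coefficients h, taken from a splitting h + h^* of its Gram matrix, cancel that matrix. *)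
Lemma hyperbolic_completion X (I : finType) (x : I -> V) : ndeg X -> ffree x ->
  (forall i, x i \in X) -> (forall i j, B (x i) (x j) = 0) ->
  exists y : I -> V, [/\ forall i, y i \in X, forall i j, B (x i) (y j) = (i == j)%:R &
    forall i j, B (y i) (y j) = 0].
Proof.
move=> nX fx xX xx; have [d [dX dx]] := dual_family nX xX fx.
have [h hE] := half (fun i => (-1) ^+ eps *: d i).
pose y j := (-1) ^+ eps *: d j - \sum_i h j i *: x i.
have sgn2 : (-1) ^+ eps * (-1) ^+ eps = 1 :> K by rewrite -expr2 sqrr_sign.
have yx i j : B (y i) (x j) = (-1) ^+ eps * (i == j)%:R.
  rewrite linearBl /= linearZl_LR /= dx form_suml big1 ?subr0 // => k _.
  by rewrite xx mulr0.
have xy i j : B (x i) (y j) = (i == j)%:R.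
  by rewrite hermC yx rmorphM rmorph_sign rmorph_nat mulrA sgn2 mul1r eq_sym.
exists y; split=> // [i|i j].
  by rewrite rpredB ?rpredZ ?rpred_sum // => k _; apply: rpredZ.
rewrite {2}/y linearBr /= form_sumr.
under eq_bigr => k _ do rewrite yx.
rewrite (bigD1 i) //= eqxx mulr1 [X in - (_ + X)]big1 ?addr0 => [|k /negPf ki]; last first.
  by rewrite eq_sym ki !mulr0.
rewrite /y linearBl /= hE form_suml (bigD1 j) //=.
rewrite big1 ?addr0 => [|k /negPf kj]; last first.
  by rewrite linearZr_LR /= hermC dx eq_sym kj rmorph0 !mulr0.
rewrite linearZr_LR /= rmorph_sign [B (x j) _]hermC dx eqxx rmorph1 mulr1 sgn2 mulr1.
by rewrite [h i j + _]addrC addrK mulrC subrr.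
Qed.

End SesquilinearFamilies.

(** * Normal form of an isotropic subspace *)

Section NormalForm.
Variables (K : fieldType) (eps : bool) (theta : {rmorphism K -> K}).
Hypothesis thetaK : involutive theta.
Variables (V : vectType K) (B : {hermitian V for eps & theta}).
Hypothesis half : forall (I : finType) (y : I -> V), exists h : I -> I -> K,
  forall i j, B (y i) (y j) = h i j + (-1) ^+ eps * theta (h j i).
Variables (TT : Type) (J : TT -> forall n, 'I_n -> 'I_n -> K).
Arguments J : clear implicits.
Hypothesis std_basis : forall X : {vspace V}, ndeg B X ->
  exists t (e : 'I_(\dim X) -> V), fbasis X e /\ forall i j, B (e i) (e j) = J t _ i j.

Lemma gram_dual_pair (I : finType) (b : I -> V) :
  (forall c : I -> K, (forall j, \sum_i c i * B (b i) (b j) = 0) -> forall i, c i = 0) ->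
  exists d, (forall i, d i \in fspan b) /\ dual_pair B b d.
Proof.
move=> nb; pose G : 'M[K]_#|I| := \matrix_(i, j) B (b (enum_val i)) (b (enum_val j)).
have uG : G \in unitmx.
  rewrite -row_free_unit -kermx_eq0; apply/eqP/row_matrixP => k; rewrite row0.
  set v := row k _; have vG : v *m G = 0 by apply/eqP; rewrite -sub_kermx row_sub.
  apply/rowP => i; rewrite [RHS]mxE.
  have := nb (fun i => v 0 (enum_rank i)) _ (enum_val i); rewrite enum_valK; apply => j.
  have /rowP/(_ (enum_rank j)) := vG; rewrite !mxE => vG0; rewrite -[RHS]vG0.
  rewrite (reindex _ (onW_bij _ (@enum_val_bij I))) /=.
  by apply: eq_bigr => i' _; rewrite enum_valK [G _ _]mxE enum_rankK.
pose D := invmx G.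
pose d j := \sum_k theta (D (enum_rank k) (enum_rank j)) *: b k.
have vd v j : B v (d j) = ((\row_k B v (b (enum_val k))) *m D) 0 (enum_rank j).
  rewrite form_sumr mxE (reindex _ (onW_bij _ (@enum_val_bij I))) /=.
  by apply: eq_bigr => k _; rewrite thetaK enum_valK mxE mulrC.
exists d; split=> [i|]; first exact: fspan_sum.
split=> [i j|v v0 i].
  rewrite vd; have -> : (\row_k B (b i) (b (enum_val k))) = row (enum_rank i) G.
    by apply/rowP => k; rewrite !mxE enum_rankK.
  by rewrite -row_mul mulmxV // !mxE (inj_eq enum_rank_inj).
have : (\row_k B v (b (enum_val k))) *m D = 0.
  by apply/rowP => j; rewrite -(enum_valK j) -vd v0 mxE.
move=> /(congr1 (mulmxr G)); rewrite /mulmxr /= mulmxKV // mul0mx => /rowP/(_ (enum_rank i)).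
by rewrite !mxE enum_rankK.
Qed.

(** Gram matrix of an orthogonal sum: a block Gb, hyperbolic pairs x_i, y_i with B(x_i, y_i) = 1,
    and a block Gc. *)
Definition hyp_gram (I I' I'' : finType) (Gb : I -> I -> K) (Gc : I'' -> I'' -> K)
    (i j : I + ((I' + I') + I'')) : K :=
  match i, j with
  | inl i, inl j => Gb i j
  | inr (inl (inl i)), inr (inl (inr j)) => (i == j)%:R
  | inr (inl (inr i)), inr (inl (inl j)) => (-1) ^+ eps * (i == j)%:R
  | inr (inr i), inr (inr j) => Gc i j
  | _, _ => 0
  end.

(** Split off the nondegenerate span of b, complete x to hyperbolic pairs inside its complement,
    split these off as well, and take a standard basis of what is left. *)
Lemma std_complete (U : {vspace V}) (I I' : finType) (b : I -> V) (x : I' -> V) : ndeg B U ->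
  (forall i, b i \in U) -> (forall i, x i \in U) -> ffree x ->
  (forall c : I -> K, (forall j, \sum_i c i * B (b i) (b j) = 0) -> forall i, c i = 0) ->
  (forall i j, B (x i) (x j) = 0) -> (forall i j, B (x i) (b j) = 0) ->
  exists n t (y : I' -> V) (c : 'I_n -> V),
    let e := sumf b (sumf (sumf x y) c) in fbasis U e /\
    forall i j, B (e i) (e j) = hyp_gram (fun i j => B (b i) (b j)) (J t n) i j.
Proof.
move=> nU bU xU fx gb xx xb.
have [d [_ bd]] := gram_dual_pair gb.
have [nE Eb] := dual_pair_split nU bU bd.
set E := (U :&: _)%VS in nE Eb.
have Eperp v i : v \in E -> B (b i) v = 0.
  rewrite memv_cap => /andP[_ /mem_orthovP v0]; apply: herm_sym0; apply: v0.
  exact: mem_fspan.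
have xE i : x i \in E.
  rewrite memv_cap xU; apply/mem_orthovP => _ /fspanP[c ->].
  by rewrite form_sumr big1 // => j _; rewrite xb mulr0.
have [y [yE xy yy]] := hyperbolic_completion thetaK half nE fx xE xx.
have sgn2 : (-1) ^+ eps * (-1) ^+ eps = 1 :> K by rewrite -expr2 sqrr_sign.
have yx i j : B (y i) (x j) = (-1) ^+ eps * (i == j)%:R.
  by rewrite hermC xy rmorph_nat eq_sym.
have xyd : dual_pair B (sumf x y) (sumf y (fun i => (-1) ^+ eps *: x i)).
  split=> [[i|i] [j|j]|v v0 [i|i]] /=.
  - by rewrite xy.
  - by rewrite linearZr_LR /= xx mulr0.
  - exact: yy.
  - by rewrite linearZr_LR /= yx rmorph_sign mulrA sgn2 mul1r.
  - by have /eqP := v0 (inr i); rewrite /= linearZr_LR /= rmorph_sign mulf_eq0 signr_eq0 /= => /eqP.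
  - exact: (v0 (inl i)).
have [|nC Cxy] := dual_pair_split nE (f := sumf x y) _ xyd; first by case.
set C := (E :&: _)%VS in nC Cxy.
have Cperp v i : v \in C -> B (sumf x y i) v = 0.
  rewrite memv_cap => /andP[_ /mem_orthovP v0]; apply: herm_sym0; apply: v0.
  exact: mem_fspan.
have [t [c [cC cJ]]] := std_basis nC.
have inC i : c i \in C by rewrite -(proj2 cC) mem_fspan.
have inE i : c i \in E by have := inC i; rewrite memv_cap => /andP[].
have by0 i j : B (b i) (y j) = 0 by apply: Eperp.
have bc i j : B (b i) (c j) = 0 by apply: Eperp.
have xc i j : B (x i) (c j) = 0 by apply: (Cperp _ (inl i)).
have yc i j : B (y i) (c j) = 0 by apply: (Cperp _ (inr i)).
exists (\dim C), t, y, c; split; first exact/Eb/Cxy.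
by case=> [i|[[i|i]|i]] [j|[[j|j]|j]] //=; exact: herm_sym0.
Qed.

(** On the side of U: a basis of P_U S modulo its radical (b), bases of S meet U (r) and of the
    radical modulo it (a), the vectors dual to these (r and a again), and a complement (c). The
    frame of W has the same a and b. *)
Definition frame_index (r a b c : nat) : finType :=
  ('I_b + ((('I_r + 'I_a) + ('I_r + 'I_a)) + 'I_c))%type.

(** The factor s is 1 for U and -1 for W, with one label t for both, since the correspondence
    between P_U S and P_W S reverses the sign of B. In the indefinite cases a label is a number of
    plus signs. *)
Definition frame_gram r a b c (s : K) (t t' : TT) : frame_index r a b c -> frame_index r a b c -> K :=
  hyp_gram (fun i j => s * J t b i j) (J t' c).
Arguments frame_gram {r a b c} s t t' i j.

Section FrameVectors.
Variables (r a b c : nat) (e : frame_index r a b c -> V).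
Definition frame_r i := e (inr (inl (inl (inl i)))).
Definition frame_a i := e (inr (inl (inl (inr i)))).
Definition frame_b i := e (inl i).
Definition frame_c i := e (inr (inr i)).
Definition frame_a' i := e (inr (inl (inr (inr i)))).
End FrameVectors.

Definition isotropic_family r r' a b c c' (e : frame_index r a b c -> V)
    (f : frame_index r' a b c' -> V) : ('I_r + 'I_r') + ('I_a + 'I_b) -> V :=
  sumf (sumf (frame_r e) (frame_r f))
    (sumf (fun i => frame_a e i + frame_a f i) (fun i => frame_b e i + frame_b f i)).

Hypothesis ndB : nondegenerate B.
Variables (U W : {vspace V}).
Hypothesis UW : orthodecomp B U W.

Definition normal_frame r r' a b c c' t tU tW (S : {vspace V}) (e : frame_index r a b c -> V)
    (f : frame_index r' a b c' -> V) : Prop :=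
  [/\ fbasis U e /\ fbasis W f,
      forall i j, B (e i) (e j) = frame_gram 1 t tU i j,
      forall i j, B (f i) (f j) = frame_gram (-1) t tW i j &
      S = fspan (isotropic_family e f)].

Let UWperp u w : u \in U -> w \in W -> B u w = 0.
Proof. by case: UW => _ _ /orthovP; apply. Qed.

Let UWdec v : exists u w, [/\ u \in U, w \in W & v = u + w].
Proof.
case: UW => UWf _ _; have /memv_addP[u uU [w wW ->]] : v \in (U + W)%VS by rewrite UWf memvf.
by exists u, w.
Qed.

Let UW0 v : v \in U -> v \in W -> v = 0.
Proof.
by case: UW => _ UWi _ vU vW; apply/eqP; rewrite -memv0 -UWi memv_cap vU.
Qed.

Lemma orthodecomp_sym : orthodecomp B W U.
Proof. by case: UW => h1 h2 h3; rewrite /orthodecomp addvC capvC orthov_sym. Qed.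

Lemma ndegB v : (forall u, B v u = 0) -> v = 0.
Proof.
move=> v0; apply/eqP; rewrite -memv0 -(eqP ndB); apply/mem_orthovP => u _; exact: v0.
Qed.

Lemma ndeg_orthodecomp : ndeg B U.
Proof.
apply/ndegP => v vU v0; apply: ndegB => x; have [u [w [uU wW ->]]] := UWdec x.
by rewrite linearDr /= v0 // UWperp // addr0.
Qed.

Lemma mem_Proj S v : v \in Proj U W S <-> v \in U /\ exists2 w, w \in W & v + w \in S.
Proof.
rewrite memv_cap; split=> [/andP[/memv_addP[s sS [w wW vE]] vU]|[vU [w wW vw]]].
  by split=> //; exists (- w); rewrite ?memvN // vE addrK.
by rewrite vU andbT -[v](addrK w) memv_add // memvN.
Qed.

Variable S : {vspace V}.
Hypothesis isoS : isotropic B S.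

Let SS s s' : s \in S -> s' \in S -> B s s' = 0.
Proof. by have /orthovP := isoS; apply. Qed.

Lemma anti_isometry u w u' w' : u \in U -> w \in W -> u' \in U -> w' \in W ->
  u + w \in S -> u' + w' \in S -> B w w' = - B u u'.
Proof.
move=> uU wW uU' wW' s s'; have uw' := UWperp uU wW'.
have wu' : B w u' = 0 by apply/herm_sym0/UWperp.
have /eqP := SS s s'; rewrite linearDl /= !linearDr /= uw' wu' addr0 add0r.
by rewrite addrC addr_eq0 => /eqP.
Qed.

Lemma capv_sub_Rad : (S :&: U <= Rad B (Proj U W S))%VS.
Proof.
apply/subvP => u; rewrite memv_cap => /andP[uS uU].
rewrite memv_cap; apply/andP; split.
  by apply/mem_Proj; split=> //; exists 0; rewrite ?mem0v ?addr0.
apply/mem_orthovP => u' /mem_Proj[uU' [w' wW' s']].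
have := SS uS s'; rewrite linearDr /= [B u w']UWperp // addr0 //.
Qed.

(** The vectors chosen in P_U S outside S meet U are lifted to S along W; by the anti-isometry their
    W-parts have the Gram matrix that [std_complete] requires in W. *)
Lemma normal_frame_exists : exists c c' t tU tW e f,
  @normal_frame (inv_r U S) (inv_r W S) (inv_a B U W S) (inv_b B U W S) c c' t tU tW S e f.
Proof.
set P := Proj U W S; set R := (S :&: U)%VS.
have PU : (P <= U)%VS by exact: capvSr.
have RP : (R <= Rad B P)%VS := capv_sub_Rad.
have RadP : (Rad B P <= P)%VS by exact: capvSl.
have quoD (X Y : {vspace V}) : (Y <= X)%VS -> (quo X Y + Y)%VS = X.
  by move=> YX; rewrite /quo addv_diff; apply/addv_idPl.
have [ru ruR] := fbasis_exists R.
have [au auA] := fbasis_exists (quo (Rad B P) R).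
have nQ : ndeg B (quo P (Rad B P)).
  apply/ndegP => v vQ v0; apply/eqP; rewrite -memv0 -(capv_diff P (Rad B P)) memv_cap vQ /=.
  have vP : v \in P by apply: (subvP (diffvSl P (Rad B P))).
  rewrite memv_cap vP; apply/mem_orthovP => u; rewrite -(quoD _ _ RadP).
  move=> /memv_addP[q qQ [z zR ->]]; rewrite linearDr /= v0 // add0r.
  by move: zR; rewrite memv_cap => /andP[_ /mem_orthovP z0]; apply/herm_sym0/z0.
have [t [bu [buQ buJ]]] := std_basis nQ.
have ruin i : ru i \in R by rewrite -(proj2 ruR) mem_fspan.
have auin i : au i \in Rad B P.
  by apply: (subvP (diffvSl _ R)); rewrite -/(quo (Rad B P) R) -(proj2 auA) mem_fspan.
have buin i : bu i \in P.
  by apply: (subvP (diffvSl _ (Rad B P))); rewrite -/(quo P (Rad B P)) -(proj2 buQ) mem_fspan.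
have inQ v : (v \in quo P (Rad B P)) = (v \in fspan bu) by rewrite (proj2 buQ).
have inA v : (v \in quo (Rad B P) R) = (v \in fspan au) by rewrite (proj2 auA).
have inR v : (v \in R) = (v \in fspan ru) by rewrite (proj2 ruR).
have decP u : u \in P -> exists c1 c2 c3,
    u = \sum_i c1 i *: bu i + (\sum_i c2 i *: au i + \sum_i c3 i *: ru i).
  move=> uP; have : u \in (quo P (Rad B P) + (quo (Rad B P) R + R))%VS by rewrite !quoD.
  move=> /memv_addP[q]; rewrite inQ => /fspanP[c1 ->] [z /memv_addP[a]].
  rewrite inA => /fspanP[c2 ->] [r]; rewrite inR => /fspanP[c3 ->] -> ->.
  by exists c1, c2, c3.
have lift v : v \in P -> exists w, w \in W /\ v + w \in S.
  by move=> /mem_Proj[_ [w wW s]]; exists w.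
have [aw /all_and2[awW awS]] := choice (fun i => lift _ (subvP RadP _ (auin i))).
have [bw /all_and2[bwW bwS]] := choice (fun i => lift _ (buin i)).
have [rw rwR] := fbasis_exists (S :&: W)%VS.
have rwin i : (rw i \in S) && (rw i \in W).
  by rewrite -memv_cap -(proj2 rwR) mem_fspan.
have inU v : v \in P -> v \in U by apply: subvP.
have radU u u' : u \in Rad B P -> u' \in P -> B u u' = 0.
  by rewrite memv_cap => /andP[_ /mem_orthovP]; apply.
have ruRad i : ru i \in Rad B P by apply: (subvP RP).
have xRad i : sumf ru au i \in Rad B P by case: i.
have fx : ffree (sumf ru au).
  apply: ffree_sum; [exact: (proj1 ruR)|exact: (proj1 auA)|].
  by rewrite (proj2 ruR) (proj2 auA) capvC capv_diff.
have gbu (c : 'I_(inv_b B U W S) -> K) : (forall j, \sum_i c i * B (bu i) (bu j) = 0) ->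
    forall i, c i = 0.
  move=> c0; apply: (proj1 buQ); move/ndegP: nQ; apply; first by rewrite inQ fspan_sum.
  move=> x; rewrite inQ => /fspanP[c' ->]; rewrite form_sumr big1 // => j _.
  by rewrite form_suml c0 mulr0.
have [n [tU [y [c [bU gU]]]]] :=
  @std_complete U _ _ bu (sumf ru au) ndeg_orthodecomp (fun i => inU _ (buin i))
    (fun i => inU _ (subvP RadP _ (xRad i))) fx gbu
    (fun i j => radU _ _ (xRad i) (subvP RadP _ (xRad j))) (fun i j => radU _ _ (xRad i) (buin j)).
have rww i u w : u \in U -> w \in W -> u + w \in S -> B (rw i) w = 0.
  move=> uU wW s; have /andP[rS rW] := rwin i.
  have ru0 : B (rw i) u = 0 by apply/herm_sym0/UWperp.
  by have := SS rS s; rewrite linearDr /= ru0 add0r.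
have aww i u w : u \in P -> w \in W -> u + w \in S -> B (aw i) w = 0.
  move=> uP wW s.
  rewrite (@anti_isometry (au i) (aw i) u w) ?awW ?awS ?inU // ?radU ?oppr0 //.
  exact/(subvP RadP)/auin.
have rw0 i : 0 + rw i \in S by rewrite add0r; case/andP: (rwin i).
have rwW i : rw i \in W by case/andP: (rwin i).
have xw i u w : u \in P -> w \in W -> u + w \in S -> B (sumf rw aw i) w = 0.
  move=> uP; case: i => i /=; last exact: aww.
  by apply: rww; exact: inU.
have auP i := subvP RadP _ (auin i).
(* In a relation among the rw and aw, the combination of the au alone lies in S, hence in S meet U,
   to which the span of the au is complementary. *)
have fxw : ffree (sumf rw aw).
  move=> c0; rewrite big_sumType /= => c00.
  have sa : \sum_i c0 (inr i) *: au i = 0.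
    apply/eqP; rewrite -memv0 -(capv_diff (Rad B P) R) memv_cap.
    rewrite -/(quo (Rad B P) R) inA fspan_sum /= memv_cap.
    rewrite (_ : _ \in U) ?andbT; last by apply: rpred_sum => i _; apply/rpredZ/inU.
    have h1 : \sum_i c0 (inr i) *: (au i + aw i) \in S.
      by apply: rpred_sum => i _; apply: rpredZ.
    have h2 : \sum_i c0 (inl i) *: rw i \in S.
      by apply: rpred_sum => i _; apply: rpredZ; case/andP: (rwin i).
    rewrite (_ : \sum_i _ = \sum_i c0 (inr i) *: (au i + aw i) + \sum_i c0 (inl i) *: rw i).
      exact: rpredD.
    rewrite (eq_bigr _ (fun i _ => scalerDr _ _ _)) big_split /= -addrA.
    by rewrite [_ + \sum_i c0 (inl i) *: _]addrC c00 addr0.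
  have ca := proj1 auA _ sa.
  move: c00; rewrite [X in _ + X]big1 ?addr0 => [/(proj1 rwR) cr|i _]; last by rewrite ca scale0r.
  by case=> i; [apply: cr|apply: ca].
have bwJ i j : B (bw i) (bw j) = - B (bu i) (bu j).
  by apply: (@anti_isometry _ _ _ _) => //; apply: inU.
have gbw (c0 : 'I_(inv_b B U W S) -> K) : (forall j, \sum_i c0 i * B (bw i) (bw j) = 0) ->
    forall i, c0 i = 0.
  move=> h; apply: gbu => j; apply/eqP; rewrite -oppr_eq0 -sumrN; apply/eqP.
  by rewrite -[RHS](h j); apply: eq_bigr => i _; rewrite bwJ mulrN.
have xwW i : sumf rw aw i \in W by case: i.
have xxw i j : B (sumf rw aw i) (sumf rw aw j) = 0.
  case: j => j /=; first by apply: (xw _ 0); rewrite ?mem0v.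
  by apply: (xw _ (au j)).
have xbw i j : B (sumf rw aw i) (bw j) = 0 by apply: (xw _ (bu j)).
have nW : ndeg B W.
  apply/ndegP => v vW v0; apply: ndegB => x; have [u [w [uU wW ->]]] := UWdec x.
  have vu : B v u = 0 by apply/herm_sym0/UWperp.
  by rewrite linearDr /= vu add0r v0.
have [n' [tW [y' [c' [bW gW]]]]] :=
  @std_complete W _ _ bw (sumf rw aw) nW bwW xwW fxw gbw xxw xbw.
exists n, n', t, tU, tW, (sumf bu (sumf (sumf (sumf ru au) y) c)),
  (sumf bw (sumf (sumf (sumf rw aw) y') c')); split=> //.
- move=> i j; rewrite gU; congr (hyp_gram _ _ _ _).
  by apply/funext => k; apply/funext => l; rewrite mul1r buJ.
- move=> i j; rewrite gW; congr (hyp_gram _ _ _ _).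
  by apply/funext => k; apply/funext => l; rewrite mulN1r bwJ buJ.
apply/eqP; rewrite eqEsubv; apply/andP; split; last first.
  apply: fspan_sub => -[[i|i]|[i|i]] /=.
  - by have := ruin i; rewrite memv_cap => /andP[].
  - by case/andP: (rwin i).
  - exact: awS.
  - exact: bwS.
apply/subvP => s sS; have [u [w [uU wW sE]]] := UWdec s.
have : u \in P by apply/mem_Proj; split=> //; exists w; rewrite -?sE.
move=> /decP[c1 [c2 [c3 uE]]].
(* A combination of the chosen vectors with the same U-part as s, so that s - s' lies in S meet W
   and is a combination of the rw. *)
pose s' := \sum_i c1 i *: (bu i + bw i) + (\sum_i c2 i *: (au i + aw i) + \sum_i c3 i *: ru i).
have sub_s' : s - s' \in (S :&: W)%VS.
  rewrite memv_cap; apply/andP; split.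
    rewrite rpredB // !rpredD ?rpred_sum // => i _; apply: rpredZ => //.
    by have := ruin i; rewrite memv_cap => /andP[].
  rewrite (_ : s - s' = w - (\sum_i c1 i *: bw i + \sum_i c2 i *: aw i)).
    by rewrite rpredB ?rpredD ?rpred_sum // => i _; apply: rpredZ.
  have -> : s' = u + (\sum_i c1 i *: bw i + \sum_i c2 i *: aw i).
    rewrite /s' uE !(eq_bigr _ (fun i _ => scalerDr _ _ _)) !big_split /=.
    by rewrite [_ + _ + \sum_i c3 i *: ru i]addrAC addrACA.
  by rewrite sE opprD addrACA subrr add0r.
have inRw v : (v \in (S :&: W)%VS) = (v \in fspan rw) by rewrite (proj2 rwR).
have rT i : ru i \in fspan (isotropic_family (sumf bu (sumf (sumf (sumf ru au) y) c))
  (sumf bw (sumf (sumf (sumf rw aw) y') c'))).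
  exact: (mem_fspan (isotropic_family _ _) (inl (inl i))).
rewrite -(subrK s' s) rpredD //.
  move: sub_s'; rewrite inRw => /fspanP[c4 ->].
  apply: rpred_sum => i _; apply: rpredZ.
  exact: (mem_fspan (isotropic_family _ _) (inl (inr i))).
rewrite !rpredD ?rpred_sum // => i _; apply: rpredZ => //.
  exact: (mem_fspan (isotropic_family _ _) (inr (inr i))).
exact: (mem_fspan (isotropic_family _ _) (inr (inl i))).
Qed.
End NormalForm.

(** * Orbits and cosets *)

Section GroupH.
Variables (K : fieldType) (eps : bool) (theta : {rmorphism K -> K}).
Variables (V : vectType K) (B : {hermitian V for eps & theta}).
Variables (U W : {vspace V}).
Hypothesis ndB : nondegenerate B.
Hypothesis UW : orthodecomp B U W.

Let UWdec v : exists u w, [/\ u \in U, w \in W & v = u + w].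
Proof.
case: UW => UWf _ _; have /memv_addP[u uU [w wW ->]] : v \in (U + W)%VS by rewrite UWf memvf.
by exists u, w.
Qed.

Let UWperp u w : u \in U -> w \in W -> B u w = 0.
Proof. by case: UW => _ _ /orthovP; apply. Qed.

Implicit Types (h k : 'End(V)) (X Y S : {vspace V}).

Definition restrict (X : {vspace V}) (h : 'End(V)) : 'End(subvs_of X) :=
  linfun (vsproj X \o h \o vsval).

Lemma restrictE (X : {vspace V}) (h : 'End(V)) x : (h @: X <= X)%VS ->
  vsval (restrict X h x) = h (vsval x).
Proof.
by move=> hX; rewrite lfunE /= vsprojK //; apply: (subvP hX); rewrite memv_img ?subvsP.
Qed.

(** Trades a pair of isometries of U and W for one endomorphism of V, for which products, inverses
    and images of subspaces are at hand. *)
Lemma HgrpP h : Hgrp B U W h <-> [/\ isometry B B h, (h @: U <= U)%VS & (h @: W <= W)%VS].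
Proof.
split=> [[hU [hW [isoU isoW [hUE hWE]]]]|[isoh hU hW]]; last first.
  exists (restrict U h), (restrict W h); split.
  - by move=> x y; rewrite /= /resform !restrictE // isoh.
  - by move=> x y; rewrite /= /resform !restrictE // isoh.
  - by split=> x; rewrite restrictE.
have hUin u : u \in U -> exists u', h u = vsval (hU u') /\ vsval u' = u.
  by move=> uU; exists (vsproj U u); rewrite -hUE vsprojK.
have hWin w : w \in W -> exists w', h w = vsval (hW w') /\ vsval w' = w.
  by move=> wW; exists (vsproj W w); rewrite -hWE vsprojK.
split=> [x y||].
- have [u [w [/hUin[u1 [hu uE]] /hWin[w1 [hw wE]] ->]]] := UWdec x.
  have [u' [w' [/hUin[u1' [hu' uE']] /hWin[w1' [hw' wE']] ->]]] := UWdec y.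
  have perp (a : subvs_of U) (b : subvs_of W) : B (vsval a) (vsval b) = 0 /\ B (vsval b) (vsval a) = 0.
    by have ab := UWperp (subvsP a) (subvsP b); rewrite ab (herm_sym0 ab).
  rewrite !linearD /= !linearDl /= hu hw hu' hw' -uE -wE -uE' -wE' !(perp _ _).1 !(perp _ _).2.
  by congr (_ + _ + (_ + _)); [exact: isoU|exact: isoW].
- apply/subvP => _ /memv_imgP[u /hUin[u1 [-> _]] ->]; exact: subvsP.
- apply/subvP => _ /memv_imgP[w /hWin[w1 [-> _]] ->]; exact: subvsP.
Qed.

Lemma isometry_lker0 (h : 'End(V)) : isometry B B h -> lker h == 0%VS.
Proof.
move=> isoh; rewrite -subv0; apply/subvP => v; rewrite memv_ker memv0 => /eqP hv.
by apply/eqP/(ndegB ndB) => u; rewrite -isoh hv linear0l.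
Qed.

Lemma lker0_img_eq (h : 'End(V)) X : lker h == 0%VS -> (h @: X <= X)%VS -> (h @: X)%VS = X.
Proof.
move=> kh hX; apply/eqP; rewrite eqEdim hX limg_dim_eq //=.
by rewrite (eqP kh) capv0.
Qed.

Lemma isometry_inv (h : 'End(V)) : isometry B B h -> isometry B B (h^-1)%VF.
Proof. by move=> isoh x y; rewrite -isoh !lker0_lfunVK // isometry_lker0. Qed.

Lemma HgrpV h : Hgrp B U W h -> Hgrp B U W (h^-1)%VF.
Proof.
move=> /HgrpP[isoh hU hW]; have kh := isometry_lker0 isoh.
apply/HgrpP; split; first exact: isometry_inv.
  by rewrite -{1}(lker0_img_eq kh hU) -limg_comp lker0_compVf // lim1g.
by rewrite -{1}(lker0_img_eq kh hW) -limg_comp lker0_compVf // lim1g.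
Qed.

Lemma HgrpM h k : Hgrp B U W h -> Hgrp B U W k -> Hgrp B U W (h \o k)%VF.
Proof.
move=> /HgrpP[isoh hU hW] /HgrpP[isok kU kW]; apply/HgrpP; split.
- by move=> x y; rewrite !comp_lfunE isoh isok.
- by rewrite limg_comp (subv_trans _ hU) // limgS.
- by rewrite limg_comp (subv_trans _ hW) // limgS.
Qed.

Lemma Hgrp1 : Hgrp B U W \1%VF.
Proof. by apply/HgrpP; split; rewrite ?lim1g // => x y; rewrite !id_lfunE. Qed.

Lemma Hgrp_lker0 h : Hgrp B U W h -> lker h == 0%VS.
Proof. by move=> /HgrpP[isoh _ _]; exact: isometry_lker0. Qed.

Lemma limg_orthov h X : isometry B B h -> (h @: orthov B X)%VS = orthov B (h @: X).
Proof.
move=> isoh; have kh := isometry_lker0 isoh.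
apply/vspaceP => v; apply/idP/idP => [/memv_imgP[u /mem_orthovP uX ->]|/mem_orthovP vX].
  by apply/mem_orthovP => _ /memv_imgP[x xX ->]; rewrite isoh uX.
rewrite -[v](lker0_lfunVK kh); apply/memv_img/mem_orthovP => x xX.
by rewrite -isoh lker0_lfunVK // vX // memv_img.
Qed.

Lemma limg_cap0 (h : 'End(V)) X Y : lker h == 0%VS ->
  (h @: (X :&: Y))%VS = (h @: X :&: h @: Y)%VS.
Proof. by move=> kh; rewrite lker0_img_cap. Qed.

Lemma dim_img0 (h : 'End(V)) X : lker h == 0%VS -> \dim (h @: X) = \dim X.
Proof. by move=> kh; rewrite limg_dim_eq // (eqP kh) capv0. Qed.

Lemma dim_quo (X Y : {vspace V}) : \dim (quo X Y) = (\dim X - \dim (X :&: Y))%N.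
Proof. by rewrite /quo -(dimv_cap_compl X Y) addKn. Qed.

Lemma Hgrp_Proj h S : Hgrp B U W h ->
  Proj U W (h @: S) = (h @: Proj U W S)%VS /\ Proj W U (h @: S) = (h @: Proj W U S)%VS.
Proof.
move=> Hh; have kh := Hgrp_lker0 Hh; have /HgrpP[isoh hU hW] := Hh.
by rewrite /Proj !limg_cap0 // !limgD (lker0_img_eq kh hU) (lker0_img_eq kh hW).
Qed.

Lemma Hgrp_Rad h X : Hgrp B U W h -> Rad B (h @: X) = (h @: Rad B X)%VS.
Proof.
move=> Hh; have kh := Hgrp_lker0 Hh; have /HgrpP[isoh hU hW] := Hh.
by rewrite /Rad limg_cap0 // limg_orthov.
Qed.

Lemma Hgrp_invariants h S : Hgrp B U W h ->
  [/\ inv_r U (h @: S) = inv_r U S, inv_r W (h @: S) = inv_r W S,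
      inv_a B U W (h @: S) = inv_a B U W S & inv_b B U W (h @: S) = inv_b B U W S].
Proof.
move=> Hh; have kh := Hgrp_lker0 Hh; have /HgrpP[isoh hU hW] := Hh.
have cU : (h @: S :&: U = h @: (S :&: U))%VS by rewrite limg_cap0 // (lker0_img_eq kh hU).
have cW : (h @: S :&: W = h @: (S :&: W))%VS by rewrite limg_cap0 // (lker0_img_eq kh hW).
rewrite /inv_r /inv_a /inv_b (Hgrp_Proj S Hh).1 Hgrp_Rad // cU cW !dim_quo.
by rewrite -!limg_cap0 // !dim_img0.
Qed.

Lemma isometry_on_basis (I : finType) (e : I -> V) (h : 'End(V)) : fbasis fullv e ->
  (forall i j, B (h (e i)) (h (e j)) = B (e i) (e j)) -> isometry B B h.
Proof.
move=> [_ fe] he x y.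
have /fspanP[c ->] : x \in fspan e by rewrite fe memvf.
have /fspanP[d ->] : y \in fspan e by rewrite fe memvf.
have hs (k : I -> K) : h (\sum_i k i *: e i) = \sum_i k i *: h (e i).
  by rewrite linear_sum; apply: eq_bigr => i _; rewrite linearZ.
rewrite !hs !form_suml; apply: eq_bigr => i _; rewrite !form_sumr; congr (_ * _).
by apply: eq_bigr => j _; rewrite he.
Qed.

Variables (TT : Type) (J : TT -> forall n, 'I_n -> 'I_n -> K).
Arguments J : clear implicits.

Lemma frames_same_orbit r r' a b c c' t1 t2 t3 s1 s2 s3 S S'
    (e e' : frame_index r a b c -> V) (f f' : frame_index r' a b c' -> V) :
  normal_frame B J U W t1 t2 t3 S e f -> normal_frame B J U W s1 s2 s3 S' e' f' ->
  (forall i j, J t1 b i j = J s1 b i j) -> (forall i j, J t2 c i j = J s2 c i j) ->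
  (forall i j, J t3 c' i j = J s3 c' i j) -> Horbit B U W S S'.
Proof.
move=> [[bU bW] gU gW ->] [[bU' bW'] gU' gW' ->] J1 J2 J3.
case: UW => UWf UW0 _.
have bV := fbasis_sum bU bW UW0; rewrite UWf in bV.
have [h hE] := fbasis_lfun (sumf e' f') (proj1 bV).
have he i : h (e i) = e' i by exact: (hE (inl i)).
have hf i : h (f i) = f' i by exact: (hE (inr i)).
have eU i : e i \in U by rewrite -(proj2 bU) mem_fspan.
have fW i : f i \in W by rewrite -(proj2 bW) mem_fspan.
have eU' i : e' i \in U by rewrite -(proj2 bU') mem_fspan.
have fW' i : f' i \in W by rewrite -(proj2 bW') mem_fspan.
exists h.
  apply/HgrpP; split.
  - apply: (isometry_on_basis bV) => -[i|i] [j|j] /=; rewrite ?he ?hf.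
    + rewrite gU gU' /frame_gram; case: i j => [i|[[i|i]|i]] [j|[[j|j]|j]] //=.
      by rewrite J1.
    + by rewrite !UWperp.
    + by rewrite !(herm_sym0 (UWperp _ _)).
    + rewrite gW gW' /frame_gram; case: i j => [i|[[i|i]|i]] [j|[[j|j]|j]] //=.
      by rewrite J1.
  - by rewrite -{1}(proj2 bU) limg_fspan; apply/subv_sumP => i _; rewrite he -memvE.
  - by rewrite -{1}(proj2 bW) limg_fspan; apply/subv_sumP => i _; rewrite hf -memvE.
rewrite limg_fspan; apply: eq_bigr => -[[i|i]|[i|i]] _ /=; rewrite ?linearD /=;
  by rewrite /frame_r /frame_a /frame_b ?he ?hf.
Qed.

End GroupH.

(** * Orbits as coset spaces; dimensions of orthogonals *)

Section OrbitAndFlags.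
Variables (K : fieldType) (eps : bool) (theta : {rmorphism K -> K}).
Hypothesis thetaK : involutive theta.
Variables (V : vectType K) (B : {hermitian V for eps & theta}).
Variables (U W : {vspace V}).
Hypothesis ndB : nondegenerate B.
Hypothesis UW : orthodecomp B U W.
Implicit Types (h k : 'End(V)) (X Y S : {vspace V}).

Lemma Hstab1 S : Hstab B U W S \1%VF.
Proof. by split; [exact: (Hgrp1 UW)|rewrite lim1g]. Qed.

Lemma orbit_iso_cosetsP S : orbit_iso_cosets B U W S.
Proof.
have trE h c : translate h c = [set (h \o d)%VF | d in c] by [].
have trM h k (C : set 'End(V)) : translate h (translate k C) = translate (h \o k)%VF C.
  rewrite !trE; apply/seteqP; split => x /=.
    by move=> [_ [c Cc <-] <-]; exists c => //; rewrite comp_lfunA.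
  by move=> [c Cc <-]; exists (k \o c)%VF; [exists c|rewrite comp_lfunA].
have tr_eq h k : translate h (Hstab B U W S) = translate k (Hstab B U W S) ->
    (h @: S)%VS = (k @: S)%VS.
  move=> hk; have : translate h (Hstab B U W S) h.
    by exists \1%VF; [exact: Hstab1|rewrite comp_lfun1r].
  by rewrite hk => -[c [_ cS] <-]; rewrite limg_comp cS.
have eq_tr h k : Hgrp B U W h -> Hgrp B U W k -> (h @: S)%VS = (k @: S)%VS ->
    translate h (Hstab B U W S) `<=` translate k (Hstab B U W S).
  move=> Hh Hk hkS _ [c [Hc cS] <-]; have kk := Hgrp_lker0 ndB UW Hk.
  exists ((k^-1 \o h) \o c)%VF; last by rewrite comp_lfunA lker0_compVKf.
  split; first by apply: (HgrpM UW) => //; apply: (HgrpM UW) => //; exact: (HgrpV ndB UW).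
  by rewrite !limg_comp cS hkS -limg_comp lker0_compVf // lim1g.
(* On a coset h H_S the value is h S, whatever the representative h; off the cosets it is 0 by
   default. *)
have /choice[phi phiE] : forall C, exists X, forall h, Hgrp B U W h ->
    C = translate h (Hstab B U W S) -> X = (h @: S)%VS.
  move=> C; have [[h [Hh CE]]|nC] := pselect (exists h, Hgrp B U W h /\ C = translate h (Hstab B U W S)).
    by exists (h @: S)%VS => k Hk; rewrite CE => /tr_eq.
  by exists 0%VS => h Hh CE; case: nC; exists h.
exists phi; split; last first.
  move=> h _ Hh [k Hk <-]; rewrite trM (phiE _ (h \o k)%VF) ?(phiE _ k) ?limg_comp //.
  exact: (HgrpM UW).
split.
- by move=> _ [h Hh <-]; exists h => //; rewrite (phiE _ h).
- move=> _ _ /set_mem[h Hh <-] /set_mem[k Hk <-]; rewrite (phiE _ h) // (phiE _ k) // => hk.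
  by apply/seteqP; split; apply: eq_tr.
- by move=> _ [h Hh ->]; exists (translate h (Hstab B U W S)); [exists h|rewrite (phiE _ h)].
Qed.

(** A family dual to a basis of X spans a complement, in U', of the orthogonal of X, and it has as
    many members as the basis. *)
Lemma dim_orthov_cap U' X : ndeg B U' -> (X <= U')%VS ->
  (\dim (orthov B X :&: U') + \dim X)%N = \dim U'.
Proof.
move=> nU XU; have [e [fe eX]] := fbasis_exists X.
have inX v : (v \in X) = (v \in fspan e) by rewrite eX.
have eX' i : e i \in X by rewrite inX mem_fspan.
have [d [dU de]] := dual_family thetaK nU (fun i => subvP XU _ (eX' i)) fe.
have dotd c j : B (\sum_i c i *: d i) (e j) = c j.
  rewrite form_suml (bigD1 j) //= de eqxx mulr1 big1 ?addr0 // => i /negPf ij.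
  by rewrite de ij mulr0.
have fd : ffree d by move=> c c0 j; rewrite -dotd c0 linear0l.
have -> : \dim X = \dim (fspan d) by rewrite dim_fspan // card_ord.
have perpd v : v \in fspan d -> (forall j, B v (e j) = 0) -> v = 0.
  by move=> /fspanP[c ->] c0; rewrite big1 // => i _; rewrite -dotd c0 scale0r.
rewrite -dimv_disjoint_sum; last first.
  apply/eqP; rewrite -subv0; apply/subvP => v; rewrite !memv_cap memv0 => /andP[/andP[/mem_orthovP v0 _] vd].
  by apply/eqP/perpd => // j; apply/v0/eX'.
congr (\dim _); apply/eqP; rewrite eqEsubv subv_add capvSr fspan_sub //=.
apply/subvP => u uU; rewrite -[u](subrK (\sum_i B u (e i) *: d i)).
apply: memv_add; last exact: fspan_sum.
rewrite memv_cap; apply/andP; split; last first.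
  by apply: rpredB => //; apply: rpred_sum => i _; apply/rpredZ/dU.
apply/mem_orthovP => x; rewrite inX => /fspanP[c ->].
by rewrite form_sumr big1 // => j _; rewrite linearBl /= dotd subrr mulr0.
Qed.

Lemma orthov_capK U' X : ndeg B U' -> (X <= U')%VS ->
  (orthov B (orthov B X :&: U') :&: U')%VS = X.
Proof.
move=> nU XU; apply/eqP; rewrite eq_sym eqEdim; apply/andP; split.
  rewrite subv_cap XU andbT; apply/subvP => x xX; apply/mem_orthovP => y.
  by rewrite memv_cap => /andP[/mem_orthovP yX _]; apply/herm_sym0/yX.
have := dim_orthov_cap nU (capvSr (orthov B X) U'); have := dim_orthov_cap nU XU; clear; lia.
Qed.

Lemma dim_Proj S : (\dim (Proj U W S) + \dim (S :&: W))%N = \dim S.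
Proof.
case: UW => UWf UW0 _.
have dimW : (\dim (Proj U W S) + \dim W)%N = \dim (S + W).
  rewrite -dimv_disjoint_sum; last by rewrite -capvA UW0 capv0.
  by rewrite /Proj (vspace_modr _ (addvSr S W)) UWf capvf.
have := dimv_sum_cap S W; move: dimW; clear; lia.
Qed.

End OrbitAndFlags.

(** * The stabilizer in adapted bases *)

Lemma sum_window (M : nmodType) n (f : nat -> M) o k : (o + k <= n)%N ->
  (forall i, (i < n)%N -> ~~ (o <= i < o + k)%N -> f i = 0) ->
  \sum_(i < n) f i = \sum_(i < k) f (o + i)%N.
Proof.
move=> okn f0; rewrite -(big_mkord xpredT) (big_cat_nat (n := o)) //=; last by lia.
rewrite big_nat big1 ?add0r => [|i /andP[_ io]]; last by apply: f0; lia.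
rewrite (big_cat_nat (n := (o + k)%N)) //=; last by lia.
rewrite [X in _ + X]big_nat [X in _ + X]big1 ?addr0 => [|i /andP[io ik]]; last by apply: f0; lia.
rewrite -[X in \sum_(X <= i < _) _]add0n big_addn addKn big_mkord.
by apply: eq_bigr => i _; rewrite addnC.
Qed.

Section TupleBasis.
Variables (K : fieldType) (V : vectType K) (U : {vspace V}) (n : nat) (e : n.-tuple V).
Hypothesis be : basis_of U e.

(* Coordinates indexed by nat, 0 beyond the dimension. *)
Definition ncoord (i : nat) (v : V) : K := if insub i is Some i' then coord e i' v else 0.

Lemma ncoord_ord (i : 'I_n) v : ncoord i v = coord e i v.
Proof.
by rewrite /ncoord (insubT (fun k => (k < n)%N) (ltn_ord i)); congr coord; apply/val_inj.
Qed.

Lemma ncoord_out i v : (n <= i)%N -> ncoord i v = 0.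
Proof. by move=> ni; rewrite /ncoord insubF // ltnNge ni. Qed.

Lemma ncoordD i u v : ncoord i (u + v) = ncoord i u + ncoord i v.
Proof. by rewrite /ncoord; case: insubP => [i' _ _|_]; rewrite ?linearD ?addr0. Qed.

Lemma ncoordZ i c v : ncoord i (c *: v) = c * ncoord i v.
Proof. by rewrite /ncoord; case: insubP => [i' _ _|_]; rewrite ?linearZ ?mulr0. Qed.

Lemma ncoord0 i : ncoord i 0 = 0.
Proof. by rewrite -(scale0r (0 : V)) ncoordZ mul0r. Qed.

Lemma ncoord_sum i (I : finType) (c : I -> K) (f : I -> V) :
  ncoord i (\sum_j c j *: f j) = \sum_j c j * ncoord i (f j).
Proof.
elim/big_ind2: _ => [|x1 y1 x2 y2 <- <-|j _]; [exact: ncoord0|exact: ncoordD|exact: ncoordZ].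
Qed.

Lemma ncoord_nth i j : (i < n)%N -> ncoord i e`_j = (i == j)%:R.
Proof.
move=> ni; rewrite (ncoord_ord (Ordinal ni)).
have [nj|nj] := ltnP j n; last first.
  rewrite nth_default ?size_tuple // linear0 /=; case: eqP => // ij.
  by move: ni; rewrite ij ltnNge nj.
by rewrite (coord_free (Ordinal nj) (Ordinal ni) (basis_free be)) -val_eqE eq_sym.
Qed.

Lemma ncoord_expand v : v \in U -> v = \sum_(i < n) ncoord i v *: e`_i.
Proof.
by move=> vU; rewrite {1}(coord_basis be vU); apply: eq_bigr => i _; rewrite ncoord_ord.
Qed.

Lemma nth_mem_basis j : e`_j \in U.
Proof.
have [nj|nj] := ltnP j n; last by rewrite nth_default ?size_tuple ?mem0v.
by apply: (basis_mem be); rewrite mem_nth ?size_tuple.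
Qed.

Lemma mem_span_take k v : v \in U ->
  (v \in <<take k e>>%VS) <-> (forall i, (k <= i)%N -> ncoord i v = 0).
Proof.
move=> vU; split=> [vk i ki|v0].
  have [ni|ni] := ltnP i n; last exact: ncoord_out.
  rewrite (coord_span (X := in_tuple (take k e)) vk) ncoord_sum big1 // => j _ /=.
  have jk : (j < k)%N.
    by have := ltn_ord j; rewrite [X in (_ < X)%N -> _]size_take size_tuple; case: (ltnP k n) => ?; lia.
  by rewrite nth_take // ncoord_nth // gtn_eqF ?mulr0 //; apply: leq_trans ki.
rewrite (ncoord_expand vU); apply: rpred_sum => i _.
have [ki|ik] := leqP k i; first by rewrite v0 // scale0r mem0v.
apply/rpredZ/memv_span/(nthP 0); exists i; last by rewrite nth_take.
by rewrite size_take size_tuple; case: (ltnP k n) => // _; exact: ltn_ord.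
Qed.

Lemma take_sub k : (<<take k e>> <= U)%VS.
Proof.
by rewrite -(span_basis be); apply: sub_span => x; apply: mem_take.
Qed.

Lemma dim_take k : (k <= n)%N -> \dim <<take k e>> = k.
Proof.
move=> kn; have : free (take k e ++ drop k e) by rewrite cat_take_drop (basis_free be).
by move=> /catl_free; rewrite /free => /eqP ->; rewrite size_take size_tuple; case: ltnP => // ?; lia.
Qed.

Lemma spanned_by_firstE X : spanned_by_first e X -> X = <<take (\dim X) e>>%VS.
Proof.
move=> [k XE]; have [kn|nk] := leqP k n; first by rewrite [in RHS]XE dim_take.
have dU : \dim U = n by rewrite -(span_basis be); apply/eqP; have := basis_free be; rewrite /free size_tuple.
have -> : X = U by rewrite XE take_oversize ?size_tuple 1?ltnW // (span_basis be).
by rewrite dU take_oversize ?size_tuple // (span_basis be).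
Qed.

End TupleBasis.

(** * Dimensions in the flag and symmetry of the invariants in U and W *)

Section InvariantDimensions.
Variables (K : fieldType) (eps : bool) (theta : {rmorphism K -> K}).
Hypothesis thetaK : involutive theta.
Variables (V : vectType K) (B : {hermitian V for eps & theta}).
Hypothesis ndB : nondegenerate B.

Section OneSide.
Variables (U W S : {vspace V}).
Hypothesis UW : orthodecomp B U W.
Hypothesis isoS : isotropic B S.

Lemma dim_Rad_Proj : \dim (Rad B (Proj U W S)) = (inv_r U S + inv_a B U W S)%N.
Proof.
rewrite /inv_a /inv_r dim_quo (capv_idPr (capv_sub_Rad UW isoS)) subnKC //.
exact: dimvS (capv_sub_Rad UW isoS).
Qed.

Lemma dim_Proj_inv : \dim (Proj U W S) = (inv_r U S + inv_a B U W S + inv_b B U W S)%N.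
Proof.
have RP : (Rad B (Proj U W S) <= Proj U W S)%VS by exact: capvSl.
by rewrite -dim_Rad_Proj /inv_b dim_quo (capv_idPr RP) subnKC // dimvS.
Qed.

Lemma dim_perp_Rad :
  \dim (orthov B (Rad B (Proj U W S)) :&: U) = (\dim U - inv_r U S - inv_a B U W S)%N.
Proof.
have RU : (Rad B (Proj U W S) <= U)%VS by apply: subv_trans (capvSl _ _) (capvSr _ _).
have := dim_orthov_cap thetaK (ndeg_orthodecomp ndB UW) RU; rewrite dim_Rad_Proj; clear; lia.
Qed.

Lemma dim_perp_cap : \dim (orthov B (S :&: U) :&: U) = (\dim U - inv_r U S)%N.
Proof.
have := dim_orthov_cap thetaK (ndeg_orthodecomp ndB UW) (capvSr S U).
by rewrite -/(inv_r U S); clear; lia.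
Qed.

Lemma size_invariants : (2 * inv_r U S + 2 * inv_a B U W S + inv_b B U W S <= \dim U)%N.
Proof.
have : (Proj U W S <= orthov B (Rad B (Proj U W S)) :&: U)%VS.
  rewrite subv_cap capvSr andbT; apply/subvP => v vP; apply/mem_orthovP => x.
  by rewrite memv_cap => /andP[_ /mem_orthovP xP]; apply/herm_sym0/xP.
move/dimvS; rewrite dim_Proj_inv dim_perp_Rad.
have : (\dim (Rad B (Proj U W S)) <= \dim U)%N.
  by apply/dimvS/(subv_trans (capvSl _ _) (capvSr _ _)).
rewrite dim_Rad_Proj; clear; lia.
Qed.

(** The part of S lying over Rad P_U S. By the anti-isometry it also lies over Rad P_W S, and its
    dimension r_U + a + r_W, read from both sides, shows that a is the same for U and W. *)
Definition radical_part := (S :&: (Rad B (Proj U W S) + W))%VS.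

Lemma mem_radical_part u w : u \in U -> w \in W ->
  (u + w \in radical_part) = (u + w \in S) && (u \in Rad B (Proj U W S)).
Proof.
move=> uU wW; rewrite memv_cap; congr (_ && _); apply/idP/idP => [|uR]; last exact: memv_add.
move=> /memv_addP[x xR [w' w'W E]].
have xU : x \in U by move: xR; rewrite memv_cap => /andP[+ _]; apply/subvP/capvSr.
suff -> : u = x by [].
apply/eqP; rewrite -subr_eq0 -memv0; case: UW => _ <- _; rewrite memv_cap rpredB //=.
have -> : u - x = w' - w by apply/eqP; rewrite subr_eq addrAC eq_sym subr_eq E addrC.
by rewrite rpredB.
Qed.

Lemma dim_radical_part :
  (\dim (Rad B (Proj U W S)) + inv_r W S)%N = \dim radical_part.
Proof.
rewrite -(dim_Proj UW radical_part); congr (_ + _)%N.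
  congr (\dim _); apply/vspaceP => u; apply/idP/idP.
    move=> uR; have uP : u \in Proj U W S by apply: (subvP (capvSl _ _) _ uR).
    have /mem_Proj[uU [w wW s]] := uP; apply/mem_Proj; split=> //.
    by exists w => //; rewrite mem_radical_part // s.
  by move=> /mem_Proj[uU [w wW]]; rewrite mem_radical_part // => /andP[].
rewrite /inv_r; congr (\dim _); apply/vspaceP => w; rewrite [LHS]memv_cap [RHS]memv_cap.
have [wW|] := boolP (w \in W); last by rewrite !andbF.
by have := @mem_radical_part 0 w (mem0v _) wW; rewrite add0r mem0v !andbT => ->.
Qed.

Lemma radical_part_sub : (radical_part <= S :&: (Rad B (Proj W U S) + U))%VS.
Proof.
apply/subvP => s sR; have sS : s \in S by move: sR; rewrite memv_cap => /andP[].
rewrite memv_cap sS /=; case: (UW) => UWf _ _.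
have /memv_addP[u uU [w wW sE]] : s \in (U + W)%VS by rewrite UWf memvf.
move: sR sS; rewrite sE mem_radical_part // => /andP[_ uR] s'.
rewrite addrC memv_add // memv_cap; apply/andP; split.
  by apply/mem_Proj; split=> //; exists u; rewrite // addrC.
apply/mem_orthovP => w' /mem_Proj[w'W [u' u'U]]; rewrite addrC => s''.
rewrite (anti_isometry UW isoS uU wW u'U w'W s' s'').
move: uR; rewrite memv_cap => /andP[_ /mem_orthovP ->]; first by rewrite oppr0.
by apply/mem_Proj; split=> //; exists w'.
Qed.

End OneSide.

Variables (U W S : {vspace V}).
Hypothesis UW : orthodecomp B U W.
Hypothesis isoS : isotropic B S.

Lemma inv_a_sym : inv_a B W U S = inv_a B U W S.
Proof.
have WU := orthodecomp_sym UW.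
have E : radical_part U W S = radical_part W U S.
  by apply/eqP; rewrite eqEsubv !radical_part_sub.
have := dim_radical_part S UW; have := dim_radical_part S WU.
by rewrite E => <-; rewrite !dim_Rad_Proj //; clear; lia.
Qed.

Lemma dim_isotropic_inv : \dim S = (inv_r U S + inv_r W S + inv_a B U W S + inv_b B U W S)%N.
Proof. have := dim_Proj UW S; rewrite dim_Proj_inv // -/(inv_r W S); clear; lia. Qed.

Lemma inv_b_sym : inv_b B W U S = inv_b B U W S.
Proof.
have WU := orthodecomp_sym UW.
have := dim_Proj WU S; rewrite dim_Proj_inv // -/(inv_r U S) dim_isotropic_inv inv_a_sym; clear; lia.
Qed.

End InvariantDimensions.

(** * Isometries induced on quotients *)

Section QuotientIsometry.
Variables (K : fieldType) (eps : bool) (theta : {rmorphism K -> K}).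
Variables (V : vectType K) (B : {hermitian V for eps & theta}).
Variables (X Y : {vspace V}).
Hypothesis YX : (Y <= X)%VS.
Hypothesis perpYX : forall y x, y \in Y -> x \in X -> B y x = 0.

Lemma quo_map_pi v : vsval (quo_map X Y v) = addv_pi1 X Y v.
Proof. by rewrite /quo_map vsprojK //; exact: memv_pi. Qed.

Lemma sub_quo_map v : v \in X -> v - vsval (quo_map X Y v) \in Y.
Proof.
move=> vX; rewrite quo_map_pi.
have vXY : v \in (X + Y)%VS by rewrite (addv_idPl YX).
by rewrite -{1}(addv_pi1_pi2 vXY) addrC addKr memv_pi2.
Qed.

Lemma quo_mapD u v : quo_map X Y (u + v) = quo_map X Y u + quo_map X Y v.
Proof. by apply: subvs_inj; rewrite linearD /= !quo_map_pi linearD. Qed.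

Lemma quo_mapZ c v : quo_map X Y (c *: v) = c *: quo_map X Y v.
Proof. by apply: subvs_inj; rewrite linearZ /= !quo_map_pi linearZ. Qed.

Lemma quo_map_sum (I : finType) (c : I -> K) (f : I -> V) :
  quo_map X Y (\sum_i c i *: f i) = \sum_i c i *: quo_map X Y (f i).
Proof.
elim/big_ind2: _ => [|x1 y1 x2 y2 <- <-|i _]; last exact: quo_mapZ.
  by apply: subvs_inj; rewrite quo_map_pi !linear0.
exact: quo_mapD.
Qed.

Lemma quo_map0 v : v \in Y -> quo_map X Y v = 0.
Proof.
move=> vY; apply: subvs_inj; apply/eqP; rewrite -memv0 -(capv_diff X Y) memv_cap.
rewrite (subvsP (quo_map X Y v)) /=.
rewrite -[vsval _](subKr v) rpredB //; apply: sub_quo_map; exact: (subvP YX).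
Qed.

Lemma quo_map_form u v : u \in X -> v \in X ->
  B (vsval (quo_map X Y u)) (vsval (quo_map X Y v)) = B u v.
Proof.
move=> uX vX; set u' := vsval _; set v' := vsval _.
have u'X : u' \in X by apply: (subvP (diffvSl X Y)); exact: subvsP.
have v'X : v' \in X by apply: (subvP (diffvSl X Y)); exact: subvsP.
have uu : u - u' \in Y by exact: sub_quo_map.
have vv : v - v' \in Y by exact: sub_quo_map.
have e1 : B (u - u') (v - v') = 0 by apply: perpYX => //; exact: (subvP YX).
have e2 : B (u - u') v' = 0 by apply: perpYX.
have e3 : B u' (v - v') = 0 by apply/herm_sym0/perpYX.
have -> : B u v = B (u - u' + u') (v - v' + v') by rewrite !subrK.
by rewrite [in RHS]linearDl /= [B (u - u') _]linearDr /= [B u' (_ + _)]linearDr /= e1 e2 e3 !add0r.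
Qed.

Variable h : 'End(V).
Hypothesis isoh : isometry B B h.
Hypothesis hX : (h @: X <= X)%VS.
Hypothesis hY : (h @: Y <= Y)%VS.

(** Well defined since h preserves Y, and isometric since Y is orthogonal to X, so that
    representatives may be changed freely. *)
Lemma quo_isometry : exists2 g, isogv B (quo X Y) g &
  forall v, v \in X -> g (quo_map X Y v) = quo_map X Y (h v).
Proof.
have lin : linear (fun x : subvs_of (quo X Y) => quo_map X Y (h (vsval x))).
  by move=> c x y; rewrite linearP quo_mapD quo_mapZ.
pose gl := GRing.isLinear.Build _ _ _ _ _ lin.
pose g : {linear subvs_of (quo X Y) -> subvs_of (quo X Y)} := HB.pack (fun x : subvs_of (quo X Y) => quo_map X Y (h (vsval x))) gl.
have inX (x : subvs_of (quo X Y)) : vsval x \in X.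
  by apply: (subvP (diffvSl X Y)); exact: subvsP.
have hin v : v \in X -> h v \in X by move=> vX; apply: (subvP hX); exact: memv_img.
exists (linfun g) => [x y|v vX].
  by rewrite !lfunE /= /resform quo_map_form ?hin // isoh.
rewrite lfunE /=; apply/eqP; rewrite -subr_eq0 -scaleN1r -quo_mapZ -quo_mapD; apply/eqP.
apply: quo_map0; rewrite scaleN1r -linearB /=; apply: (subvP hY); apply: memv_img.
by rewrite -opprB rpredN sub_quo_map.
Qed.

End QuotientIsometry.

(** * Block triangular shape in an adapted basis *)

Section AdaptedSide.
Variables (K : fieldType) (eps : bool) (theta : {rmorphism K -> K}).
Hypothesis thetaK : involutive theta.
Variables (V : vectType K) (B : {hermitian V for eps & theta}).
Hypothesis ndB : nondegenerate B.
Variables (U W S : {vspace V}).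
Hypothesis UW : orthodecomp B U W.
Hypothesis isoS : isotropic B S.
Variable e : (\dim U).-tuple V.
Hypothesis fb : flag_basis B U W S e.

Local Notation n := (\dim U).
Local Notation r := (inv_r U S).
Local Notation a := (inv_a B U W S).
Local Notation b := (inv_b B U W S).
Local Notation P := (Proj U W S).
Local Notation s := (block_sizes n r a b).

Lemma adapted_basis : basis_of U e.
Proof. by case: fb. Qed.
Let be := adapted_basis.

Lemma flag_cap : (S :&: U)%VS = <<take r e>>%VS.
Proof. by case: fb => _ [/(spanned_by_firstE be) h _] _ _ _. Qed.

Lemma flag_Rad : Rad B P = <<take (r + a) e>>%VS.
Proof.
case: fb => _ [_ /(spanned_by_firstE be)] + _ _ _.
by rewrite dim_Rad_Proj.
Qed.

Lemma flag_Proj : P = <<take (r + a + b) e>>%VS.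
Proof.
case: fb => _ _ [/(spanned_by_firstE be) + _] _ _.
by rewrite (dim_Proj_inv UW).
Qed.

Lemma flag_perp_Rad : (orthov B (Rad B P) :&: U)%VS = <<take (n - r - a) e>>%VS.
Proof.
case: fb => _ _ [_ /(spanned_by_firstE be)] + _ _.
by rewrite dim_perp_Rad.
Qed.

Lemma flag_perp_cap : (orthov B (S :&: U) :&: U)%VS = <<take (n - r) e>>%VS.
Proof.
case: fb => _ _ _ /(spanned_by_firstE be) + _.
by rewrite (dim_perp_cap thetaK ndB _ UW).
Qed.

Lemma adapted_size : (2 * r + 2 * a + b <= n)%N.
Proof. exact: size_invariants. Qed.

(** Matrix entries indexed by natural numbers, zero outside the matrix, so that positions in a block
    are plain sums of offsets. *)
Definition hcoef (h : 'End(V)) i j := ncoord e i (h e`_j).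

Lemma hcoef_expand h j : (h @: U <= U)%VS -> h e`_j = \sum_(i < n) hcoef h i j *: e`_i.
Proof.
move=> hU; apply: (ncoord_expand be); apply: (subvP hU); apply: memv_img.
exact: nth_mem_basis.
Qed.

(** The five cut points are the dimensions of the members of the flag below U; the second clause is
    the zero block in row 3, column 4. *)
Definition flag_shape h : Prop :=
  (forall p, p \in [:: r; r + a; r + a + b; n - r - a; n - r]%N ->
     forall i j, (j < p <= i)%N -> hcoef h i j = 0) /\
  (forall i j, (r + a <= i < r + a + b)%N -> (r + a + b <= j < n - r - a)%N -> hcoef h i j = 0).

Lemma hcoef_flag h p : (h @: <<take p e>> <= <<take p e>>)%VS ->
  forall i j, (j < p <= i)%N -> hcoef h i j = 0.
Proof.
move=> hp i j /andP[jp pi].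
have jn : e`_j \in <<take p e>>%VS.
  apply/(mem_span_take be _ (nth_mem_basis be j)) => i' pi'.
  have [ni|ni] := ltnP i' n; last exact: ncoord_out.
  by rewrite (ncoord_nth be) // gtn_eqF //; apply: leq_trans pi'.
have : h e`_j \in <<take p e>>%VS by apply: (subvP hp); exact: memv_img.
have hU : h e`_j \in U by apply: (subvP (take_sub be p)); apply: (subvP hp); exact: memv_img.
by move=> /(mem_span_take be _ hU); apply.
Qed.

(** v lies in the orthogonal of the radical. Without its components on the basis vectors orthogonal
    to P_U S it lies in P_U S and is still orthogonal to it, hence is in the radical, where the
    coordinates in question vanish. *)
Lemma perp_Proj_coord v : v \in U -> v \in orthov B P ->
  forall i, (r + a <= i < r + a + b)%N -> ncoord e i v = 0.
Proof.
move=> vU vP i /andP[i1 i2]; have sz := adapted_size.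
have eP j : (r + a + b <= j < n - r - a)%N -> e`_j \in orthov B P by case: fb => _ _ _ _; apply.
have vF : v \in <<take (n - r - a) e>>%VS.
  rewrite -flag_perp_Rad memv_cap vU andbT; apply/mem_orthovP => x.
  rewrite memv_cap => /andP[xP _]; move/mem_orthovP: vP; exact.
(* subtract the components on the vectors orthogonal to P *)
pose w := v - \sum_(j < n | (r + a + b <= j)%N) ncoord e j v *: e`_j.
have wU : w \in U.
  by rewrite rpredB // rpred_sum // => j _; apply/rpredZ/nth_mem_basis.
have vexp := ncoord_expand be vU.
have wE : w = \sum_(j < n | ~~ (r + a + b <= j)%N) ncoord e j v *: e`_j.
  apply/eqP; rewrite /w subr_eq addrC; apply/eqP.
  by rewrite {1}vexp (bigID (fun j : 'I_n => (r + a + b <= j)%N)).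
have wR : w \in Rad B P.
  rewrite memv_cap; apply/andP; split.
    rewrite flag_Proj; apply/(mem_span_take be _ wU) => k rk.
    rewrite wE big_mkcond /=.
    rewrite (eq_bigr (fun j : 'I_n => (if ~~ (r + a + b <= j)%N then ncoord e j v else 0) *: e`_j)).
      rewrite ncoord_sum big1 // => j _; have [kn|kn] := ltnP k n; last by rewrite [ncoord e k _]ncoord_out // mulr0.
      rewrite [ncoord e k _](ncoord_nth be) //; case: ifP => [jr|]; last by rewrite mul0r.
      by rewrite gtn_eqF ?mulr0 //; apply: leq_trans rk; rewrite ltnNge jr.
    by move=> j _; case: ifP => // _; rewrite scale0r.
  rewrite rpredB // rpred_sum // => j rj.
  have [jn|jn] := ltnP j (n - r - a)%N; first by rewrite rpredZ // eP // rj jn.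
  by move/(mem_span_take be _ vU): vF => -> //; rewrite scale0r mem0v.
move: wR; rewrite flag_Rad => /(mem_span_take be _ wU)/(_ i i1).
rewrite /w ncoordD -scaleN1r ncoordZ big_mkcond /=.
rewrite (eq_bigr (fun j : 'I_n => (if (r + a + b <= j)%N then ncoord e j v else 0) *: e`_j)).
  rewrite ncoord_sum big1 ?mulr0 ?addr0 // => j _.
  have [kn|kn] := ltnP i n; last by rewrite [ncoord e i _]ncoord_out // mulr0.
  rewrite [ncoord e i _](ncoord_nth be) //; case: ifP => [jr|]; last by rewrite mul0r.
  by rewrite ltn_eqF ?mulr0 //; apply: leq_trans jr.
by move=> j _; case: ifP => // _; rewrite scale0r.
Qed.

Section Stabilizer.
Variable h : 'End(V).
Hypothesis Hh : Hgrp B U W h.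
Hypothesis hS : (h @: S)%VS = S.

Let kh := Hgrp_lker0 ndB UW Hh.
Let hU : (h @: U)%VS = U.
Proof. by have /(HgrpP UW)[_ ? _] := Hh; exact: lker0_img_eq. Qed.
Let isoh : isometry B B h.
Proof. by have /(HgrpP UW)[] := Hh. Qed.

Lemma stab_Proj : (h @: P)%VS = P.
Proof. by rewrite -(Hgrp_Proj ndB UW S Hh).1 hS. Qed.

Lemma stab_Rad : (h @: Rad B P)%VS = Rad B P.
Proof. by rewrite -(Hgrp_Rad ndB UW _ Hh) stab_Proj. Qed.

Lemma stab_perp_cap X : (h @: X)%VS = X -> (h @: (orthov B X :&: U))%VS = (orthov B X :&: U)%VS.
Proof. by move=> hX; rewrite limg_cap0 // limg_orthov // hX hU. Qed.

Lemma stab_flag_shape : flag_shape h.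
Proof.
have hc : (h @: (S :&: U))%VS = (S :&: U)%VS by rewrite limg_cap0 // hS hU.
split=> [p|i j ri rj].
  rewrite !inE => /orP[|/orP[|/orP[|/orP[]]]] /eqP ->; apply: hcoef_flag.
  - by rewrite -flag_cap hc.
  - by rewrite -flag_Rad stab_Rad.
  - by rewrite -flag_Proj stab_Proj.
  - by rewrite -flag_perp_Rad (stab_perp_cap stab_Rad).
  - by rewrite -flag_perp_cap (stab_perp_cap hc).
apply: perp_Proj_coord => //.
  by have := memv_img h (nth_mem_basis be j); rewrite hU.
rewrite -stab_Proj -limg_orthov // memv_img //.
by case: fb => _ _ _ _; apply.
Qed.

End Stabilizer.
End AdaptedSide.

(** * Pairings between dual blocks *)

Section AdaptedBlocks.
Variables (K : fieldType) (eps : bool) (theta : {rmorphism K -> K}).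
Hypothesis thetaK : involutive theta.
Variables (V : vectType K) (B : {hermitian V for eps & theta}).
Hypothesis ndB : nondegenerate B.
Variables (U W S : {vspace V}).
Hypothesis UW : orthodecomp B U W.
Hypothesis isoS : isotropic B S.
Variable e : (\dim U).-tuple V.
Hypothesis fb : flag_basis B U W S e.

Local Notation n := (\dim U).
Local Notation r := (inv_r U S).
Local Notation a := (inv_a B U W S).
Local Notation b := (inv_b B U W S).
Local Notation P := (Proj U W S).
Local Notation s := (block_sizes n r a b).
Let be := adapted_basis fb.
Let sz : (2 * r + 2 * a + b <= n)%N := adapted_size thetaK ndB UW isoS.

Lemma block_hcoef (g : 'End(subvs_of U)) (h : 'End(V)) t k l i j :
  (forall u, h (vsval u) = vsval (g u)) ->
  block (mx_in_basis e g) t k l i j = hcoef e h (sumn (take k t) + i) (sumn (take l t) + j).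
Proof.
move=> hE; rewrite mxE /hcoef /ncoord; case: insubP => [i' _ i'E|_] //.
case: insubP => [j' _ j'E|].
  by rewrite mxE -hE vsprojK ?j'E // -j'E nth_mem_basis.
by rewrite -leqNgt => nj; rewrite (nth_default 0) ?size_tuple // !linear0.
Qed.

Lemma find_block i : (i < n)%N ->
  exists k i0, [/\ (k < 6)%N, (i0 < nth 0%N s k)%N & i = (sumn (take k s) + i0)%N].
Proof.
move=> ni; have := sz; move: (inv_r U S) (inv_a B U W S) (inv_b B U W S) => r a b sz'.
have [i1|i1] := ltnP i r; first by exists 0%N, i; split=> //=.
have [i2|i2] := ltnP i (r + a)%N; first by exists 1%N, (i - r)%N; split=> //=; lia.
have [i3|i3] := ltnP i (r + a + b)%N; first by exists 2%N, (i - (r + a))%N; split=> //=; lia.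
have [i4|i4] := ltnP i (n - r - a)%N; first by exists 3%N, (i - (r + a + b))%N; split=> //=; lia.
have [i5|i5] := ltnP i (n - r)%N; first by exists 4%N, (i - (n - r - a))%N; split=> //=; lia.
by exists 5%N, (i - (n - r))%N; split=> //=; lia.
Qed.

Section Shape.
Variables (h : 'End(V)) (g : 'End(subvs_of U)).
Hypothesis hg : forall u, h (vsval u) = vsval (g u).
Let M := mx_in_basis e g.

Lemma flag_shape_blocks : flag_shape B W S e h ->
  (forall k l, (l < k < 6)%N -> block M s k l = 0) /\ block M s 2 3 = 0.
Proof.
move=> [sh1 sh2]; split=> [k l /andP[lk k6]|].
  apply/matrixP => i j; rewrite (block_hcoef _ _ hg) [RHS]mxE.
  apply: (sh1 (sumn (take k s))).
    move: sz lk k6 {i j}; rewrite !inE.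
    move: (inv_r U S) (inv_a B U W S) (inv_b B U W S) => r a b.
    by case: k => [|[|[|[|[|[|k]]]]]] //=; lia.
  have := ltn_ord i; have := ltn_ord j; move: (nat_of_ord i) (nat_of_ord j) => {i j} i j.
  move: sz lk k6; move: (inv_r U S) (inv_a B U W S) (inv_b B U W S) => r a b.
  by case: k => [|[|[|[|[|[|k]]]]]] //; case: l => [|[|[|[|[|[|l]]]]]] //=; lia.
apply/matrixP => i j; rewrite (block_hcoef _ _ hg) [RHS]mxE.
have := ltn_ord i; have := ltn_ord j; move: (nat_of_ord i) (nat_of_ord j) => {i j} i j /= ? ?.
by apply: sh2; move: sz; lia.
Qed.

Lemma blocks_flag p : (forall k l, (l < k < 6)%N -> block M s k l = 0) ->
  p \in [:: r; r + a; r + a + b]%N -> forall i j, (j < p <= i)%N -> hcoef e h i j = 0.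
Proof.
move=> M0 pin i j jpi; have [ni|ni] := ltnP i n; last exact: ncoord_out.
have pn : (p <= n)%N by move: sz pin; rewrite !inE; lia.
have nj : (j < n)%N by lia.
have [k [i0 [k6 ik iE]]] := find_block ni.
have [l [j0 [l6 jl jE]]] := find_block nj.
have lk : (l < k)%N.
  move: sz pin jpi; rewrite iE jE !inE; move: ik jl k6 l6 {iE jE}.
  move: (inv_r U S) (inv_a B U W S) (inv_b B U W S) => r a b.
  by case: k => [|[|[|[|[|[|k]]]]]] //; case: l => [|[|[|[|[|[|l]]]]]] //=; lia.
have /M0/matrixP/(_ (Ordinal ik) (Ordinal jl)) : (l < k < 6)%N by rewrite lk.
by rewrite (block_hcoef _ _ hg) [RHS]mxE /= -iE -jE.
Qed.

End Shape.

Lemma perp_flag_cap i l : (i < r)%N -> (l < n - r)%N -> B e`_i e`_l = 0.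
Proof.
move=> ir lr; have iS : e`_i \in (S :&: U)%VS.
  rewrite (flag_cap fb); apply/(mem_span_take be _ (nth_mem_basis be i)) => k rk.
  have [kn|kn] := ltnP k n; last exact: ncoord_out.
  by rewrite (ncoord_nth be) // gtn_eqF //; apply: leq_trans rk.
have : e`_l \in (orthov B (S :&: U) :&: U)%VS.
  rewrite (flag_perp_cap thetaK ndB UW fb).
  apply/(mem_span_take be _ (nth_mem_basis be l)) => k rk.
  have [kn|kn] := ltnP k n; last exact: ncoord_out.
  by rewrite (ncoord_nth be) // gtn_eqF //; apply: leq_trans rk.
by rewrite memv_cap => /andP[/mem_orthovP lS _]; apply/herm_sym0/lS.
Qed.

Lemma perp_flag_Rad i l : (i < r + a)%N -> (l < n - r - a)%N -> B e`_i e`_l = 0.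
Proof.
move=> ir lr; have iS : e`_i \in Rad B P.
  rewrite (flag_Rad UW isoS fb); apply/(mem_span_take be _ (nth_mem_basis be i)) => k rk.
  have [kn|kn] := ltnP k n; last exact: ncoord_out.
  by rewrite (ncoord_nth be) // gtn_eqF //; apply: leq_trans rk.
have : e`_l \in (orthov B (Rad B P) :&: U)%VS.
  rewrite (flag_perp_Rad thetaK ndB UW isoS fb).
  apply/(mem_span_take be _ (nth_mem_basis be l)) => k rk.
  have [kn|kn] := ltnP k n; last exact: ncoord_out.
  by rewrite (ncoord_nth be) // gtn_eqF //; apply: leq_trans rk.
by rewrite memv_cap => /andP[/mem_orthovP lS _]; apply/herm_sym0/lS.
Qed.

Definition pairing_mx o o' k : 'M[K]_k := \matrix_(i, j) B e`_(o + i) e`_(o' + j).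
Definition hcoef_mx (h : 'End(V)) o k : 'M[K]_k := \matrix_(i, j) hcoef e h (o + i) (o + j).

(** For diagonal blocks X and Y of h at two windows with pairing matrix D, invariance of B reads X^T
    D theta(Y) = D, once the last hypothesis has removed the terms outside the windows. *)
Lemma pairing_invariant (h : 'End(V)) o o' k : isometry B B h -> (h @: U <= U)%VS ->
  (o + k <= n)%N -> (o' + k <= n)%N ->
  (forall i j, (o <= i < o + k)%N -> (o' <= j < o' + k)%N -> forall i' j', (i' < n)%N -> (j' < n)%N ->
     ~~ ((o <= i' < o + k) && (o' <= j' < o' + k))%N ->
     [\/ hcoef e h i' i = 0, hcoef e h j' j = 0 | B e`_i' e`_j' = 0]) ->
  (hcoef_mx h o k)^T *m pairing_mx o o' k *m map_mx theta (hcoef_mx h o' k) = pairing_mx o o' k.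
Proof.
move=> isoh hU ok o'k zero; apply/matrixP => i j; rewrite [RHS]mxE -isoh.
have z (i' j' : nat) : (i' < n)%N -> (j' < n)%N -> ~~ ((o <= i' < o + k) && (o' <= j' < o' + k))%N ->
    hcoef e h i' (o + i) * (theta (hcoef e h j' (o' + j)) * B e`_i' e`_j') = 0.
  move=> i'n j'n out; have := ltn_ord i; have := ltn_ord j => jk ik.
  have [||->|->|->] := zero (o + i)%N (o' + j)%N _ _ _ _ i'n j'n out; [lia|lia| | |].
  - by rewrite mul0r.
  - by rewrite rmorph0 mul0r mulr0.
  - by rewrite !mulr0.
rewrite (hcoef_expand fb _ hU) (hcoef_expand fb (o' + j) hU) form_suml.
under [RHS]eq_bigr => i' _ do rewrite form_sumr mulr_sumr.
rewrite (sum_window (f := fun i' => \sum_(j' < n) hcoef e h i' (o + i) *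
  (theta (hcoef e h j' (o' + j)) * B e`_i' e`_j')) ok); last first.
  move=> i' i'n i'o; rewrite big1 // => j' _; apply: z => //.
  by rewrite (negPf i'o).
rewrite mxE; under [RHS]eq_bigr => i' _.
  rewrite (sum_window (f := fun j' => hcoef e h (o + i') (o + i) *
    (theta (hcoef e h j' (o' + j)) * B e`_(o + i') e`_j')) o'k); last first.
    move=> j' j'n j'o; apply: z => //; first by have := ltn_ord i'; lia.
    by rewrite (negPf j'o) andbF.
  over.
rewrite exchange_big /=; apply: eq_bigr => j' _; rewrite !mxE mulr_suml.
by apply: eq_bigr => i' _; rewrite !mxE; ring.
Qed.

(** A combination of the first r vectors killed by this pairing is orthogonal to the last r vectors,
    and by the flag to the others, hence to U. *)
Lemma pairing05_unit : pairing_mx 0 (n - r) r \in unitmx.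
Proof.
rewrite -row_free_unit -kermx_eq0; apply/eqP/row_matrixP => k; rewrite row0.
set c := row k _; have cD : c *m pairing_mx 0 (n - r) r = 0 by apply/eqP; rewrite -sub_kermx row_sub.
pose v := \sum_(i < r) c 0 i *: e`_i.
have vU : v \in U by apply: rpred_sum => i _; apply/rpredZ/nth_mem_basis.
have v0 : v = 0.
  have /ndegP := ndeg_orthodecomp ndB UW; apply=> // x /(ncoord_expand be) ->.
  rewrite form_sumr big1 // => l _; have [lr|lr] := ltnP l (n - r)%N.
    by rewrite form_suml big1 ?mulr0 // => i _; rewrite perp_flag_cap ?mulr0.
  have lr' : (l - (n - r) < r)%N by have := ltn_ord l; move: sz; lia.
  have /rowP/(_ (Ordinal lr')) := cD; rewrite [LHS]mxE [RHS]mxE => c0.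
  rewrite form_suml (_ : \sum_i _ = 0) ?mulr0 // -[RHS]c0.
  by apply: eq_bigr => i _; rewrite [pairing_mx _ _ _ _ _]mxE /= subnKC.
apply/rowP => i; rewrite [RHS]mxE -(ncoord0 e i) -v0 ncoord_sum (bigD1 i) //=.
have rn : (r <= n)%N by move: sz; lia.
rewrite (ncoord_nth be) ?eqxx ?mulr1 ?big1 ?addr0 // => [j /negPf ji|]; last first.
  by apply: leq_trans rn.
rewrite (ncoord_nth be) 1?eq_sym ?val_eqE ?ji ?mulr0 //; exact: leq_trans rn.
Qed.

(** A combination of these a vectors killed by the pairing is orthogonal to the orthogonal of S meet
    U in U, so it lies in S meet U, where the coordinates from r on vanish. *)
Lemma pairing14_unit : pairing_mx r (n - r - a) a \in unitmx.
Proof.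
rewrite -row_free_unit -kermx_eq0; apply/eqP/row_matrixP => k; rewrite row0.
set c := row k _; have cD : c *m pairing_mx r (n - r - a) a = 0.
  by apply/eqP; rewrite -sub_kermx row_sub.
pose v := \sum_(i < a) c 0 i *: e`_(r + i).
have vU : v \in U by apply: rpred_sum => i _; apply/rpredZ/nth_mem_basis.
have vS : v \in (S :&: U)%VS.
  rewrite -(orthov_capK thetaK (ndeg_orthodecomp ndB UW) (capvSr S U)) memv_cap vU andbT.
  rewrite (flag_perp_cap thetaK ndB UW fb); apply/mem_orthovP => x xF.
  have xU : x \in U by apply: (subvP (take_sub be _)) xF.
  rewrite (ncoord_expand be xU) form_sumr big1 // => l _.
  have [lr|lr] := ltnP l (n - r - a)%N.
    rewrite form_suml big1 ?mulr0 // => i _; rewrite perp_flag_Rad ?mulr0 //.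
    by rewrite ltn_add2l.
  have [lr2|lr2] := ltnP l (n - r)%N; last first.
    by have /(mem_span_take be _ xU) -> // := xF; rewrite rmorph0 mul0r.
  have lr' : (l - (n - r - a) < a)%N by move: sz; lia.
  have /rowP/(_ (Ordinal lr')) := cD; rewrite [LHS]mxE [RHS]mxE => c0.
  rewrite form_suml (_ : \sum_i _ = 0) ?mulr0 // -[RHS]c0.
  by apply: eq_bigr => i _; rewrite [pairing_mx _ _ _ _ _]mxE /= subnKC.
have an : (r + a <= n)%N by move: sz; lia.
apply/rowP => i; rewrite [RHS]mxE; move: vS; rewrite (flag_cap fb).
move=> /(mem_span_take be _ vU)/(_ (r + i)%N (leq_addr _ _)).
rewrite /v ncoord_sum (bigD1 i) //=.
rewrite (ncoord_nth be) ?eqxx ?mulr1 ?big1 ?addr0 // => [j /negPf ji|]; last first.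
  by apply: leq_trans an; rewrite ltn_add2l.
rewrite (ncoord_nth be) 1?eq_sym ?eqn_add2l ?val_eqE ?ji ?mulr0 //.
by apply: leq_trans an; rewrite ltn_add2l.
Qed.

Section Pairings.
Variable h : 'End(V).
Hypothesis isoh : isometry B B h.
Hypothesis hU : (h @: U <= U)%VS.
Hypothesis sh : flag_shape B W S e h.

Lemma pairing05 : (hcoef_mx h 0 r)^T *m pairing_mx 0 (n - r) r *m
  map_mx theta (hcoef_mx h (n - r) r) = pairing_mx 0 (n - r) r.
Proof.
have [sh1 _] := sh; apply: pairing_invariant => //; [by move: sz; lia|by move: sz; lia|].
move=> i j ir jr i' j' i'n j'n out; have [i'r|i'r] := ltnP i' r; last first.
  by apply: Or31; apply: (sh1 r); rewrite ?inE ?eqxx //; lia.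
by apply: Or33; apply: perp_flag_cap => //; lia.
Qed.

Lemma pairing14 : (hcoef_mx h r a)^T *m pairing_mx r (n - r - a) a *m
  map_mx theta (hcoef_mx h (n - r - a) a) = pairing_mx r (n - r - a) a.
Proof.
have [sh1 _] := sh; apply: pairing_invariant => //; [by move: sz; lia|by move: sz; lia|].
move=> i j ir jr i' j' i'n j'n out; have [i'r|i'r] := ltnP i' (r + a)%N; last first.
  by apply: Or31; apply: (sh1 (r + a)%N); rewrite ?inE ?eqxx ?orbT //; lia.
have [j'r|j'r] := ltnP j' (n - r)%N; last first.
  by apply: Or32; apply: (sh1 (n - r)%N); rewrite ?inE ?eqxx ?orbT //; move: sz; lia.
have [i'r2|i'r2] := ltnP i' r; first by apply: Or33; apply: perp_flag_cap.
by apply: Or33; apply: perp_flag_Rad => //; lia.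
Qed.

End Pairings.
End AdaptedBlocks.

(** * Diagonal blocks of an element of the stabilizer *)

Section StabilizerBlocks.
Variables (K : fieldType) (eps : bool) (theta : {rmorphism K -> K}).
Hypothesis thetaK : involutive theta.
Variables (V : vectType K) (B : {hermitian V for eps & theta}).
Hypothesis ndB : nondegenerate B.
Implicit Types (h : 'End(V)).

Section OneSide.
Variables (U W S : {vspace V}).
Hypothesis UW : orthodecomp B U W.
Hypothesis isoS : isotropic B S.
Variable e : (\dim U).-tuple V.
Hypothesis fb : flag_basis B U W S e.

Local Notation n := (\dim U).
Local Notation r := (inv_r U S).
Local Notation a := (inv_a B U W S).
Local Notation b := (inv_b B U W S).
Local Notation P := (Proj U W S).
Local Notation s := (block_sizes n r a b).
Let be := adapted_basis fb.
Let sz : (2 * r + 2 * a + b <= n)%N := adapted_size thetaK ndB UW isoS.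

Lemma flag_mem p i : (i < p)%N -> e`_i \in <<take p e>>%VS.
Proof.
move=> ip; apply/(mem_span_take be _ (nth_mem_basis be i)) => k pk.
have [kn|kn] := ltnP k n; last exact: ncoord_out.
by rewrite (ncoord_nth be) // gtn_eqF //; apply: leq_trans pk.
Qed.

Lemma perp_Proj_mem i : (r + a + b <= i < n - r - a)%N -> e`_i \in orthov B P.
Proof. by case: fb => _ _ _ _; apply. Qed.

Variables (h : 'End(V)) (g : 'End(subvs_of U)).
Hypothesis Hh : Hgrp B U W h.
Hypothesis hS : (h @: S)%VS = S.
Hypothesis hg : forall u, h (vsval u) = vsval (g u).
Let M := mx_in_basis e g.

Let sh : flag_shape B W S e h := stab_flag_shape thetaK ndB UW isoS fb Hh hS.
Let isoh : isometry B B h.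
Proof. by have /(HgrpP UW)[] := Hh. Qed.
Let hU : (h @: U <= U)%VS.
Proof. by have /(HgrpP UW)[] := Hh. Qed.

(** Modulo Y only the coordinates in the window survive: the other coordinates of h e_j vanish or
    belong to basis vectors in Y. *)
Lemma mx_isog_quo_window X Y o k (A : 'M[K]_k) : (Y <= X)%VS ->
  (forall y x, y \in Y -> x \in X -> B y x = 0) -> (h @: X <= X)%VS -> (h @: Y <= Y)%VS ->
  (o + k <= n)%N -> (forall i j, A i j = hcoef e h (o + i) (o + j)) ->
  (forall j, (o <= j < o + k)%N -> e`_j \in X) ->
  (forall i j, (o <= j < o + k)%N -> ~~ (o <= i < o + k)%N -> e`_i \in Y \/ hcoef e h i j = 0) ->
  mx_isog_quo B X Y e o A.
Proof.
move=> YX perp hX hY okn AE eX zero.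
have [g0 isog0 g0E] := quo_isometry YX perp isoh hX hY.
exists g0 => // j; have jk := ltn_ord j.
have oj : (o <= o + j < o + k)%N by lia.
rewrite g0E ?eX // (hcoef_expand fb _ hU) quo_map_sum.
rewrite (sum_window (f := fun i => hcoef e h i (o + j) *: quo_map X Y e`_i) okn) => [|i ni out].
  by apply: eq_bigr => i _; rewrite AE.
have [iY|->] := zero i (o + j)%N oj out; last by rewrite scale0r.
by rewrite (quo_map0 YX iY) scaler0.
Qed.

Let blockE k l (i : 'I_(nth 0%N s k)) (j : 'I_(nth 0%N s l)) :
  block M s k l i j = hcoef e h (sumn (take k s) + i) (sumn (take l s) + j).
Proof. exact: (block_hcoef fb). Qed.

Lemma mx_isog_quo_Proj : mx_isog_quo B P (Rad B P) e (r + a) (block M s 2 2 : 'M_b).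
Proof.
have [sh1 _] := sh; apply: mx_isog_quo_window.
- exact: capvSl.
- by move=> y x; rewrite memv_cap => /andP[_ /mem_orthovP]; apply.
- by rewrite (stab_Proj ndB UW Hh hS).
- by rewrite (stab_Rad ndB UW Hh hS).
- by move: sz; lia.
- by move=> i j; apply: etrans (@blockE 2 2 i j) _; congr hcoef => /=; lia.
- by move=> j jr; rewrite (flag_Proj UW isoS fb) flag_mem //; case/andP: jr.
- move=> i j jr ir; have [i1|i1] := ltnP i (r + a)%N.
    by left; rewrite (flag_Rad UW isoS fb) flag_mem.
  by right; apply: (sh1 (r + a + b)%N); [rewrite !inE eqxx !orbT|lia].
Qed.

Lemma mx_isog_quo_perp : mx_isog_quo B (orthov B P :&: U)%VS (Rad B P) e (r + a + b)
  (block M s 3 3 : 'M_(n - (r.*2 + a.*2 + b))).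
Proof.
have [sh1 sh2] := sh; apply: mx_isog_quo_window.
- rewrite subv_cap capvSr; apply: subv_trans (capvSl _ _) (capvSr _ _).
- move=> y x /memv_capP[yP _] /memv_capP[/mem_orthovP xP _].
  exact/herm_sym0/xP.
- by rewrite (stab_perp_cap ndB UW Hh (stab_Proj ndB UW Hh hS)).
- by rewrite (stab_Rad ndB UW Hh hS).
- by move: sz; lia.
- by move=> i j; apply: etrans (@blockE 3 3 i j) _; congr hcoef => /=; lia.
- move=> j jr; rewrite memv_cap (nth_mem_basis be) andbT perp_Proj_mem //; move: sz; lia.
- move=> i j jr ir; have [i1|i1] := ltnP i (r + a)%N.
    by left; rewrite (flag_Rad UW isoS fb) flag_mem.
  right; have [i2|i2] := ltnP i (r + a + b)%N.
    by apply: sh2; [lia|move: sz; lia].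
  by apply: (sh1 (n - r - a)%N); [rewrite !inE eqxx !orbT|move: sz; lia].
Qed.

Lemma block00E : block M s 0 0 = hcoef_mx e h 0 r.
Proof. by apply/matrixP => i j; apply: etrans (@blockE 0 0 i j) _; rewrite mxE. Qed.

Lemma block11E : block M s 1 1 = hcoef_mx e h r a.
Proof. by apply/matrixP => i j; apply: etrans (@blockE 1 1 i j) _; rewrite mxE; congr hcoef => /=; clear; lia. Qed.

Lemma block44E : block M s 4 4 = hcoef_mx e h (n - r - a) a.
Proof. by apply/matrixP => i j; apply: etrans (@blockE 4 4 i j) _; rewrite mxE; congr hcoef => /=; move: sz; clear; lia. Qed.

Lemma block55E : block M s 5 5 = hcoef_mx e h (n - r) r.
Proof. by apply/matrixP => i j; apply: etrans (@blockE 5 5 i j) _; rewrite mxE; congr hcoef => /=; move: sz; clear; lia. Qed.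

Lemma map_theta_unit k (A : 'M[K]_k) : (map_mx theta A \in unitmx) = (A \in unitmx).
Proof. by rewrite map_unitmx. Qed.

Lemma stab_block_shape : block_shape B W S a b e M.
Proof.
have [z1 z2] := flag_shape_blocks thetaK ndB UW isoS fb hg sh.
have := pairing05 thetaK ndB UW isoS fb isoh hU sh; have := pairing05_unit thetaK ndB UW isoS fb.
have := pairing14 thetaK ndB UW isoS fb isoh hU sh; have := pairing14_unit thetaK ndB UW isoS fb.
(* The pairing matrix is invertible and equal to X^T D theta(Y), so both diagonal blocks are
   invertible. *)
move=> u14 p14 u05 p05; rewrite -p05 in u05; rewrite -p14 in u14.
move: u05 u14; rewrite !unitmx_mul !unitmx_tr !map_theta_unit.
move=> /andP[/andP[u0 _] u5] /andP[/andP[u1 _] u4].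
split=> //.
- by rewrite -block00E -block55E in u0 u5 *.
- by rewrite -block11E -block44E in u1 u4 *.
- exact: mx_isog_quo_Proj.
- exact: mx_isog_quo_perp.
Qed.

End OneSide.
End StabilizerBlocks.

(** * The stabilizer described by its blocks *)

Section Description.
Variables (K : fieldType) (eps : bool) (theta : {rmorphism K -> K}).
Hypothesis thetaK : involutive theta.
Variables (V : vectType K) (B : {hermitian V for eps & theta}).
Hypothesis ndB : nondegenerate B.

Lemma pairing_determined k (X X' D Y Y' : 'M[K]_k) : D \in unitmx ->
  X^T *m D *m map_mx theta Y = D -> X'^T *m D *m map_mx theta Y' = D ->
  X = X' <-> Y = Y'.
Proof.
move=> uD XY XY'; have := uD; rewrite -{1}XY !unitmx_mul => /andP[/andP[uX _] uY].
split=> [XX|YY].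
  move: XY' ; rewrite -XX -{2}XY => /(can_inj (mulKmx _)) H.
  apply/esym/(map_mx_inj (f := theta)); apply: H; by rewrite unitmx_mul uX uD.
apply: trmx_inj; apply: (can_inj (mulmxK uD)); apply: (can_inj (mulmxK uY)).
by rewrite XY YY XY'.
Qed.

Section OneSide.
Variables (U W S : {vspace V}).
Hypothesis UW : orthodecomp B U W.
Hypothesis isoS : isotropic B S.
Variable e : (\dim U).-tuple V.
Hypothesis fb : flag_basis B U W S e.

Local Notation n := (\dim U).
Local Notation r := (inv_r U S).
Local Notation a := (inv_a B U W S).
Local Notation b := (inv_b B U W S).
Local Notation s := (block_sizes n r a b).
Let be := adapted_basis fb.
Let sz : (2 * r + 2 * a + b <= n)%N := adapted_size thetaK ndB UW isoS.

Lemma blocks_determined (h h' : 'End(V)) (g g' : 'End(subvs_of U)) :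
  Hstab B U W S h -> Hstab B U W S h' ->
  (forall u, h (vsval u) = vsval (g u)) -> (forall u, h' (vsval u) = vsval (g' u)) ->
  let M := mx_in_basis e g in let M' := mx_in_basis e g' in
  (block M s 0 0 = block M' s 0 0 <-> block M s 5 5 = block M' s 5 5) /\
  (block M s 1 1 = block M' s 1 1 <-> block M s 4 4 = block M' s 4 4).
Proof.
move=> [Hh hS] [Hh' hS'] hg hg' M M'.
have sh := stab_flag_shape thetaK ndB UW isoS fb Hh hS.
have sh' := stab_flag_shape thetaK ndB UW isoS fb Hh' hS'.
have [[isoh hU _] [isoh' hU' _]] := ((HgrpP UW h).1 Hh, (HgrpP UW h').1 Hh').
rewrite (block00E fb hg) (block00E fb hg') (block11E fb hg) (block11E fb hg').
rewrite (block44E thetaK ndB UW isoS fb hg) (block44E thetaK ndB UW isoS fb hg').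
rewrite (block55E thetaK ndB UW isoS fb hg) (block55E thetaK ndB UW isoS fb hg').
split.
  exact: (pairing_determined (pairing05_unit thetaK ndB UW isoS fb)
    (pairing05 thetaK ndB UW isoS fb isoh hU sh) (pairing05 thetaK ndB UW isoS fb isoh' hU' sh')).
exact: (pairing_determined (pairing14_unit thetaK ndB UW isoS fb)
  (pairing14 thetaK ndB UW isoS fb isoh hU sh) (pairing14 thetaK ndB UW isoS fb isoh' hU' sh')).
Qed.

Lemma flag_split u : u \in U -> (forall i, (r + a + b <= i)%N -> ncoord e i u = 0) ->
  exists2 x, x \in (S :&: U)%VS & u = x + \sum_(k < a + b) ncoord e (r + k) u *: e`_(r + k).
Proof.
move=> uU u0; exists (\sum_(i < n) (if (i < r)%N then ncoord e i u else 0) *: e`_i).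
  apply: rpred_sum => i _; case: ifP => [ir|_]; last by rewrite scale0r mem0v.
  by rewrite rpredZ // (flag_cap fb) (flag_mem fb).
have rn : (r + (a + b) <= n)%N by move: sz; clear; lia.
rewrite {1}(ncoord_expand be uU).
rewrite (eq_bigr (fun i : 'I_n => (if (i < r)%N then ncoord e i u else 0) *: e`_i +
  (if (i < r)%N then 0 else ncoord e i u) *: e`_i)); last first.
  by move=> i _; case: ifP; rewrite scale0r ?addr0 ?add0r.
rewrite big_split /=; congr (_ + _).
rewrite (sum_window (f := fun i => (if (i < r)%N then 0 else ncoord e i u) *: e`_i) rn).
  by apply: eq_bigr => k _; rewrite ltnNge leq_addr.
move=> i ni io; case: ifP => [_|ir]; first by rewrite scale0r.
by rewrite u0 ?scale0r //; move: io ir; clear; lia.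
Qed.

Lemma ncoord_cap x i : x \in (S :&: U)%VS -> (r <= i)%N -> ncoord e i x = 0.
Proof.
move=> xS ri; have xU : x \in U by move: xS; rewrite memv_cap => /andP[].
by move: xS; rewrite (flag_cap fb) => /(mem_span_take be _ xU); apply.
Qed.

End OneSide.

Variables (U W S : {vspace V}).
Hypothesis UW : orthodecomp B U W.
Hypothesis isoS : isotropic B S.

Local Notation a := (inv_a B U W S).
Local Notation b := (inv_b B U W S).

Section Adapted.
Variables (eU : (\dim U).-tuple V) (eW : (\dim W).-tuple V).
Hypothesis ad : adapted B U W S eU eW.

Let WU := orthodecomp_sym UW.
Let fU : flag_basis B U W S eU. Proof. by case: ad. Qed.
Let fW : flag_basis B W U S eW. Proof. by case: ad. Qed.
Let glue i : (i < a + b)%N -> eU`_(inv_r U S + i) + eW`_(inv_r W S + i) \in S.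
Proof. by case: ad => _ _ h /h[]. Qed.
Let aW : inv_a B W U S = a := inv_a_sym UW isoS.
Let bW : inv_b B W U S = b := inv_b_sym UW isoS.

Definition levi_agree (h : 'End(V)) : Prop := forall k i, (k < a + b)%N -> (i < a + b)%N ->
  hcoef eU h (inv_r U S + k) (inv_r U S + i) = hcoef eW h (inv_r W S + k) (inv_r W S + i).

Let flag_splitW w : w \in W -> (forall i, (inv_r W S + a + b <= i)%N -> ncoord eW i w = 0) ->
  exists2 x, x \in (S :&: W)%VS &
    w = x + \sum_(k < a + b) ncoord eW (inv_r W S + k) w *: eW`_(inv_r W S + k).
Proof. have := flag_split WU isoS fW; rewrite aW bW; exact. Qed.

(** From the image of u_i + w_i subtract the combination of the u_k + w_k with the coefficients of h
    u_i. Up to S meet U, what is left lies in S meet W, where the middle coordinates vanish; these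
    are the differences of the two matrices. *)
Lemma stab_levi (h : 'End(V)) : Hstab B U W S h -> levi_agree h.
Proof.
move=> [Hh hS] k i ka ia; have /(HgrpP UW)[isoh hU hW] := Hh.
have [shU _] := stab_flag_shape thetaK ndB UW isoS fU Hh hS.
have HhW : Hgrp B W U h by apply/(HgrpP WU); split.
have [shW _] := stab_flag_shape thetaK ndB WU isoS fW HhW hS; rewrite aW bW in shW.
set j := (inv_r U S + i)%N; set j' := (inv_r W S + i)%N.
have [|x xS hx] := flag_split UW isoS fU (subvP hU _ (memv_img h (nth_mem_basis (adapted_basis fU) j))).
  by move=> l ll; apply: (shU (inv_r U S + a + b)%N); rewrite ?inE ?eqxx ?orbT // ll andbT /j -addnA ltn_add2l.
have [|y yS hy] := flag_splitW (subvP hW _ (memv_img h (nth_mem_basis (adapted_basis fW) j'))).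
  by move=> l ll; apply: (shW (inv_r W S + a + b)%N); rewrite ?inE ?eqxx ?orbT // ll andbT /j' -addnA ltn_add2l.
have := memv_img h (glue ia); rewrite hS -/j -/j'.
rewrite linearD /= hx hy => hin.
pose d l := hcoef eW h (inv_r W S + l) j' - hcoef eU h (inv_r U S + l) j.
have : \sum_(l < a + b) d l *: eW`_(inv_r W S + l) \in (S :&: W)%VS.
  rewrite memv_cap; apply/andP; split; last first.
    by apply: rpred_sum => l _; apply/rpredZ/(nth_mem_basis (adapted_basis fW)).
  have -> : \sum_(l < a + b) d l *: eW`_(inv_r W S + l) =
     (x + \sum_(l < a + b) hcoef eU h (inv_r U S + l) j *: eU`_(inv_r U S + l) +
      (y + \sum_(l < a + b) hcoef eW h (inv_r W S + l) j' *: eW`_(inv_r W S + l))) - (x + y)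
     - \sum_(l < a + b) hcoef eU h (inv_r U S + l) j *: (eU`_(inv_r U S + l) + eW`_(inv_r W S + l)).
    rewrite addrACA [x + y + _]addrC addrK (eq_bigr _ (fun l _ => scalerDr _ _ _)) big_split /=.
    rewrite opprD addrACA subrr add0r -sumrB; apply: eq_bigr => l _.
    by rewrite -scalerBl.
  move: xS yS; rewrite !memv_cap => /andP[xS _] /andP[yS _].
  apply: rpredB; first by apply: rpredB; [exact: hin|exact: rpredD].
  by apply: rpred_sum => l _; apply/rpredZ/glue.
move=> /(ncoord_cap fW)/(_ (leq_addr k _)).
rewrite ncoord_sum (bigD1 (Ordinal ka)) //= (ncoord_nth (adapted_basis fW)) ?eqxx ?mulr1; last first.
  by have := adapted_size thetaK ndB WU isoS; rewrite aW bW; move: ka; clear; lia.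
rewrite big1 ?addr0 => [/eqP|l lk].
  by rewrite subr_eq0 => /eqP ->.
rewrite (ncoord_nth (adapted_basis fW)); last first.
  by have := adapted_size thetaK ndB WU isoS; rewrite aW bW; move: (ka); clear; lia.
by rewrite eqn_add2l; case: eqP => [kl|_]; [move: lk; rewrite -val_eqE /= -kl eqxx|rewrite mulr0].
Qed.

(** S is the sum of S meet U, S meet W and the span of the u_i + w_i; equality of the middle blocks
    sends the last of these into S. *)
Lemma levi_stab (h : 'End(V)) : Hgrp B U W h ->
  (forall p, p \in [:: inv_r U S; inv_r U S + a; inv_r U S + a + b]%N ->
     forall i j, (j < p <= i)%N -> hcoef eU h i j = 0) ->
  (forall p, p \in [:: inv_r W S; inv_r W S + a; inv_r W S + a + b]%N ->
     forall i j, (j < p <= i)%N -> hcoef eW h i j = 0) ->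
  levi_agree h -> Hstab B U W S h.
Proof.
move=> Hh shU shW agree; split=> //; have /(HgrpP UW)[isoh hU hW] := Hh.
apply: (lker0_img_eq (Hgrp_lker0 ndB UW Hh)); apply/subvP => _ /memv_imgP[v vS ->].
have hcapU x : x \in (S :&: U)%VS -> h x \in (S :&: U)%VS.
  move=> xS; have xU : x \in U by move: xS; rewrite memv_cap => /andP[].
  rewrite (ncoord_expand (adapted_basis fU) xU) linear_sum /=; apply: rpred_sum => i _.
  rewrite linearZ /=; have [ri|ir] := leqP (inv_r U S) i.
    by rewrite (ncoord_cap fU) // scale0r mem0v.
  apply: rpredZ; have hin := subvP hU _ (memv_img h (nth_mem_basis (adapted_basis fU) i)).
  rewrite (flag_cap fU); apply/(mem_span_take (adapted_basis fU) _ hin) => k rk.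
  by apply: (shU (inv_r U S)); rewrite ?inE ?eqxx // ir rk.
have hcapW x : x \in (S :&: W)%VS -> h x \in (S :&: W)%VS.
  move=> xS; have xW : x \in W by move: xS; rewrite memv_cap => /andP[].
  rewrite (ncoord_expand (adapted_basis fW) xW) linear_sum /=; apply: rpred_sum => i _.
  rewrite linearZ /=; have [ri|ir] := leqP (inv_r W S) i.
    by rewrite (ncoord_cap fW) // scale0r mem0v.
  apply: rpredZ; have hin := subvP hW _ (memv_img h (nth_mem_basis (adapted_basis fW) i)).
  rewrite (flag_cap fW); apply/(mem_span_take (adapted_basis fW) _ hin) => k rk.
  by apply: (shW (inv_r W S)); rewrite ?inE ?eqxx // ir rk.
have hglue i : (i < a + b)%N -> h (eU`_(inv_r U S + i) + eW`_(inv_r W S + i)) \in S.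
  move=> ia; set j := (inv_r U S + i)%N; set j' := (inv_r W S + i)%N.
  have [|x xS hx] := flag_split UW isoS fU (subvP hU _ (memv_img h (nth_mem_basis (adapted_basis fU) j))).
    by move=> l ll; apply: (shU (inv_r U S + a + b)%N); rewrite ?inE ?eqxx ?orbT // ll andbT /j -addnA ltn_add2l.
  have [|y yS hy] := flag_splitW (subvP hW _ (memv_img h (nth_mem_basis (adapted_basis fW) j'))).
    by move=> l ll; apply: (shW (inv_r W S + a + b)%N); rewrite ?inE ?eqxx ?orbT // ll andbT /j' -addnA ltn_add2l.
  rewrite linearD /= hx hy addrACA -big_split /=.
  move: xS yS; rewrite !memv_cap => /andP[xS _] /andP[yS _].
  apply: rpredD; first exact: rpredD.
  apply: rpred_sum => l _; have := agree l i (ltn_ord l) ia; rewrite /hcoef => <-.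
  by rewrite -scalerDr rpredZ // glue.
have [u [w [uU wW vE]]] : exists u w, [/\ u \in U, w \in W & v = u + w].
  case: (UW) => UWf _ _; have /memv_addP[u uU [w wW ->]] : v \in (U + W)%VS by rewrite UWf memvf.
  by exists u, w.
have uP : u \in Proj U W S by apply/mem_Proj; split=> //; exists w; rewrite -?vE.
have [|x xS uE] := flag_split UW isoS fU uU.
  by move: uP; rewrite (flag_Proj UW isoS fU) => /(mem_span_take (adapted_basis fU) _ uU).
pose c k := ncoord eU (inv_r U S + k) u.
pose y := w - \sum_(k < a + b) c k *: eW`_(inv_r W S + k).
have vE' : v = x + y + \sum_(k < a + b) c k *: (eU`_(inv_r U S + k) + eW`_(inv_r W S + k)).
  rewrite (eq_bigr _ (fun l _ => scalerDr _ _ _)) big_split /= addrACA -uE /y subrK //.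
have yS : y \in (S :&: W)%VS.
  rewrite memv_cap; apply/andP; split; last first.
    by rewrite rpredB // rpred_sum // => l _; apply/rpredZ/(nth_mem_basis (adapted_basis fW)).
  have -> : y = v - x - \sum_(k < a + b) c k *: (eU`_(inv_r U S + k) + eW`_(inv_r W S + k)).
    by rewrite vE' -[x + y + _]addrA [x + (y + _)]addrC addrK addrK.
  move: xS; rewrite memv_cap => /andP[xS _].
  by apply: rpredB; [exact: rpredB|apply: rpred_sum => l _; apply/rpredZ/glue].
move: y vE' yS => y vE' yS; rewrite vE' !linearD /= linear_sum /=.
have := hcapU _ xS; have := hcapW _ yS; rewrite !memv_cap => /andP[hyS _] /andP[hxS _].
apply: rpredD; first exact: rpredD.
by apply: rpred_sum => l _; rewrite linearZ; apply/rpredZ/hglue.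
Qed.

Theorem Hstab_descriptionP : forall (h : 'End(V)), Hstab B U W S h <->
  exists hU hW,
    let MU := mx_in_basis eU hU in
    let MW := mx_in_basis eW hW in
    [/\ isogv B U hU /\ isogv B W hW, is_dprod h hU hW,
        block_shape B W S a b eU MU, block_shape B U S a b eW MW &
        levi_block MU (inv_r U S) a b = levi_block MW (inv_r W S) a b].
Proof.
move=> h; split=> [stab|[hU [hW [[isoU isoW] hdp shU shW lev]]]].
  have [[hU [hW [isoU isoW hdp]]] hS] := stab; exists hU, hW => MU MW.
  have [hUE hWE] := hdp; have Hh : Hgrp B U W h by exists hU, hW.
  have HhW : Hgrp B W U h by exists hW, hU; split=> //; split.
  have := stab_block_shape thetaK ndB WU isoS fW HhW hS hWE; rewrite aW bW => shW.
  have shU := stab_block_shape thetaK ndB UW isoS fU Hh hS hUE.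
  have agree := stab_levi stab.
  pose sU := block_sizes (\dim U) (inv_r U S) a b; pose sW := block_sizes (\dim W) (inv_r W S) a b.
  have eq k l (i : 'I_(nth 0 sU k)%N) (j : 'I_(nth 0 sU l)%N) (i' : 'I_(nth 0 sW k)%N)
      (j' : 'I_(nth 0 sW l)%N) : hcoef eU h (sumn (take k sU) + i) (sumn (take l sU) + j) =
      hcoef eW h (sumn (take k sW) + i') (sumn (take l sW) + j') ->
      block MU sU k l i j = block MW sW k l i' j'.
    by rewrite (block_hcoef fU _ _ hUE) (block_hcoef fW _ _ hWE).
  split=> //; congr block_mx; apply/matrixP => i j; have := ltn_ord i; have := ltn_ord j => jb ib.
  - by apply: (eq 1 1)%N; rewrite /= !addn0; apply: agree; lia.
  - by apply: (eq 1 2)%N; rewrite /= !addn0 -!addnA; apply: agree; lia.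
  - by apply: (eq 2 2)%N; rewrite /= !addn0 -!addnA; apply: agree; lia.
have [hUE hWE] := hdp; have Hh : Hgrp B U W h by exists hU, hW.
have [[zU _] _ _ _ _] := shU; have [[zW _] _ _ _ _] := shW.
have fU0 := blocks_flag thetaK ndB UW isoS fU hUE zU.
have fW0 := blocks_flag thetaK ndB WU isoS fW hWE; rewrite aW bW in fW0.
have {}fW0 := fW0 _ zW.
apply: levi_stab => // k i ka ia.
have [b11 b12 _ b22] := eq_block_mx lev.
pose sU := block_sizes (\dim U) (inv_r U S) a b; pose sW := block_sizes (\dim W) (inv_r W S) a b.
have eq q l (i0 : 'I_(nth 0 sU q)%N) (j : 'I_(nth 0 sU l)%N) (i' : 'I_(nth 0 sW q)%N)
    (j' : 'I_(nth 0 sW l)%N) :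
    block (mx_in_basis eU hU) sU q l i0 j = block (mx_in_basis eW hW) sW q l i' j' ->
    hcoef eU h (sumn (take q sU) + i0) (sumn (take l sU) + j) =
    hcoef eW h (sumn (take q sW) + i') (sumn (take l sW) + j').
  by rewrite (block_hcoef fU _ _ hUE) (block_hcoef fW _ _ hWE).
have [ka'|ak] := ltnP k a; have [ia'|ai] := ltnP i a.
- have := congr1 (fun A : 'M_a => A (Ordinal ka') (Ordinal ia')) b11.
  by move/(eq 1 1)%N; rewrite /= !addn0.
- have ib : (i - a < b)%N by lia.
  have := congr1 (fun A : 'M_(a, b) => A (Ordinal ka') (Ordinal ib)) b12.
  by move/(eq 1 2)%N; rewrite /= !addn0 -!addnA subnKC.
- rewrite (fU0 (inv_r U S + a)%N) ?(fW0 (inv_r W S + a)%N) ?inE ?eqxx ?orbT //.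
    by rewrite ltn_add2l ia' leq_add2l.
  by rewrite ltn_add2l ia' leq_add2l.
- have kb : (k - a < b)%N by lia.
  have ib : (i - a < b)%N by lia.
  have := congr1 (fun A : 'M_b => A (Ordinal kb) (Ordinal ib)) b22.
  by move/(eq 2 2)%N; rewrite /= !addn0 -!addnA !subnKC.
Qed.

End Adapted.

Theorem Hstab_description_holds : Hstab_description B U W S.
Proof.
move=> eU eW ad; split=> [h|h h' hU hU' hW hW' sh sh' [hUE hWE] [hUE' hWE']].
  exact: Hstab_descriptionP.
have WU := orthodecomp_sym UW.
have fU : flag_basis B U W S eU by case: ad.
have fW : flag_basis B W U S eW by case: ad.
have sW : Hstab B W U S h by case: sh => /(HgrpP UW)[? ? ?] ?; split=> //; apply/(HgrpP WU).
have sW' : Hstab B W U S h' by case: sh' => /(HgrpP UW)[? ? ?] ?; split=> //; apply/(HgrpP WU).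
have [d0 d1] := blocks_determined UW isoS fU sh sh' hUE hUE'.
have := blocks_determined WU isoS fW sW sW' hWE hWE'.
by rewrite (inv_a_sym UW isoS) (inv_b_sym UW isoS) => -[d0' d1'].
Qed.

End Description.

(** * The Lie algebra of the stabilizer *)

Section FrameForms.
Variables (K : fieldType) (eps : bool) (theta : {rmorphism K -> K}).
Hypothesis thetaK : involutive theta.
Variables (V : vectType K) (B : {hermitian V for eps & theta}).
Hypothesis ndB : nondegenerate B.
Variables (TT : Type) (J : TT -> forall n, 'I_n -> 'I_n -> K).
Arguments J : clear implicits.
Variables (U W : {vspace V}).
Hypothesis UW : orthodecomp B U W.
Variables (S : {vspace V}) (r r' a b c c' : nat) (t tU tW : TT).
Variables (e : frame_index r a b c -> V) (f : frame_index r' a b c' -> V).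
Hypothesis NF : normal_frame B J U W t tU tW S e f.

Definition frame_vec : frame_index r a b c + frame_index r' a b c' -> V := sumf e f.
Local Notation E := frame_vec.

Let UWperp u w : u \in U -> w \in W -> B u w = 0.
Proof. by case: UW => _ _ /orthovP; apply. Qed.

Lemma frame_basis : fbasis fullv E.
Proof.
by case: NF => -[bU bW] _ _ _; case: UW => <- UW0 _; exact: fbasis_sum.
Qed.

Lemma frame_memU i : e i \in U.
Proof. by case: NF => -[[_ <-] _] _ _ _; exact: mem_fspan. Qed.

Lemma frame_memW i : f i \in W.
Proof. by case: NF => -[_ [_ <-]] _ _ _; exact: mem_fspan. Qed.

Lemma frame_cross i j : B (e i) (f j) = 0 /\ B (f j) (e i) = 0.
Proof.
have ef : B (e i) (f j) = 0 by apply: UWperp; [exact: frame_memU|exact: frame_memW].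
by split=> //; exact: herm_sym0.
Qed.

Lemma gramU i j : B (e i) (e j) = frame_gram eps J 1 t tU i j.
Proof. by case: NF. Qed.

Lemma gramW i j : B (f i) (f j) = frame_gram eps J (-1) t tW i j.
Proof. by case: NF. Qed.

(* These vectors span the orthogonal of S; e and f enter separately except in type b and a'. *)
Definition orthogonal_family : (('I_r + 'I_r') + ('I_a + 'I_a)) + (('I_b + 'I_a) + ('I_c + 'I_c')) -> V :=
  sumf (sumf (sumf (frame_r e) (frame_r f)) (sumf (frame_a e) (frame_a f)))
    (sumf (sumf (fun i => frame_b e i + frame_b f i) (fun i => frame_a' e i - frame_a' f i))
      (sumf (frame_c e) (frame_c f))).

Lemma frame_ndeg (d : frame_index r a b c -> K) :
  (forall j, \sum_i d i * B (e i) (e j) = 0) -> forall i, d i = 0.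
Proof.
move=> d0; have [[[fe eU] _] _ _ _] := NF; apply: fe.
have /ndegP := ndeg_orthodecomp ndB UW; apply=> [|u].
  by apply: rpred_sum => i _; rewrite rpredZ // frame_memU.
rewrite -eU => /fspanP[k ->]; rewrite form_sumr big1 // => j _.
by rewrite form_suml d0 mulr0.
Qed.

Lemma frame_ndegW (d : frame_index r' a b c' -> K) :
  (forall j, \sum_i d i * B (f i) (f j) = 0) -> forall i, d i = 0.
Proof.
move=> d0; have [[_ [fe eU]] _ _ _] := NF; apply: fe.
have /ndegP := ndeg_orthodecomp ndB (orthodecomp_sym UW); apply=> [|u].
  by apply: rpred_sum => i _; rewrite rpredZ // frame_memW.
rewrite -eU => /fspanP[k ->]; rewrite form_sumr big1 // => j _.
by rewrite form_suml d0 mulr0.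
Qed.

Lemma isotropic_orthogonal i j : B (isotropic_family e f i) (orthogonal_family j) = 0.
Proof.
rewrite /isotropic_family /orthogonal_family /frame_r /frame_a /frame_b /frame_c /frame_a'.
case: i => i; case: i => i; case: j => j; case: j => j; case: j => j /=;
  rewrite ?linearDl /= ?linearDr /= ?linearBr /= ?(frame_cross _ _).1 ?(frame_cross _ _).2
    ?gramU ?gramW /= ?addr0 ?add0r ?subr0 ?mul1r ?mulN1r ?subrr ?oppr0 ?addr0
    ?linearNr /= ?gramU ?gramW ?(frame_cross _ _).1 ?oppr0 ?addr0 ?subrr; try by [].
Qed.

(** The double orthogonal of S made explicit: pairing with r and a vectors kills the coefficients of
    their duals, a' identifies the a-coefficients of the two sides, c kills the c-part and b
    identifies the b-coefficients. It turns stability of S under x into equations on the B(x E_i)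
    E_j. *)
Lemma mem_isotropicP v : v \in S <-> forall j, B v (orthogonal_family j) = 0.
Proof.
have SE : S = fspan (isotropic_family e f) by case: NF.
split=> [|v0].
  rewrite SE => /fspanP[k ->] j; rewrite form_suml big1 // => i _.
  by rewrite isotropic_orthogonal mulr0.
have /fspanP[k vE] : v \in fspan E by rewrite (proj2 frame_basis) memvf.
pose k1 i := k (inl i); pose k2 i := k (inr i).
have vE' : v = \sum_i k1 i *: e i + \sum_i k2 i *: f i by rewrite vE big_sumType.
have ve j : B v (e j) = \sum_i k1 i * B (e i) (e j).
  rewrite vE' linearDl /= !form_suml [X in _ + X]big1 ?addr0 // => i _.
  by rewrite (frame_cross _ _).2 mulr0.
have vf j : B v (f j) = \sum_i k2 i * B (f i) (f j).
  rewrite vE' linearDl /= !form_suml big1 ?add0r // => i _.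
  by rewrite (frame_cross _ _).1 mulr0.
have sums (I : finType) (x : I -> K) i (y : K) : \sum_j x j * (y * (j == i)%:R) = x i * y.
  rewrite (bigD1 i) //= eqxx mulr1 big1 ?addr0 // => j /negPf ji.
  by rewrite ji !mulr0.
have sums1 (I : finType) (x : I -> K) i : \sum_j x j * (j == i)%:R = x i.
  by rewrite -[RHS]mulr1 -sums; apply: eq_bigr => j _; rewrite mul1r.
have z0 (I : finType) (x : I -> K) : \sum_i x i * 0 = 0 by rewrite big1 // => i _; rewrite mulr0.
have sgn0 (x : K) : x * (-1) ^+ eps = 0 -> x = 0.
  by move/eqP; rewrite mulf_eq0 signr_eq0 orbF => /eqP.
have ger' i : k1 (inr (inl (inr (inl i)))) = 0.
  apply: sgn0; rewrite -[RHS](v0 (inl (inl (inl i)))) /= /frame_r ve.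
  under [RHS]eq_bigr => j _ do rewrite gramU.
  by rewrite 3!big_sumType /= !z0 sums !(addr0, add0r).
have gea' i : k1 (inr (inl (inr (inr i)))) = 0.
  apply: sgn0; rewrite -[RHS](v0 (inl (inr (inl i)))) /= /frame_a ve.
  under [RHS]eq_bigr => j _ do rewrite gramU.
  by rewrite 3!big_sumType /= !z0 sums !(addr0, add0r).
have gfr' i : k2 (inr (inl (inr (inl i)))) = 0.
  apply: sgn0; rewrite -[RHS](v0 (inl (inl (inr i)))) /= /frame_r vf.
  under [RHS]eq_bigr => j _ do rewrite gramW.
  by rewrite 3!big_sumType /= !z0 sums !(addr0, add0r).
have gfa' i : k2 (inr (inl (inr (inr i)))) = 0.
  apply: sgn0; rewrite -[RHS](v0 (inl (inr (inr i)))) /= /frame_a vf.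
  under [RHS]eq_bigr => j _ do rewrite gramW.
  by rewrite 3!big_sumType /= !z0 sums !(addr0, add0r).
have gaa i : k1 (inr (inl (inl (inr i)))) = k2 (inr (inl (inl (inr i)))).
  apply/eqP; rewrite -subr_eq0; apply/eqP; rewrite -[RHS](v0 (inr (inl (inr i)))) /= linearBr /=.
  rewrite /frame_a' ve vf; under [X in _ = X - _]eq_bigr => j _ do rewrite gramU.
  under [X in _ = _ - X]eq_bigr => j _ do rewrite gramW.
  by do 2 rewrite 3!big_sumType /= !z0 sums1 !(addr0, add0r).
have gc i : k1 (inr (inr i)) = 0.
  pose d (i : frame_index r a b c) : K := match i with inr (inr i) => k1 (inr (inr i)) | _ => 0 end.
  rewrite -[LHS]/(d (inr (inr i))); apply: frame_ndeg => j.
  case: j => j; last (case: j => j; first (case: j => j)); try by rewrite !big_sumType /= !big1 ?addr0 // => l _; rewrite ?mul0r ?gramU /= ?mulr0.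
  rewrite -[RHS](v0 (inr (inr (inl j)))) /= /frame_c ve !big_sumType /=.
  by congr (_ + (_ + _ + (_ + _) + _)); apply: eq_bigr => l _; rewrite gramU /= mul0r mulr0.
have gc' i : k2 (inr (inr i)) = 0.
  pose d (i : frame_index r' a b c') : K := match i with inr (inr i) => k2 (inr (inr i)) | _ => 0 end.
  rewrite -[LHS]/(d (inr (inr i))); apply: frame_ndegW => j.
  case: j => j; last (case: j => j; first (case: j => j)); try by rewrite !big_sumType /= !big1 ?addr0 // => l _; rewrite ?mul0r ?gramW /= ?mulr0.
  rewrite -[RHS](v0 (inr (inr (inr j)))) /= /frame_c vf !big_sumType /=.
  by congr (_ + (_ + _ + (_ + _) + _)); apply: eq_bigr => l _; rewrite gramW /= mul0r mulr0.
have gb i : k1 (inl i) = k2 (inl i).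
  apply/eqP; rewrite -subr_eq0; apply/eqP.
  pose d (i : frame_index r a b c) : K := match i with inl i => k1 (inl i) - k2 (inl i) | _ => 0 end.
  rewrite -[LHS]/(d (inl i)); apply: frame_ndeg => j.
  case: j => [j|j]; last first.
    rewrite !big_sumType /= !big1 ?addr0 // => l _; rewrite ?mul0r // gramU /=.
    by case: j => [[j|j]|j] /=; rewrite mulr0.
  rewrite -[RHS](v0 (inr (inl (inl j)))) /= /frame_b linearDr /= ve vf.
  rewrite !big_sumType /=.
  rewrite [X in (_ + X = _)](_ : _ = 0); last first.
    by rewrite !big1 ?addr0 // => l _; rewrite mul0r.
  have zU (I : finType) (x : I -> K) (g : I -> _) :
      \sum_i x i * B (e (inr (g i))) (e (inl j)) = 0.
    by rewrite big1 // => l _; rewrite gramU /=; case: (g l) => [[]|] *; rewrite mulr0.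
  have zW (I : finType) (x : I -> K) (g : I -> _) :
      \sum_i x i * B (f (inr (g i))) (f (inl j)) = 0.
    by rewrite big1 // => l _; rewrite gramW /=; case: (g l) => [[]|] *; rewrite mulr0.
  rewrite !zU !zW !addr0 -big_split /=; apply: eq_bigr => l _.
  by rewrite gramU gramW /= mul1r mulN1r mulrN mulrBl.
rewrite SE; pose kS i := match i with
  | inl (inl i) => k1 (inr (inl (inl (inl i)))) | inl (inr i) => k2 (inr (inl (inl (inl i))))
  | inr (inl i) => k1 (inr (inl (inl (inr i)))) | inr (inr i) => k1 (inl i) end.
suff -> : v = \sum_i kS i *: isotropic_family e f i by exact: fspan_sum.
have z0' (I : finType) (x : I -> K) (g : I -> V) : (forall i, x i = 0) -> \sum_i x i *: g i = 0.
  by move=> x0; rewrite big1 // => i _; rewrite x0 scale0r.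
rewrite vE' !big_sumType /= (z0' _ _ _ ger') (z0' _ _ _ gea') (z0' _ _ _ gc).
rewrite (z0' _ _ _ gfr') (z0' _ _ _ gfa') (z0' _ _ _ gc') !addr0.
rewrite [LHS](AC ((1*2)*(1*2)) ((2*5)*((3*6)*(1*4)))); congr (_ + (_ + _)).
  by rewrite -big_split /=; apply: eq_bigr => i _; rewrite /frame_a scalerDr gaa.
by rewrite -big_split /=; apply: eq_bigr => i _; rewrite /frame_b scalerDr gb.
Qed.

End FrameForms.

(** * Entries of the skew endomorphisms that preserve U, W and S *)

Section LieAlgebra.
Variables (K : fieldType) (eps : bool) (theta : {rmorphism K -> K}).
Hypothesis thetaK : involutive theta.
Variables (V : vectType K) (B : {hermitian V for eps & theta}).
Hypothesis ndB : nondegenerate B.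
Variables (TT : Type) (J : TT -> forall n, 'I_n -> 'I_n -> K).
Arguments J : clear implicits.
Variables (U W : {vspace V}).
Hypothesis UW : orthodecomp B U W.
Variables (S : {vspace V}) (r r' a b c c' : nat) (t tU tW : TT).
Variables (e : frame_index r a b c -> V) (f : frame_index r' a b c' -> V).
Hypothesis NF : normal_frame B J U W t tU tW S e f.
Local Notation E := (frame_vec e f).

Definition stab_skew (U W S : {vspace V}) (x : 'End(V)) : Prop :=
  [/\ forall u v, B (x u) v + B u (x v) = 0,
      forall u, u \in U -> x u \in U, forall u, u \in W -> x u \in W &
      forall u, u \in S -> x u \in S].

(* The types r, a, b, c, a', r' of frame vectors, in the order of the blocks. *)
Definition kind r a b c (i : frame_index r a b c) : nat :=
  match i with
  | inr (inl (inl (inl _))) => 0 | inr (inl (inl (inr _))) => 1 | inl _ => 2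
  | inr (inr _) => 3 | inr (inl (inr (inr _))) => 4 | inr (inl (inr (inl _))) => 5
  end.

(** B(x e_i) e_j reads the component of x e_i in the kind dual to that of e_j, where 4 is dual to 1,
    5 to 0, and 2 and 3 to themselves; the excluded pairs are those where the block shape of the
    stabilizer has a zero. *)
Definition freeU (k l : nat) : bool :=
  [|| k == 5, l == 5, (k == 4) && (0 < l)%N, (l == 4) && (0 < k)%N,
      (k == 2) && (l == 2) | (k == 3) && (l == 3)].

(** The entries on W that repeat entries on U, according to A22 = B22, A23 = B23 and A33 = B33,
    together with their images under the skew symmetry. *)
Definition mirrored (k l : nat) : bool :=
  [|| (k == 4) && ((l == 1) || (l == 2)), (l == 4) && ((k == 1) || (k == 2)) |
      (k == 2) && (l == 2)].

(* The entries B (x E_i) E_j of an element x of the Lie algebra of the stabilizer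
   that can be chosen freely, up to the (skew-)symmetry. *)
Definition free_entry (i j : frame_index r a b c + frame_index r' a b c') : bool :=
  match i, j with
  | inl i, inl j => freeU (kind i) (kind j)
  | inr i, inr j => freeU (kind i) (kind j) && ~~ mirrored (kind i) (kind j)
  | _, _ => false
  end.

(** The repeated entries. The sign at b-b comes from the factor -1 in the Gram matrix of W; a and a'
    pair to 1 on both sides. *)
Definition mix (p : frame_index r a b c + frame_index r' a b c' ->
    frame_index r a b c + frame_index r' a b c' -> K)
    (i j : frame_index r a b c + frame_index r' a b c') : K :=
  match i, j with
  | inr i, inr j =>
    match i, j with
    | inl i, inl j => - p (inl (inl i)) (inl (inl j))
    | inl i, inr (inl (inr (inr j))) => p (inl (inl i)) (inl (inr (inl (inr (inr j)))))
    | inr (inl (inr (inr i))), inl j => p (inl (inr (inl (inr (inr i))))) (inl (inl j))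
    | inr (inl (inl (inr i))), inr (inl (inr (inr j))) =>
        p (inl (inr (inl (inl (inr i))))) (inl (inr (inl (inr (inr j)))))
    | inr (inl (inr (inr i))), inr (inl (inl (inr j))) =>
        p (inl (inr (inl (inr (inr i))))) (inl (inr (inl (inl (inr j)))))
    | _, _ => 0
    end
  | _, _ => 0
  end.

Definition framed_skew p : Prop :=
  (forall i j, p i j = - (-1) ^+ eps * theta (p j i)) /\
  (forall i j, p i j = (if free_entry i j then p i j else 0) + mix p i j).

Definition frame_form (x : 'End(V)) i j : K := B (x (E i)) (E j).

Lemma frame_index_ind (r1 a1 b1 c1 : nat) (P : frame_index r1 a1 b1 c1 -> Prop) :
  (forall i, P (inr (inl (inl (inl i))))) -> (forall i, P (inr (inl (inl (inr i))))) ->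
  (forall i, P (inl i)) -> (forall i, P (inr (inr i))) ->
  (forall i, P (inr (inl (inr (inr i))))) -> (forall i, P (inr (inl (inr (inl i))))) ->
  forall i, P i.
Proof.
move=> P0 P1 P2 P3 P4 P5; case=> [i|i]; first exact: P2.
by case: i => [i|i] //; case: i => i; case: i.
Qed.

Lemma theta_sgn k : theta ((-1) ^+ k) = (-1) ^+ k.
Proof. by rewrite rmorphXn rmorphN1. Qed.

Lemma skew_twice (k : K) : - (-1) ^+ eps * theta (- (-1) ^+ eps * theta k) = k.
Proof.
rewrite rmorphM rmorphN /= theta_sgn thetaK !mulNr mulrN opprK mulrA -expr2 sqrr_sign.
by rewrite mul1r.
Qed.

Lemma orthodecomp_orthov U' W' v : orthodecomp B U' W' -> (forall w, w \in W' -> B v w = 0) -> v \in U'.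
Proof.
move=> UW' vW; have [UWf _ /orthovP pUW] := UW'.
have /memv_addP[u uU [w wW vE]] : v \in (U' + W')%VS by rewrite UWf memvf.
suff w0 : w = 0 by rewrite vE w0 addr0.
have /ndegP := ndeg_orthodecomp ndB (orthodecomp_sym UW'); apply=> // w' w'W.
by have := vW w' w'W; rewrite vE linearDl /= pUW // add0r.
Qed.

(** Skewness and stability of U and W are read off the frame; stability of S becomes B(x s, o) = 0
    for s in the isotropic family and o in the orthogonal one, which gives the vanishing entries and
    the repeated ones. *)
Lemma frame_formP x : stab_skew U W S x <-> framed_skew (frame_form x).
Proof.
have SE : S = fspan (isotropic_family e f) by case: NF.
have fr := frame_cross UW NF.
split=> [[sk xU xW xS]|[sk sh]].
  have sk' i j : frame_form x i j = - (-1) ^+ eps * theta (frame_form x j i).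
    rewrite /frame_form; have /eqP := sk (E i) (E j); rewrite addr_eq0 => /eqP ->.
    by rewrite (hermC _ (E i)) mulNr.
  split=> //; set p := frame_form x in sk' *.
  have flip i j : p j i = 0 -> p i j = 0 by move=> pji; rewrite sk' pji rmorph0 mulr0.
  have cr1 i j : B (x (e i)) (f j) = 0.
    case: UW => _ _ /orthovP; apply; last exact: frame_memW NF _.
    by apply: xU; exact: frame_memU NF _.
  have cr2 i j : B (x (f i)) (e j) = 0.
    apply: (herm_sym0 (B := B)); case: UW => _ _ /orthovP; apply; first exact: frame_memU NF _.
    by apply: xW; exact: frame_memW NF _.
  have hS i j : B (x (isotropic_family e f i)) (orthogonal_family e f j) = 0.
    by apply: (mem_isotropicP ndB UW NF _).1; apply: xS; rewrite SE mem_fspan.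
  have mS i j := hS i j; rewrite /isotropic_family /orthogonal_family /frame_r /frame_a
    /frame_b /frame_c /frame_a' in mS.
  have hU (i j : frame_index r a b c) : (kind i < 3)%N -> (kind j \in [:: 0; 1; 3]) ->
      p (inl i) (inl j) = 0.
    elim/frame_index_ind: i => i; elim/frame_index_ind: j => j //= _ _; rewrite /p /frame_form /=;
    [have := mS (inl (inl i)) (inl (inl (inl j)))|have := mS (inl (inl i)) (inl (inr (inl j)))
    |have := mS (inl (inl i)) (inr (inr (inl j)))|have := mS (inr (inl i)) (inl (inl (inl j)))
    |have := mS (inr (inl i)) (inl (inr (inl j)))|have := mS (inr (inl i)) (inr (inr (inl j)))
    |have := mS (inr (inr i)) (inl (inl (inl j)))|have := mS (inr (inr i)) (inl (inr (inl j)))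
    |have := mS (inr (inr i)) (inr (inr (inl j)))];
    by rewrite /= ?linearD /= ?linearDl /= ?cr2 ?addr0.
  have hW (i j : frame_index r' a b c') : (kind i < 3)%N -> (kind j \in [:: 0; 1; 3]) ->
      p (inr i) (inr j) = 0.
    elim/frame_index_ind: i => i; elim/frame_index_ind: j => j //= _ _; rewrite /p /frame_form /=;
    [have := mS (inl (inr i)) (inl (inl (inr j)))|have := mS (inl (inr i)) (inl (inr (inr j)))
    |have := mS (inl (inr i)) (inr (inr (inr j)))|have := mS (inr (inl i)) (inl (inl (inr j)))
    |have := mS (inr (inl i)) (inl (inr (inr j)))|have := mS (inr (inl i)) (inr (inr (inr j)))
    |have := mS (inr (inr i)) (inl (inl (inr j)))|have := mS (inr (inr i)) (inl (inr (inr j)))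
    |have := mS (inr (inr i)) (inr (inr (inr j)))];
    by rewrite /= ?linearD /= ?linearDl /= ?cr1 ?add0r.
  have hUr i j : p (inl (inr (inl (inl (inl i))))) (inl (inr (inl (inr (inr j))))) = 0.
    by have := mS (inl (inl i)) (inr (inl (inr j))); rewrite /= linearBr /= cr1 subr0.
  have hWr i j : p (inr (inr (inl (inl (inl i))))) (inr (inr (inl (inr (inr j))))) = 0.
    have /eqP := mS (inl (inr i)) (inr (inl (inr j))).
    by rewrite /= linearBr /= cr2 sub0r oppr_eq0 => /eqP.
  have hbb i j : p (inr (inl i)) (inr (inl j)) = - p (inl (inl i)) (inl (inl j)).
    have /eqP := mS (inr (inr i)) (inr (inl (inl j))).
    rewrite /= !linearD /= !linearDl /= !cr1 !cr2 addr0 add0r addrC addr_eq0 => /eqP E1.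
    exact: E1.
  have hba i j : p (inr (inl i)) (inr (inr (inl (inr (inr j))))) =
      p (inl (inl i)) (inl (inr (inl (inr (inr j))))).
    have /eqP := mS (inr (inr i)) (inr (inl (inr j))).
    rewrite /= linearBr /= !linearD /= !linearDl /= cr1 cr2 addr0 add0r subr_eq0 => /eqP E1.
    exact/esym.
  have haa i j : p (inr (inr (inl (inl (inr i))))) (inr (inr (inl (inr (inr j))))) =
      p (inl (inr (inl (inl (inr i))))) (inl (inr (inl (inr (inr j))))).
    have /eqP := mS (inr (inl i)) (inr (inl (inr j))).
    rewrite /= linearBr /= !linearD /= !linearDl /= cr1 cr2 addr0 add0r subr_eq0 => /eqP E1.
    exact/esym.
  have flip2 i j i' j' : p i j = p i' j' -> p j i = p j' i' by move=> ij; rewrite sk' ij -sk'.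
  case=> i; case=> j /=; rewrite ?addr0.
  - by elim/frame_index_ind: i => i; elim/frame_index_ind: j => j //=;
      first [exact: hU|exact: hUr|apply: flip; first [exact: hU|exact: hUr]].
  - exact: cr1.
  - exact: cr2.
  by elim/frame_index_ind: i => i; elim/frame_index_ind: j => j //=; rewrite ?addr0 ?add0r //;
      first [exact: hbb|exact: hba|exact: haa|exact: hW|exact: hWr
            |apply: flip; first [exact: hW|exact: hWr]
            |apply: flip2; first [exact: hba|exact: haa]].
have sk1 i v : B (x (E i)) v + B (E i) (x v) = 0.
  have /fspanP[k ->] : v \in fspan E by rewrite (frame_basis UW NF).2 memvf.
  rewrite linear_sum !linear_sum -big_split big1 // => j _.
  rewrite /= !linearZ /= -mulrDr (hermC _ (E i)) -[B (x (E i)) _]/(frame_form x i j) sk.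
  by rewrite mulNr addNr mulr0.
have shU (i j : frame_index r a b c) : ~~ freeU (kind i) (kind j) -> B (x (e i)) (e j) = 0.
  by move=> /negPf ij; have /= := sh (inl i) (inl j); rewrite ij addr0.
have shUW i j : B (x (e i)) (f j) = 0 by have /= := sh (inl i) (inr j); rewrite addr0.
have shWU i j : B (x (f i)) (e j) = 0 by have /= := sh (inr i) (inl j); rewrite addr0.
have shW i j : B (x (f i)) (f j) =
    (if freeU (kind i) (kind j) && ~~ mirrored (kind i) (kind j) then B (x (f i)) (f j) else 0)
    + mix (frame_form x) (inr i) (inr j) by exact: (sh (inr i) (inr j)).
have [[[_ eU] [_ fW]] _ _ _] := NF.
have xsum (I : finType) (k : I -> K) g : x (\sum_i k i *: g i) = \sum_i k i *: x (g i).
  by rewrite linear_sum; apply: eq_bigr => i _; rewrite linearZ.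
split=> [u v|u|w|s].
- have /fspanP[k ->] : u \in fspan E by rewrite (frame_basis UW NF).2 memvf.
  rewrite xsum !form_suml -big_split big1 // => i _ /=.
  by rewrite -mulrDr sk1 mulr0.
- rewrite -{1}eU => /fspanP[k ->]; rewrite xsum.
  apply: (orthodecomp_orthov UW) => w; rewrite -fW => /fspanP[l ->].
  rewrite form_sumr big1 // => j _; rewrite form_suml big1 ?mulr0 // => i _.
  by rewrite shUW mulr0.
- rewrite -{1}fW => /fspanP[k ->]; rewrite xsum.
  apply: (orthodecomp_orthov (orthodecomp_sym UW)) => u; rewrite -eU => /fspanP[l ->].
  rewrite form_sumr big1 // => j _; rewrite form_suml big1 ?mulr0 // => i _.
  by rewrite shWU mulr0.
rewrite {1}SE => /fspanP[k ->]; apply/(mem_isotropicP ndB UW NF) => j.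
rewrite xsum form_suml big1 // => i _; apply/eqP; rewrite mulf_eq0; apply/orP; right; apply/eqP.
rewrite /isotropic_family /orthogonal_family /frame_r /frame_a /frame_b /frame_c /frame_a'.
case: i => i; case: i => i; case: j => j; case: j => j; case: j => j /=;
  rewrite ?linearBr /= ?linearD /= ?linearDl /= ?shUW ?shWU ?addr0 ?add0r ?subr0 ?sub0r;
  first [by rewrite shU|by rewrite shW /= ?add0r ?oppr0|by rewrite shW shU /= ?add0r ?oppr0
        |by rewrite shW /= add0r subrr|by []].
Qed.

Lemma frame_form_inj x : (forall i j, frame_form x i j = 0) -> x = 0.
Proof.
have [_ fE] := frame_basis UW NF.
move=> x0; apply/lfunP => v; have /fspanP[k ->] : v \in fspan E by rewrite fE memvf.
rewrite linear_sum lfunE; apply: big1 => i _; rewrite linearZ /=.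
suff -> : x (E i) = 0 by rewrite scaler0.
apply: (ndegB ndB) => w.
have /fspanP[l ->] : w \in fspan E by rewrite fE memvf.
by rewrite form_sumr big1 // => j _; rewrite [B _ _]x0 mulr0.
Qed.

Lemma frame_form_surj p : exists x, forall i j, frame_form x i j = p i j.
Proof.
have [fe _] := frame_basis UW NF.
have ndf : ndeg B fullv by apply/ndegP => v _ v0; apply: (ndegB ndB) => w; exact: v0 (memvf w).
have [d [_ dE]] := dual_family thetaK ndf (fun i => memvf (E i)) fe.
have [x xE] := fbasis_lfun (fun i => \sum_j p i j *: d j) fe.
exists x => i j; rewrite /frame_form xE form_suml (bigD1 j) //= dE eqxx mulr1 big1 ?addr0 //.
by move=> l /negPf lj; rewrite dE lj mulr0.
Qed.

(** [mix] reads only entries on U and writes only entries on W that are not free, so adding it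
    leaves the free entries and [mix] itself unchanged. *)
Lemma framed_skew_ext p : (forall i j, p i j = - (-1) ^+ eps * theta (p j i)) ->
  (forall i j, ~~ free_entry i j -> p i j = 0) ->
  let q i j := p i j + mix p i j in framed_skew q /\ forall i j, free_entry i j -> q i j = p i j.
Proof.
move=> sk p0 q.
have mixp i j : free_entry i j -> mix p i j = 0.
  by case: i => i; case: j => j //; elim/frame_index_ind: i => i; elim/frame_index_ind: j => j.
have mixq i j : mix q i j = mix p i j.
  by case: i => i; case: j => j //; elim/frame_index_ind: i => i; elim/frame_index_ind: j => j //;
    rewrite /q /= addr0.
have mixC i j : mix p i j = - (-1) ^+ eps * theta (mix p j i).
  case: i => i; case: j => j; rewrite /= ?rmorph0 ?mulr0 //.
  elim/frame_index_ind: i => i; elim/frame_index_ind: j => j; rewrite /= ?rmorph0 ?mulr0 //.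
  by rewrite rmorphN mulrN; congr (- _).
have qf i j : free_entry i j -> q i j = p i j by move=> ij; rewrite /q mixp // addr0.
split=> //; split=> i j; first by rewrite /q rmorphD mulrDr -sk -mixC.
rewrite mixq; case: ifP => [ij|/negbT ij]; first by rewrite mixp ?addr0.
by rewrite /q p0 // add0r.
Qed.

Lemma framed_skew0 p : framed_skew p -> (forall i j, free_entry i j -> p i j = 0) ->
  forall i j, p i j = 0.
Proof.
move=> [sk sh] p0.
have p0' i j : (if free_entry i j then p i j else 0) = 0 by case: ifP => // /p0.
have pU i j : p (inl i) (inl j) = 0 by rewrite sh p0' add0r.
move=> i j; rewrite sh p0' add0r.
case: i => i; case: j => j //.
by elim/frame_index_ind: i => i; elim/frame_index_ind: j => j //=; rewrite pU ?oppr0.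
Qed.

Lemma free_sym i j : free_entry i j = free_entry j i.
Proof.
case: i => i; case: j => j //=; elim/frame_index_ind: i => i; elim/frame_index_ind: j => j //=.
Qed.

End LieAlgebra.

(** * The chart (g - 1)^-1 of the stabilizer *)

Section Cayley.
Variables (K : fieldType) (eps : bool) (theta : {rmorphism K -> K}).
Variables (V : vectType K) (B : {hermitian V for eps & theta}).
Hypothesis ndB : nondegenerate B.
Variables (U W : {vspace V}).
Hypothesis UW : orthodecomp B U W.
Variable S : {vspace V}.

(* The set of all (g - 1)^-1 for g in the stabilizer, up to invertibility: this
   avoids the division by 2 of the usual Cayley transform. *)
Definition cayley (y : 'End(V)) : Prop :=
  [/\ forall u v, B (y u) v + B u (y v) = - B u v,
      forall u, u \in U -> y u \in U, forall u, u \in W -> y u \in W &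
      forall u, u \in S -> y u \in S].

Lemma stable_inv (y : 'End(V)) (X : {vspace V}) : lker y == 0%VS ->
  (forall u, u \in X -> y u \in X) -> forall u, u \in X -> (y^-1)%VF u \in X.
Proof.
move=> ky yX u uX; have /memv_imgP[w wX ->] : u \in (y @: X)%VS.
  by rewrite lker0_img_eq //; apply/subvP => _ /memv_imgP[w wX ->]; exact: yX.
by rewrite lker0_lfunK.
Qed.

Lemma HstabP h : Hstab B U W S h <-> [/\ isometry B B h,
  forall u, u \in U -> h u \in U, forall u, u \in W -> h u \in W &
  forall u, u \in S -> h u \in S].
Proof.
have imgP X : (h @: X <= X)%VS <-> (forall u, u \in X -> h u \in X).
  split=> [/subvP hX u uX|hX]; first by apply: hX; exact: memv_img.
  by apply/subvP => _ /memv_imgP[u uX ->]; exact: hX.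
split=> [[/(HgrpP UW)[ih /imgP hU /imgP hW] hS]|[ih hU hW hS]].
  by split=> //; apply/imgP; rewrite hS.
split; first by apply/(HgrpP UW); split=> //; apply/imgP.
by apply: lker0_img_eq; [exact: (isometry_lker0 ndB ih)|exact/imgP].
Qed.

(** With u = (g - 1) u' and v = (g - 1) v', the identity for y is B(g u', g v') = B(u', v')
    expanded. *)
Lemma Hstab_cayley g : Hstab B U W S g -> lker (g - \1%VF) == 0%VS -> cayley ((g - \1%VF)^-1)%VF.
Proof.
move=> /HstabP[ig gU gW gS] kg.
have st (X : {vspace V}) : (forall u, u \in X -> g u \in X) ->
    forall u, u \in X -> ((g - \1%VF)^-1)%VF u \in X.
  move=> gX; apply: stable_inv kg _ => u uX.
  by rewrite add_lfunE opp_lfunE id_lfunE rpredB // gX.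
split; [|exact: st..].
have onto w : exists w', w = (g - \1%VF) w' by exists (((g - \1%VF)^-1)%VF w); rewrite lker0_lfunVK.
move=> u v; have [{}u ->] := onto u; have [{}v ->] := onto v; rewrite !lker0_lfunK //.
rewrite !add_lfunE !opp_lfunE !id_lfunE !linearBr /= !linearBl /= ig.
ring.
Qed.

Lemma cayley_Hstab y : cayley y -> lker y == 0%VS -> Hstab B U W S (\1%VF + (y^-1)%VF).
Proof.
move=> [yB yU yW yS] ky.
have st (X : {vspace V}) : (forall u, u \in X -> y u \in X) ->
    forall u, u \in X -> (\1%VF + (y^-1)%VF : 'End(V)) u \in X.
  by move=> yX u uX; rewrite add_lfunE id_lfunE rpredD // stable_inv.
apply/HstabP; split; [|exact: st..].
have onto w : exists w', w = y w' by exists ((y^-1)%VF w); rewrite lker0_lfunVK.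
move=> u v; have [{}u ->] := onto u; have [{}v ->] := onto v.
rewrite !add_lfunE !id_lfunE !lker0_lfunK //.
have := yB u v; rewrite !linearDl /= !linearDr /= => h.
rewrite -[RHS]addr0 -[X in _ = _ + X](addNr (B u v)) -h; ring.
Qed.

Lemma HstabM g h : Hstab B U W S g -> Hstab B U W S h -> Hstab B U W S (g \o h)%VF.
Proof.
move=> /HstabP[ig gU gW gS] /HstabP[ih hU hW hS]; apply/HstabP; split.
- by move=> u v; rewrite !comp_lfunE ig ih.
- by move=> u uU; rewrite comp_lfunE gU ?hU.
- by move=> u uU; rewrite comp_lfunE gW ?hW.
- by move=> u uU; rewrite comp_lfunE gS ?hS.
Qed.

Lemma HstabV g : Hstab B U W S g -> lker g == 0%VS /\ Hstab B U W S (g^-1)%VF.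
Proof.
move=> /HstabP[ig gU gW gS]; have kg := isometry_lker0 ndB ig; split=> //.
by apply/HstabP; split; [exact: isometry_inv|exact: stable_inv..].
Qed.

Lemma cayley_affine y : cayley y -> forall y', cayley y' <-> stab_skew B U W S (y' - y).
Proof.
have st (X : {vspace V}) : (forall u, u \in X -> y u \in X) -> forall y' : 'End(V),
    (forall u, u \in X -> y' u \in X) <-> (forall u, u \in X -> (y' - y) u \in X).
  move=> yX y'; split=> y'X u uX.
    by rewrite add_lfunE opp_lfunE rpredB ?yX ?y'X.
  by have := y'X u uX; rewrite add_lfunE opp_lfunE => /rpredD/(_ (yX u uX)); rewrite subrK.
move=> [yB yU yW yS] y'; split=> -[y'B /(st _ yU y') y'U /(st _ yW y') y'W /(st _ yS y') y'S]; split=> //.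
  move=> u v; rewrite !add_lfunE !opp_lfunE !linearBr /= !linearBl /=.
  by rewrite addrACA -opprD y'B yB subrr.
move=> u v; have := y'B u v; rewrite !add_lfunE !opp_lfunE !linearBr /= !linearBl /=.
by rewrite addrACA -opprD yB opprK => /eqP; rewrite addr_eq0 => /eqP.
Qed.

End Cayley.

(** Coordinates on the scalars allowed on the diagonal of a skew matrix: all of F for symplectic
    forms, only 0 for symmetric ones outside characteristic 2, the imaginary numbers for Hermitian
    ones. *)
Record skew_coordinates (F K : fieldType) (iota : {rmorphism F -> K}) (eps : bool)
    (theta : {rmorphism K -> K}) := SkewCoordinates {
  skdim : nat;
  skfun : K -> 'I_skdim -> F;
  skvec : ('I_skdim -> F) -> K;
  skfunD : forall x y i, skfun (x + y) i = skfun x i + skfun y i;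
  skfunZ : forall a x i, skfun (iota a * x) i = a * skfun x i;
  skvec_skew : forall v, skvec v = - (-1) ^+ eps * theta (skvec v);
  skvecK : forall v i, skfun (skvec v) i = v i;
  skfun_inj : forall x, x = - (-1) ^+ eps * theta x -> (forall i, skfun x i = 0) -> x = 0
}.

Lemma card_strict_sym (I : finType) (P : rel I) : (forall i j, P i j = P j i) ->
  (2 * #|[pred p : I * I | (enum_rank p.1 < enum_rank p.2)%N && P p.1 p.2]|
     + #|[pred i | P i i]| = \sum_i \sum_j P i j)%N.
Proof.
move=> symP.
have cE (Q : rel I) : #|[pred p : I * I | Q p.1 p.2]| = (\sum_i \sum_j Q i j)%N.
  by rewrite pair_bigA -sum1_card big_mkcond /=; apply: eq_bigr => -[i j] _; rewrite !inE /=; case: (Q i j).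
have dE : #|[pred i | P i i]| = (\sum_i \sum_j (i == j) && P i j)%N.
  rewrite -sum1_card big_mkcond; apply: eq_bigr => i _; rewrite (bigD1 i) //= eqxx big1 ?addn0.
    by rewrite inE; case: (P i i).
  by move=> j; rewrite eq_sym => /negPf ->.
rewrite (cE (fun i j => (enum_rank i < enum_rank j)%N && P i j)) dE mul2n -addnn.
rewrite [X in (X + _ + _)%N]exchange_big -!big_split; apply: eq_bigr => i _.
rewrite -!big_split; apply: eq_bigr => j _ /=; rewrite symP.
case: (P i j); rewrite ?andbF ?andbT //.
case: (ltngtP (enum_rank i) (enum_rank j)) => [ij|ij|/ord_inj/enum_rank_inj ->] /=.
- by case: eqVneq ij => [->|//]; rewrite ltnn.
- by case: eqVneq ij => [->|//]; rewrite ltnn.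
by rewrite eqxx.
Qed.

(** * Counting the dimension of the stabilizer *)

Section StabilizerDimension.
Variables (F K : fieldType) (iota : {rmorphism F -> K}).
Hypothesis Finf : forall l : seq F, exists x, x \notin l.
Variables (eps : bool) (theta : {rmorphism K -> K}).
Hypothesis thetaK : involutive theta.
Hypothesis theta_iota : forall x, theta (iota x) = iota x.
Variables (cK : coordinates iota K^o) (sk : skew_coordinates iota eps theta).
Variables (V : vectType K) (B : {hermitian V for eps & theta}).
Hypothesis ndB : nondegenerate B.
Variables (TT : Type) (J : TT -> forall n, 'I_n -> 'I_n -> K).
Arguments J : clear implicits.
Variables (tau : K) (scale : TT -> forall n, 'I_n -> K).
Arguments scale : clear implicits.
Hypothesis tau01 : tau != 0 /\ tau != 1.
Hypothesis scale1 : forall t n i, scale t n i != 1.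
Hypothesis scaleJ : forall t n i j, scale t n i * theta (scale t n j) * J t n i j = J t n i j.
Variables (U W : {vspace V}).
Hypothesis UW : orthodecomp B U W.
Variables (S : {vspace V}) (r r' a b c c' : nat) (t tU tW : TT).
Variables (e : frame_index r a b c -> V) (f : frame_index r' a b c' -> V).
Hypothesis NF : normal_frame B J U W t tU tW S e f.
Local Notation E := (frame_vec e f).
Local Notation index := (frame_index r a b c + frame_index r' a b c')%type.

(** Eigenvalues of an element of the stabilizer that is diagonal in the frame: tau on the isotropic
    vectors, theta(tau)^-1 on their duals, a diagonal isometry on the standard blocks. U and W get
    the same values at a and b, so the vectors u + w of S are eigenvectors. *)
Definition frame_scale r1 c1 (t1 : TT) (i : frame_index r1 a b c1) : K :=
  match i with
  | inl i => scale t b i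
  | inr (inl (inl _)) => tau
  | inr (inl (inr _)) => theta tau^-1
  | inr (inr i) => scale t1 c1 i
  end.

Lemma frame_scale_gram r1 c1 t1 s (i j : frame_index r1 a b c1) :
  frame_scale t1 i * theta (frame_scale t1 j) * frame_gram eps J s t t1 i j =
  frame_gram eps J s t t1 i j.
Proof.
have [t0 _] := tau01.
by elim/frame_index_ind: i => i; elim/frame_index_ind: j => j /=;
  rewrite ?mulr0 // ?scaleJ // ?thetaK ?(mulrCA _ s) ?scaleJ //
   ?mulfV ?mul1r // -rmorphM mulVf ?rmorph1 ?mul1r.
Qed.

Lemma frame_scale_neq1 r1 c1 t1 (i : frame_index r1 a b c1) : frame_scale t1 i != 1.
Proof.
have [t0 t1'] := tau01.
have tV1 : theta tau^-1 != 1.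
  by rewrite -(rmorph1 theta) (inj_eq (can_inj thetaK)) invr_eq1.
by elim/frame_index_ind: i => i /=.
Qed.

Lemma Hstab_no_fixed_vector : exists g0, Hstab B U W S g0 /\ lker (g0 - \1%VF) == 0%VS.
Proof.
have [fE sE] := frame_basis UW NF.
pose d (i : index) := match i with inl i => frame_scale tU i | inr i => frame_scale tW i end.
have [g gE] := fbasis_lfun (fun i => d i *: E i) fE.
have SE : S = fspan (isotropic_family e f) by case: NF.
have [[[_ eU] [_ fW]] _ _ _] := NF.
have geE i : g (e i) = frame_scale tU i *: e i by exact: (gE (inl i)).
have gfE i : g (f i) = frame_scale tW i *: f i by exact: (gE (inr i)).
have gsum (I : finType) (k : I -> K) h : g (\sum_i k i *: h i) = \sum_i k i *: g (h i).
  by rewrite linear_sum; apply: eq_bigr => i _; rewrite linearZ.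
exists g; split.
  apply/(HstabP ndB UW); split.
  - apply: (isometry_on_basis (conj fE sE)) => i j; rewrite !gE linearZl_LR /= linearZ /= mulrA.
    case: i => i; case: j => j /=; rewrite ?(frame_cross UW NF _ _).1 ?(frame_cross UW NF _ _).2
      ?mulr0 // ?(gramU NF) ?(gramW NF); exact: frame_scale_gram.
  - rewrite -eU => u /fspanP[k ->]; rewrite gsum; apply: rpred_sum => i _.
    by rewrite geE !rpredZ // mem_fspan.
  - rewrite -fW => u /fspanP[k ->]; rewrite gsum; apply: rpred_sum => i _.
    by rewrite gfE !rpredZ // mem_fspan.
  - rewrite SE => u /fspanP[k ->]; rewrite gsum; apply: rpred_sum => i _; apply: rpredZ.
    have [l -> ] : exists l, g (isotropic_family e f i) = l *: isotropic_family e f i.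
      rewrite /isotropic_family /frame_r /frame_a /frame_b.
      by case: i => i; case: i => i /=; rewrite ?linearD /= ?geE ?gfE /= -?scalerDr;
        eexists; reflexivity.
    by rewrite rpredZ // mem_fspan.
rewrite -subv0; apply/subvP => v; rewrite memv_ker memv0 add_lfunE opp_lfunE id_lfunE subr_eq0.
have /fspanP[k ->] : v \in fspan E by rewrite sE memvf.
rewrite gsum -subr_eq0 -sumrB; under eq_bigr => i _ do rewrite gE scalerA -scalerBl -{2}[k i]mulr1 -mulrBr.
move=> /eqP /fE k0; rewrite big1 // => i _; have /eqP := k0 i.
rewrite mulf_eq0 subr_eq0 => /orP[/eqP ->|]; first by rewrite scale0r.
by rewrite /d; case: i => i; rewrite (negPf (frame_scale_neq1 _ _)).
Qed.

Lemma stab_skew_lin x y k : stab_skew B U W S x -> stab_skew B U W S y ->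
  stab_skew B U W S (x + iota k *: y).
Proof.
move=> [xB xU xW xS] [yB yU yW yS]; split.
- move=> u v; rewrite !add_lfunE !scale_lfunE linearDl /= linearZl_LR linearD /= linearZ /=.
  by rewrite theta_iota addrACA xB add0r -mulrDr yB mulr0.
- by move=> u uU; rewrite add_lfunE scale_lfunE rpredD ?rpredZ ?xU ?yU.
- by move=> u uU; rewrite add_lfunE scale_lfunE rpredD ?rpredZ ?xW ?yW.
- by move=> u uU; rewrite add_lfunE scale_lfunE rpredD ?rpredZ ?xS ?yS.
Qed.

Definition strict_free (p : index * index) : bool :=
  (enum_rank p.1 < enum_rank p.2)%N && free_entry p.1 p.2.

Definition diag_free (i : index) : bool := free_entry i i.

(** An entry above the diagonal, in the order of [enum_rank], has all the coordinates of a scalar;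
    an entry on the diagonal only those of a skew scalar. *)
Definition Lie_fun (j : {p | strict_free p} * 'I_(csize cK) + {i | diag_free i} * 'I_(skdim sk))
    (x : 'End(V)) : F :=
  match j with
  | inl (p, k) => cfun (c := cK) (frame_form B e f x (sval p).1 (sval p).2) k
  | inr (i, k) => @skfun _ _ _ _ _ sk (frame_form B e f x (sval i) (sval i)) k
  end.

Lemma Lie_fun_linear j : flinear iota (Lie_fun j).
Proof.
have fD x y i i' : frame_form B e f (x + y) i i' = frame_form B e f x i i' + frame_form B e f y i i'.
  by rewrite /frame_form add_lfunE linearDl.
have fZ k x i i' : frame_form B e f (iota k *: x) i i' = iota k * frame_form B e f x i i'.
  by rewrite /frame_form scale_lfunE linearZl_LR.
case: j => -[i k]; split=> *; rewrite /Lie_fun ?fD ?fZ.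
- exact: cfunD.
- exact: (cfunZ (c := cK)).
- exact: skfunD.
- exact: skfunZ.
Qed.

Lemma Lie_fun_inj x : stab_skew B U W S x -> (forall j, Lie_fun j x = 0) -> x = 0.
Proof.
move=> /(frame_formP ndB UW NF) fs x0; apply: (frame_form_inj ndB UW NF).
apply: (framed_skew0 fs) => i j ij.
have strict i' j' : free_entry i' j' -> (enum_rank i' < enum_rank j')%N -> frame_form B e f x i' j' = 0.
  move=> fij lij; have sij : strict_free (i', j') by rewrite /strict_free /= lij.
  rewrite (cfunE cK (frame_form B e f x i' j' : K^o)) big1 // => k _.
  by rewrite [cfun _ _](x0 (inl (exist _ (i', j') sij, k))) rmorph0 scale0r.
case: (ltngtP (enum_rank i) (enum_rank j)) => [lij|lij|/ord_inj/enum_rank_inj eij].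
- exact: strict.
- by rewrite fs.1 strict ?rmorph0 ?mulr0 // free_sym.
rewrite -{j}eij in ij *; apply: (skfun_inj (s := sk)); first exact: fs.1.
by move=> k; exact: (x0 (inr (exist _ i ij, k))).
Qed.

Lemma Lie_fun_surj v : exists2 x, stab_skew B U W S x & forall j, Lie_fun j x = v j.
Proof.
(* [up] holds the prescribed entries above the diagonal and [dg] those on it; p is their skew
   completion, to which [mix] adds the repeated entries. *)
pose up i j : K := if insub (i, j) is Some p
  then \sum_k iota (v (inl (p, k))) *: (cvec (c := cK) k : K^o) else 0.
pose dg i : K := if insub i is Some i' then skvec (s := sk) (fun k => v (inr (i', k))) else 0.
pose p i j := if i == j then dg i else up i j - (-1) ^+ eps * theta (up j i).
have up0 i j : ~~ strict_free (i, j) -> up i j = 0 by move=> ij; rewrite /up insubN.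
have skp i j : p i j = - (-1) ^+ eps * theta (p j i).
  rewrite /p [j == i]eq_sym; case: eqVneq => [<-|_].
    rewrite /dg; case: insub => [i'|]; first exact: skvec_skew.
    by rewrite rmorph0 mulr0.
  by rewrite -!mulNr rmorphD mulrDr /= skew_twice // addrC.
have p0 i j : ~~ free_entry i j -> p i j = 0.
  move=> ij; rewrite /p; case: eqVneq => [eij|_].
    by rewrite /dg insubN // /diag_free {2}eij.
  by rewrite !up0 ?rmorph0 ?mulr0 ?subr0 // /strict_free /= ?(free_sym j) (negPf ij) andbF.
have [fq qE] := framed_skew_ext skp p0.
have [x xE] := frame_form_surj thetaK ndB UW NF (fun i j => p i j + mix p i j).
have xq : frame_form B e f x = fun i j => p i j + mix p i j.
  by apply/funext => i; apply/funext => j.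
exists x; first by apply/(frame_formP ndB UW NF); rewrite xq.
case=> -[[i si] k] /=; rewrite xq.
  case: i si => i j sij /=; have [lij fij] := andP sij.
  have nij : i != j by apply: contraTneq lij => ->; rewrite ltnn.
  rewrite qE // /p (negPf nij) [up j i]up0 ?rmorph0 ?mulr0 ?subr0; last first.
    by rewrite /strict_free /= ltnNge (ltnW lij).
  rewrite /up insubT /= cfun_sum; congr (v (inl (_, k))); exact: val_inj.
rewrite qE // /p eqxx /dg insubT skvecK.
by congr (v (inr (_, k))); exact: val_inj.
Qed.

(** The two brackets count the free entries on U and on W as ordered pairs, of which r + r' + 2a + b
    + c + c' are diagonal; doubling and moving one term to the left avoid division and
    subtraction. *)
Lemma Lie_count (d d' : nat) :
  (2 * (#|{: {p | strict_free p}}| * d + #|{: {i | diag_free i}}| * d') + d * (r + r' + 2 * a + b + c + c')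
   = d * ((3 * r * r + 4 * r * a + 2 * r * b + 2 * r * c + 3 * a * a + 2 * a * b + 2 * a * c + b * b + c * c)
      + (3 * r' * r' + 4 * r' * a + 2 * r' * b + 2 * r' * c' + 2 * a * c' + a * a + c' * c'))
     + 2 * d' * (r + r' + 2 * a + b + c + c'))%N.
Proof.
have sumc n (m : nat) : (\sum_(i < n) m = n * m)%N by rewrite sum_nat_const card_ord.
have dE : #|{: {i | diag_free i}}| = (r + r' + 2 * a + b + c + c')%N.
  rewrite card_sig -sum1_card big_mkcond !big_sumType /= /diag_free /= !sumc.
  ring.
have := card_strict_sym (@free_sym r r' a b c c').
have -> : (\sum_(i : index) \sum_j free_entry i j = (3 * r * r + 4 * r * a + 2 * r * b + 2 * r * c + 3 * a * a + 2 * a * b + 2 * a * c + b * b + c * c)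
      + (3 * r' * r' + 4 * r' * a + 2 * r' * b + 2 * r' * c' + 2 * a * c' + a * a + c' * c'))%N.
  under eq_bigr => i _ do rewrite !big_sumType /=.
  rewrite !big_sumType /= !sumc.
  ring.
have strictE : #|{: {p | strict_free p}}| = #|[pred p : index * index | (enum_rank p.1 < enum_rank p.2)%N & free_entry p.1 p.2]|.
  by rewrite card_sig; apply: eq_card.
have diagE : #|{: {i | diag_free i}}| = #|[pred i : index | free_entry i i]|.
  by rewrite card_sig; apply: eq_card.
rewrite -strictE -diagE dE; move: #|_| => N; set N2 := (X in _ = X -> _); set N1 := (r + _ + _ + _ + _ + _)%N.
move=> h; transitivity (d * N2 + 2 * d' * N1)%N => //; rewrite -h; ring.
Qed.

Theorem zdim_Hstab (c1 : coordinates iota V) (ce : coordinates iota 'End(V)) :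
  let d := csize cK in let d' := skdim sk in let n1 := (r + r' + 2 * a + b + c + c')%N in
  (2 * zdim (cfun (c := ce) @` Hstab B U W S) + d * n1
   = d * ((3 * r * r + 4 * r * a + 2 * r * b + 2 * r * c + 3 * a * a + 2 * a * b + 2 * a * c + b * b + c * c)
      + (3 * r' * r' + 4 * r' * a + 2 * r' * b + 2 * r' * c' + 2 * a * c' + a * a + c' * c'))
     + 2 * d' * n1)%N.
Proof.
move=> d d' n1.
have /= -> := zdim_End_group Finf c1 ce (Hstab_cayley ndB UW (S := S)) (cayley_Hstab ndB UW (S := S))
  (HstabM ndB UW (S := S)) (HstabV ndB UW (S := S)) Hstab_no_fixed_vector
  (cayley_affine (B := B) (U := U) (W := W) (S := S)) stab_skew_lin Lie_fun_linear Lie_fun_inj Lie_fun_surj.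
by rewrite card_sum !card_prod !card_ord Lie_count.
Qed.

End StabilizerDimension.

(** * The dimension formula *)

Section DimensionFormula.
Variables (F K : fieldType) (iota : {rmorphism F -> K}).
Hypothesis Finf : forall l : seq F, exists x, x \notin l.
Variables (eps : bool) (theta : {rmorphism K -> K}).
Hypothesis thetaK : involutive theta.
Hypothesis theta_iota : forall x, theta (iota x) = iota x.
Variables (delta : nat) (cs : forall E : vectType K, coordinates iota E).
Hypothesis csE : forall E : vectType K, csize (cs E) = (delta * \dim {:E})%N.
Variable sk : skew_coordinates iota eps theta.
Variables (TT : Type) (J : TT -> forall n, 'I_n -> 'I_n -> K).
Arguments J : clear implicits.
Variables (tau : K) (scale : TT -> forall n, 'I_n -> K).
Arguments scale : clear implicits.
Hypothesis tau01 : tau != 0 /\ tau != 1.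
Hypothesis scale1 : forall t n i, scale t n i != 1.
Hypothesis scaleJ : forall t n i j, scale t n i * theta (scale t n j) * J t n i j = J t n i j.
Variable good : forall V : vectType K, {hermitian V for eps & theta} -> Prop.
Hypothesis good_res : forall (V : vectType K) (B : {hermitian V for eps & theta}) (X : {vspace V}), good B ->
  good (resform B (X := X) : {hermitian (subvs_of X) for eps & theta}).
Hypothesis good_half : forall (V : vectType K) (B : {hermitian V for eps & theta}), good B ->
  forall (I : finType) (y : I -> V), exists h : I -> I -> K,
  forall i j, B (y i) (y j) = h i j + (-1) ^+ eps * theta (h j i).
Hypothesis good_basis : forall (V : vectType K) (B : {hermitian V for eps & theta}), good B ->
  forall X : {vspace V}, ndeg B X -> exists t (e : 'I_(\dim X) -> V), fbasis X e /\
  forall i j, B (e i) (e j) = J t _ i j.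

Definition gdim (E : vectType K) (A : set E) : nat := zdim (cfun (c := cs E) @` A).

Lemma csize_field : csize (cs K^o) = delta.
Proof. by rewrite csE dimvf /dim /= muln1. Qed.

Lemma nondegenerateP (V : vectType K) (B : {hermitian V for eps & theta}) :
  (forall v, (forall u, B v u = 0) -> v = 0) -> nondegenerate B.
Proof.
move=> nB; rewrite /nondegenerate -subv0; apply/subvP => v; rewrite memv0 => /mem_orthovP v0.
by apply/eqP/nB => u; apply: v0; exact: memvf.
Qed.

Section Space.
Variables (V : vectType K) (B : {hermitian V for eps & theta}).
Hypothesis gB : good B.

(** The stabilizer of S = 0 for the decomposition of X as X and 0 is all of G(X); in the count c =
    dim X is then the only nonzero block size. *)
Lemma dim_isogv X : ndeg B X ->
  (2 * gdim (isogv B X) + delta * \dim X = delta * (\dim X * \dim X) + 2 * skdim sk * \dim X)%N.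
Proof.
move=> /ndegP nX; pose BX : {hermitian (subvs_of X) for eps & theta} := resform B (X := X).
have ndX : nondegenerate BX.
  apply: nondegenerateP => v v0; suff v00 : vsval v = 0 by apply: val_inj; rewrite /= v00.
  apply: nX; first exact: subvsP.
  by move=> u uX; have := v0 (vsproj X u); rewrite /BX /= /resform vsprojK.
have dec : orthodecomp BX fullv 0.
  split; [by rewrite addv0|by rewrite capv0|].
  by apply/orthovP => u w _; rewrite memv0 => /eqP ->; rewrite linear0r.
have iso0 : isotropic BX 0 by exact: sub0v.
have [c [c' [t [tU [tW [e [f NF]]]]]]] := normal_frame_exists thetaK (good_half (good_res X gB))
  (good_basis (good_res X gB)) ndX dec iso0.
have P0 : Proj fullv 0 0 = 0%VS :> {vspace subvs_of X} by rewrite /Proj addv0 cap0v.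
have r0 : inv_r fullv (0 : {vspace subvs_of X}) = 0%N by rewrite /inv_r cap0v dimv0.
have r0' : inv_r (0 : {vspace subvs_of X}) 0 = 0%N by rewrite /inv_r cap0v dimv0.
have a0 : inv_a BX fullv 0 0 = 0%N by rewrite /inv_a dim_quo P0 /Rad !cap0v dimv0.
have b0 : inv_b BX fullv 0 0 = 0%N by rewrite /inv_b dim_quo P0 cap0v dimv0.
have := zdim_Hstab Finf thetaK theta_iota (cs K^o) sk ndX tau01 scale1 scaleJ dec NF (cs _) (cs _).
have [[bU bW] _ _ _] := NF.
have := fbasis_card bU; have := fbasis_card bW; rewrite !card_sum !card_ord dimv0 dimvf /dim /=.
rewrite r0 r0' a0 b0 csize_field => c'0 cX.
have -> : Hstab BX fullv 0 0 = isogv B X.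
  apply/seteqP; split=> g; first by move=> /(HstabP ndX dec)[].
  move=> ig; apply/(HstabP ndX dec); split=> // [u _|u|u]; first exact: memvf.
  - by rewrite memv0 => /eqP ->; rewrite linear0 mem0v.
  - by rewrite memv0 => /eqP ->; rewrite linear0 mem0v.
rewrite -/(gdim (isogv B X)); nia.
Qed.

Lemma dim_GLv (X : {vspace V}) : gdim (@GLv K V X) = (delta * (\dim X * \dim X))%N.
Proof. by rewrite /gdim (zdim_GL Finf (cs _)) csE dimvf. Qed.

Lemma dim_Hom (X Y : {vspace V}) :
  gdim [set: 'Hom(subvs_of X, subvs_of Y)] = (delta * (\dim X * \dim Y))%N.
Proof. by rewrite /gdim (zdim_setT Finf) csE dimvf. Qed.

Lemma ndeg_quo (X Y : {vspace V}) : (Y <= X)%VS ->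
  (forall v, v \in X -> (forall x, x \in X -> B v x = 0) -> v \in Y) ->
  (forall x y, x \in X -> y \in Y -> B x y = 0) -> ndeg B (quo X Y).
Proof.
move=> YX radY perpY; apply/ndegP => v vQ v0; have vX : v \in X by apply: (subvP (diffvSl X Y)).
apply/eqP; rewrite -memv0 -(capv_diff X Y) memv_cap vQ /=; apply: radY => // x xX.
have : x \in (quo X Y + Y)%VS by rewrite /quo addv_diff; apply: (subvP (addvSl _ _)).
by move=> /memv_addP[q qQ [y yY ->]]; rewrite linearDr /= v0 // perpY // addr0.
Qed.

Variables (U W : {vspace V}).
Hypothesis UW : orthodecomp B U W.
Hypothesis ndB : nondegenerate B.
Variable S : {vspace V}.
Hypothesis isoS : isotropic B S.

Lemma ndeg_perp_Rad : ndeg B (quo (orthov B (Rad B (Proj U W S)) :&: U) (Rad B (Proj U W S))).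
Proof.
set P := Proj U W S.
have RU : (Rad B P <= U)%VS by apply: subv_trans (capvSl _ _) (capvSr _ _).
apply: ndeg_quo => [|v /memv_capP[_ vU] v0|x y /memv_capP[/mem_orthovP xR _]].
- rewrite subv_cap RU andbT; apply/subvP => v; rewrite memv_cap => /andP[vP vP'].
  apply/mem_orthovP => x; rewrite memv_cap => /andP[xP _].
  by move/mem_orthovP: vP'; apply.
- rewrite -(orthov_capK thetaK (ndeg_orthodecomp ndB UW) RU) memv_cap vU andbT.
  exact/mem_orthovP.
- exact: xR.
Qed.

Lemma ndeg_perp : ndeg B (quo (orthov B (Proj U W S) :&: U) (Rad B (Proj U W S))).
Proof.
set P := Proj U W S; have PU : (P <= U)%VS by exact: capvSr.
apply: ndeg_quo => [|v /memv_capP[vP vU] v0|x y /memv_capP[/mem_orthovP xP _]].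
- by rewrite subv_cap capvSr /=; apply: subv_trans (capvSl _ _) PU.
- rewrite memv_cap vP andbT -(orthov_capK thetaK (ndeg_orthodecomp ndB UW) PU) memv_cap vU andbT.
  exact/mem_orthovP.
- by move=> /memv_capP[yP _]; apply: xP.
Qed.

Lemma ndeg_Proj : ndeg B (quo (Proj U W S) (Rad B (Proj U W S))).
Proof.
apply: ndeg_quo => [|v vP v0|x y xP]; first exact: capvSl.
  by rewrite memv_cap vP; apply/mem_orthovP.
by rewrite memv_cap => /andP[_ /mem_orthovP yP]; apply/herm_sym0/yP.
Qed.

Lemma dim_quo_perp_Rad : \dim (quo (orthov B (Rad B (Proj U W S)) :&: U) (Rad B (Proj U W S)))
  = (\dim U - 2 * (inv_r U S + inv_a B U W S))%N.
Proof.
have RU : (Rad B (Proj U W S) <= U)%VS by apply: subv_trans (capvSl _ _) (capvSr _ _).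
have sub : (Rad B (Proj U W S) <= orthov B (Rad B (Proj U W S)) :&: U)%VS.
  rewrite subv_cap RU andbT; apply/subvP => v; rewrite memv_cap => /andP[vP vP'].
  apply/mem_orthovP => x; rewrite memv_cap => /andP[xP _].
  by move/mem_orthovP: vP'; apply.
rewrite dim_quo (capv_idPr sub).
by rewrite dim_perp_Rad // dim_Rad_Proj //; clear; lia.
Qed.

Lemma dim_quo_perp : \dim (quo (orthov B (Proj U W S) :&: U) (Rad B (Proj U W S)))
  = (\dim U - 2 * (inv_r U S + inv_a B U W S) - inv_b B U W S)%N.
Proof.
have PU : (Proj U W S <= U)%VS by exact: capvSr.
have sub : (Rad B (Proj U W S) <= orthov B (Proj U W S) :&: U)%VS.
  by rewrite subv_cap capvSr /=; apply: subv_trans (capvSl _ _) PU.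
rewrite dim_quo (capv_idPr sub).
have := dim_orthov_cap thetaK (ndeg_orthodecomp ndB UW) PU.
by rewrite dim_Rad_Proj // (dim_Proj_inv UW isoS); clear; lia.
Qed.

End Space.

Theorem Hstab_dim_formula_holds (V : vectType K) (B : {hermitian V for eps & theta}) U W S :
  good B -> nondegenerate B -> orthodecomp B U W -> isotropic B S ->
  Hstab_dim_formula B gdim U W S.
Proof.
move=> gB ndB UW isoS; have WU := orthodecomp_sym UW; rewrite /Hstab_dim_formula.
have := dim_isogv gB (ndeg_orthodecomp ndB UW).
have := dim_isogv gB (ndeg_orthodecomp ndB WU).
have := dim_isogv gB (ndeg_perp_Rad UW ndB S); have := dim_isogv gB (ndeg_perp_Rad WU ndB S).
have := dim_isogv gB (ndeg_perp UW ndB S); have := dim_isogv gB (ndeg_perp WU ndB S).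
have := dim_isogv gB (ndeg_Proj B U W S).
rewrite !dim_quo_perp_Rad // !dim_quo_perp // !dim_GLv dim_Hom.
have -> : inv_a B W U S = inv_a B U W S by exact: inv_a_sym.
have -> : inv_b B W U S = inv_b B U W S by exact: inv_b_sym.
rewrite -/(inv_b B U W S) -/(inv_a B U W S) -/(inv_r U S) -/(inv_r W S).
have [c [c' [t [tU [tW [e [f NF]]]]]]] := normal_frame_exists thetaK (good_half gB)
  (good_basis gB) ndB UW isoS.
have := zdim_Hstab Finf thetaK theta_iota (cs K^o) sk ndB tau01 scale1 scaleJ UW NF (cs _) (cs _).
have [[bU bW] _ _ _] := NF.
have := fbasis_card bU; have := fbasis_card bW; rewrite !card_sum !card_ord csize_field.
rewrite -/(gdim (Hstab B U W S)).
move: (inv_r U S) (inv_r W S) (inv_a B U W S) (inv_b B U W S) (\dim U) (\dim W) (skdim sk).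
move: (gdim _) (gdim _) (gdim _) (gdim _) (gdim _) (gdim _) (gdim _) (gdim _).
move=> g0 g1 g2 g3 g4 g5 g6 g7 {e f NF bU bW} r r' a b u w d' <- <- /=.
have -> : (b + (r' + a + (r' + a) + c') - 2 * (r' + a) = b + c')%N by lia.
have -> : (b + (r + a + (r + a) + c) - 2 * (r + a) = b + c)%N by lia.
rewrite !addKn.
(* The eight doubled counts, seven for isometry groups and one for the stabilizer, are linear in the
   dimensions, with products of block sizes as atoms; the formula is a rational combination of
   them. *)
do 8 (move=> /(congr1 (fun n => n%:R : rat)); rewrite !natrD !natrM => ?); lra.

Qed.
End DimensionFormula.

(** * Standard bases and real coordinates *)

Lemma fbasis_reindex (K : fieldType) (V : vectType K) (X : {vspace V}) (I I' : finType)
    (e : I -> V) (h : I' -> I) : bijective h -> fbasis X e -> fbasis X (e \o h).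
Proof.
move=> [g hK gK] [fe eX]; split.
  move=> k k0 i; rewrite -(hK i); apply: (fe (k \o g)).
  by rewrite (reindex h) /=; [rewrite -[RHS]k0; apply: eq_bigr => j _; rewrite /= hK|exists g => *].
by rewrite -eX /fspan [RHS](reindex h) //; exists g => *.
Qed.

Lemma split_bij m n : bijective (@fintype.split m n).
Proof. by exists (@unsplit m n); [exact: splitK|exact: unsplitK]. Qed.

Section StandardBases.
Variables (K : fieldType) (eps : bool) (theta : {rmorphism K -> K}).
Variables (V : vectType K) (B : {hermitian V for eps & theta}).

Lemma orthogonal_extension X m (f d : 'I_m -> V) : ndeg B X -> (forall i, f i \in X) ->
  dual_pair B f d -> exists Y : {vspace V}, [/\ ndeg B Y, (Y <= X)%VS,
    (m + \dim Y)%N = \dim X,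
    forall i y, y \in Y -> B (f i) y = 0 /\ B y (f i) = 0 &
    forall (g : 'I_(\dim Y) -> V), fbasis Y g -> fbasis X (sumf f g)].
Proof.
move=> nX fX fd; have [nY bY] := dual_pair_split nX fX fd.
exists (X :&: orthov B (fspan f))%VS; split=> //; [exact: capvSl| | |by move=> g; exact: bY].
  have [g bg] := fbasis_exists (X :&: orthov B (fspan f))%VS.
  by have := fbasis_card (bY _ _ bg); rewrite card_sum !card_ord.
move=> i y /memv_capP[_ /mem_orthovP y0]; have yf : B y (f i) = 0 by apply: y0; exact: mem_fspan.
by split=> //; exact: herm_sym0.
Qed.

Lemma ndeg_nonzero X : ndeg B X -> X != 0%VS -> exists u v, [/\ u \in X, v \in X & B u v = 1].
Proof.
move=> /ndegP nX X0; have uX := memv_pick X; have u0 : vpick X != 0 by rewrite vpick0.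
have [[v [vX uv]]|none] := pselect (exists v, v \in X /\ B (vpick X) v != 0).
  exists ((B (vpick X) v)^-1 *: vpick X), v; split=> //; first exact: rpredZ.
  by rewrite linearZl_LR mulVf.
case/eqP: u0; apply: nX => // v vX; apply/eqP; apply: contrapT => /negP uv.
by apply: none; exists v.
Qed.

Lemma spanned0 n X (e : 'I_n -> V) : \dim X = 0%N -> n = 0%N -> fbasis X e.
Proof.
move=> /eqP; rewrite dimv_eq0 => /eqP -> n0; subst n.
by split=> [c _ []//|]; rewrite /fspan big_ord0.
Qed.

End StandardBases.

(** Blocks with rows 0, 1 and -1, 0 on the consecutive positions 2k and 2k + 1. *)
Definition alternating_gram (K : fieldType) n (i j : 'I_n) : K :=
  if ~~ odd i && (j == i.+1 :> nat) then 1
  else if ~~ odd j && (i == j.+1 :> nat) then -1 else 0.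

(** A nonzero nondegenerate X contains u, v with B(u, v) = 1; their plane is split off, and the
    positions in its complement shift by two, which keeps parities. *)
Lemma alternating_basis (K : fieldType) (V : vectType K) (B : {skew_symmetric V}) (X : {vspace V}) :
  (forall v, B v v = 0) -> ndeg B X ->
  exists e : 'I_(\dim X) -> V, fbasis X e /\ forall i j, B (e i) (e j) = alternating_gram K i j.
Proof.
move=> B0 nX; have skB u v : B u v = - B v u by rewrite hermC expr1 mulN1r.
suff: forall n (X : {vspace V}), (\dim X <= n)%N -> ndeg B X -> exists e : 'I_(\dim X) -> V,
    fbasis X e /\ forall i j, B (e i) (e j) = alternating_gram K i j by apply.
elim=> [|n IHn] {nX}X Xn nX.
  have X0 : \dim X = 0%N by apply/eqP; rewrite -leqn0.
  exists (fun=> 0); split; first exact: spanned0.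
  by case=> i i0 j; exfalso; move: i0; rewrite X0.
have [X0|X0] := eqVneq X 0%VS.
  have d0 : \dim X = 0%N by rewrite X0 dimv0.
  exists (fun=> 0); split; first exact: spanned0.
  by case=> i i0 j; exfalso; move: i0; rewrite d0.
have [u [v [uX vX uv]]] := ndeg_nonzero nX X0.
have vu : B v u = -1 by rewrite skB uv.
pose f (i : 'I_2) := if i == ord0 then u else v.
pose d (i : 'I_2) := if i == ord0 then v else - u.
have fd : dual_pair B f d.
  split=> [i j|w wd i].
    rewrite /f /d; case: i => [[|[|//]] ?]; case: j => [[|[|//]] ?] //=;
      by rewrite ?linearNr /= ?B0 ?uv ?vu ?oppr0 ?opprK.
  rewrite /f; case: ifP => _; last exact: (wd ord0).
  by apply/eqP; rewrite -oppr_eq0 -linearNr; apply/eqP; exact: (wd ord_max).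
have fX i : f i \in X by rewrite /f; case: ifP.
have [Y [nY YX dY fY bY]] := orthogonal_extension nX fX fd.
have [|e [be eE]] := IHn Y _ nY; first by move: Xn; rewrite -dY; clear; lia.
have := fbasis_reindex (split_bij 2 (\dim Y)) (bY _ be).
move: (\dim X) dY => k dY; case: k / dY => bX.
exists (sumf f e \o @fintype.split 2 (\dim Y)); split=> // i j.
have eY k : e k \in Y by rewrite -(proj2 be) mem_fspan.
rewrite -(splitK i) -(splitK j) /=; case: (fintype.split i) => {}i; case: (fintype.split j) => {}j;
  rewrite !unsplitK /=.
- rewrite /alternating_gram /f; case: i => [[|[|//]] ?]; case: j => [[|[|//]] ?] //=.
- rewrite (fY i _ (eY j)).1 /alternating_gram /= add2n /=; case: i => [[|[|//]] ?] /=; rewrite ?andbF //.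
- rewrite (fY j _ (eY i)).2 /alternating_gram /= add2n /=; case: j => [[|[|//]] ?] /=; rewrite ?andbF //.
by rewrite eE /alternating_gram /= !add2n /= !negbK !eqSS.
Qed.

Definition diagonal_gram (K : fieldType) (p n : nat) (i j : 'I_n) : K :=
  (i == j)%:R * (if (i < p)%N then 1 else -1).

Lemma swap_bij (A A' : Type) : bijective (fun x : A + A' => match x with inl a => inr a | inr a => inl a end).
Proof. by exists (fun x : A' + A => match x with inl a => inr a | inr a => inl a end); case. Qed.

(** The flag [neg] tells whether the value -1 may occur: it is false over an algebraically closed
    field, and then p is the whole dimension. *)
Lemma diagonal_basis (K : fieldType) (theta : {rmorphism K -> K}) (neg : bool) (V : vectType K)
    (B : {hermitian V for false & theta}) (X : {vspace V}) :
  (2%:R : K) != 0 ->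
  (forall x, x != 0 -> theta x = x -> exists c (s : bool),
     c * theta c * x = (-1) ^+ s /\ (s -> neg)) ->
  ndeg B X ->
  exists p (e : 'I_(\dim X) -> V), [/\ (p <= \dim X)%N, ~~ neg -> p = \dim X, fbasis X e &
    forall i j, B (e i) (e j) = diagonal_gram K p i j].
Proof.
move=> K2 normalize nX.
have symB u v : B u v = theta (B v u) by rewrite hermC expr0 mul1r.
suff: forall n (X : {vspace V}), (\dim X <= n)%N -> ndeg B X -> exists p (e : 'I_(\dim X) -> V),
    [/\ (p <= \dim X)%N, ~~ neg -> p = \dim X, fbasis X e &
    forall i j, B (e i) (e j) = diagonal_gram K p i j] by apply.
elim=> [|n IHn] {nX}X Xn nX.
  have X0 : \dim X = 0%N by apply/eqP; rewrite -leqn0.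
  exists 0%N, (fun=> 0); split=> //; first exact: spanned0.
  by case=> i i0 j; exfalso; move: i0; rewrite X0.
have [X0|X0] := eqVneq X 0%VS.
  have d0 : \dim X = 0%N by rewrite X0 dimv0.
  exists 0%N, (fun=> 0); split=> //; first exact: spanned0.
  by case=> i i0 j; exfalso; move: i0; rewrite d0.
(* Were B(z, z) = 0 throughout X, vectors with B(u, v) = 1 would give B(u + v, u + v) = 2, which is
   nonzero. *)
have [w [wX w0]] : exists w, w \in X /\ B w w != 0.
  apply: contrapT => none; have [u [v [uX vX uv]]] := ndeg_nonzero nX X0.
  have B0 z : z \in X -> B z z = 0.
    by move=> zX; apply/eqP; apply: contrapT => /negP z0; apply: none; exists z.
  have := B0 (u + v) (rpredD uX vX).
  rewrite linearDl /= !linearD /= !B0 // uv symB uv rmorph1 addr0 add0r => /eqP.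
  by rewrite -[1 + 1]/(2%:R) (negPf K2).
have [c [s [cs sneg]]] := normalize _ w0 (esym (symB w w)).
pose v := c *: w; have vv : B v v = (-1) ^+ s by rewrite linearZl_LR linearZ /= mulrA cs.
pose f (i : 'I_1) := v; pose d (i : 'I_1) := (-1) ^+ s *: v.
have fd : dual_pair B f d.
  split=> [i j|z zd i].
    by rewrite !ord1 eqxx linearZ /= vv rmorph_sign -expr2 sqrr_sign.
  have := zd i; rewrite linearZ /= rmorph_sign => /eqP.
  by rewrite mulf_eq0 signr_eq0 => /eqP.
have fX i : f i \in X by exact: rpredZ.
have [Y [nY YX dY fY bY]] := orthogonal_extension nX fX fd.
have [|p [e [pY pneg be eE]]] := IHn Y _ nY; first by move: Xn; rewrite -dY; clear; lia.
have eY k : e k \in Y by rewrite -(proj2 be) mem_fspan.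
have vv' i j : B (f i) (f j) = (-1) ^+ s by exact: vv.
case: s sneg vv vv' {cs} d fd => sneg vv vv' d fd.
  (* A vector of value -1 goes to the end, one of value 1 to the front, so that the plus signs come
     first. *)
  have := fbasis_reindex (split_bij (\dim Y) 1) (fbasis_reindex (swap_bij _ _) (bY _ be)).
  rewrite addnC in dY; move: (\dim X) dY => k dY; case: k / dY => bX.
  exists p, (sumf f e \o (fun x : 'I_(\dim Y) + 'I_1 => match x with inl a => inr a | inr a => inl a end)
    \o @fintype.split (\dim Y) 1); split=> // [|/negP[]|i j].
  - by rewrite addn1 ltnW.
  - exact: sneg.
  rewrite -(splitK i) -(splitK j) /=; case: (fintype.split i) => {}i; case: (fintype.split j) => {}j;
    rewrite !unsplitK /= /diagonal_gram.
  - by rewrite eE /diagonal_gram -!val_eqE.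
  - rewrite (fY j _ (eY i)).2 -val_eqE /= !ord1 addn0; case: eqP => [h|]; last by rewrite mul0r.
    by have := ltn_ord i; rewrite h ltnn.
  - rewrite (fY i _ (eY j)).1 -val_eqE /= !ord1 addn0; case: eqP => [h|]; last by rewrite mul0r.
    by have := ltn_ord j; rewrite -h ltnn.
  by rewrite vv' -val_eqE /= !ord1 eqxx addn0 ltnNge pY mul1r.
have := fbasis_reindex (split_bij 1 (\dim Y)) (bY _ be).
move: (\dim X) dY => k dY; case: k / dY => bX.
exists p.+1, (sumf f e \o @fintype.split 1 (\dim Y)); split=> // [/pneg ->|i j] //.
rewrite -(splitK i) -(splitK j) /=; case: (fintype.split i) => {}i; case: (fintype.split j) => {}j;
  rewrite !unsplitK /= /diagonal_gram -val_eqE /=.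
- by rewrite vv' !ord1 eqxx mul1r.
- by rewrite (fY i _ (eY j)).1 !ord1 mul0r.
- by rewrite (fY j _ (eY i)).2 !ord1 mul0r.
by rewrite eE /diagonal_gram -!val_eqE /= !add1n eqSS ltnS.
Qed.

(** * Coordinates over the base field and over the reals *)

Section FieldCoordinates.
Variable F : fieldType.

(** Transparent, so that [gdim] built on these coordinates unfolds to [dim_over]. *)
Definition field_coordinates (E : vectType F) : coordinates (idfun : {rmorphism F -> F}) E.
Proof.
apply: (@Coordinates _ _ _ _ _ (@coords F E) (fun i => (vbasis fullv)`_i)).
- by move=> x y i; rewrite /coords linearD.
- by move=> a x i; rewrite /coords linearZ.
- by move=> x; rewrite {1}[x](coord_vbasis (memvf x)).
- by move=> i j; rewrite /coords coord_free ?(basis_free (vbasisP _)).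
Defined.

Lemma field_csize (E : vectType F) : csize (field_coordinates E) = (1 * \dim {:E})%N.
Proof. by rewrite mul1n. Qed.

Definition full_skew : skew_coordinates (idfun : {rmorphism F -> F}) true idfun.
Proof.
apply: (@SkewCoordinates _ _ _ _ _ 1 (fun k _ => k) (fun v => v ord0)) => //.
- by move=> v; rewrite expr1 opprK mul1r.
- by move=> v i; rewrite (ord1 i).
- by move=> x _ /(_ ord0).
Defined.

Definition zero_skew : (2%:R : F) != 0 -> skew_coordinates (idfun : {rmorphism F -> F}) false idfun.
Proof.
move=> F2; apply: (@SkewCoordinates _ _ _ _ _ 0 (fun k _ => 0) (fun v => 0)).
- by move=> x y [].
- by move=> a x [].
- by move=> v; rewrite rmorph0 mulr0.
- by move=> v [].
move=> x xE _; apply/eqP; move/eqP: xE; rewrite expr0 mulN1r -addr_eq0 -mulr2n -mulr_natl mulf_eq0.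
by rewrite (negPf F2).
Defined.

End FieldCoordinates.

Section ComplexCoordinates.
Variable R : realType.
Local Notation C := R[i].

Definition complex_coordinates (E : vectType C) : coordinates (real_complex R : {rmorphism R -> C}) E.
Proof.
apply: (@Coordinates _ _ _ _ _ (@real_coords R E) (fun k =>
  match fintype.split k with
  | inl i => (vbasis fullv)`_i | inr i => 'i%C *: (vbasis fullv)`_i end)).
- by move=> x y i; rewrite /real_coords; case: fintype.split => j; rewrite /coords linearD raddfD.
- move=> a x i; rewrite /real_coords; case: fintype.split => j; rewrite /coords linearZ /=;
  case: (coord _ _ _) => u v /=; ring.
- move=> x; rewrite {1}[x](coord_vbasis (memvf x)) big_split_ord /= -big_split /=.
  apply: eq_bigr => i _; rewrite /real_coords.
  rewrite -[lshift _ i]/(unsplit (inl i)) -[rshift _ i]/(unsplit (inr i)) !unsplitK.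
  by rewrite scalerA -scalerDl; congr (_ *: _); rewrite mulrC -complexE.
have fv (i : 'I_(\dim (fullv : {vspace E}))) : coords (vbasis fullv)`_i = (fun j => (i == j)%:R : C).
  by apply/funext => j; rewrite /coords coord_free ?(basis_free (vbasisP _)).
move=> i j; rewrite /real_coords -[in RHS](splitK i) -[in RHS](splitK j) (inj_eq (can_inj unsplitK)).
case: (fintype.split i) => {}i; case: (fintype.split j) => {}j; rewrite /coords ?linearZ /= -/(coords _ _) fv.
- by rewrite -[inl i == inl j]/(i == j); case: (i == j).
- by case: (i == j).
- by case: (i == j); rewrite ?mulr1 ?mulr0.
by rewrite -[inr i == inr j]/(i == j); case: (i == j); rewrite ?mulr1 ?mulr0.
Defined.

Lemma complex_csize (E : vectType C) : csize (complex_coordinates E) = (2 * \dim {:E})%N.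
Proof. by rewrite mul2n -addnn. Qed.

Definition imaginary_skew : skew_coordinates (real_complex R : {rmorphism R -> C}) false Num.conj.
Proof.
apply: (@SkewCoordinates _ _ _ _ _ 1 (fun z _ => complex.Im z) (fun v => (0 +i* v ord0)%C)).
- by move=> x y i; rewrite raddfD.
- by move=> a [u v] i /=; rewrite mul0r addr0.
- by move=> v; rewrite expr0 mulN1r; apply/eqP; rewrite eq_complex /= oppr0 opprK !eqxx.
- by move=> v i; rewrite (ord1 i).
move=> x; rewrite expr0 mulN1r => /eqP; case: x => u v.
rewrite eq_complex /= => /andP[/eqP uE _] /(_ ord0) /= v0.
have u0 : u = 0 by lra.
by rewrite u0 v0.
Defined.
End ComplexCoordinates.

(** * Infinite fields and normalization of scalars *)

Lemma finset_avoid_infinite (F : fieldType) : infinite_set [set: F] -> forall l : seq F, exists x, x \notin l.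
Proof.
move=> Finf l; apply: contrapT => none; apply: Finf; apply/finite_seqP; exists l.
apply/seteqP; split=> x //= _; apply: contrapT => /negP xl; apply: none; by exists x.
Qed.

Lemma finset_avoid_pchar0 (F : numDomainType) (l : seq F) : exists x, x \notin l.
Proof.
apply: contrapT => none.
have natl (i : 'I_(size l).+1) : (i%:R : F) \in l.
  by apply: contrapT => /negP h; apply: none; exists i%:R.
pose s := [seq (i : nat)%:R : F | i <- iota 0 (size l).+1].
have us : uniq s by rewrite map_inj_uniq ?iota_uniq // => i j /eqP; rewrite eqr_nat => /eqP.
have sl : {subset s <= l}.
  move=> x /mapP[k]; rewrite mem_iota add0n => /andP[_ kl] ->; exact: (natl (Ordinal kl)).
by have := uniq_leq_size us sl; rewrite size_map size_iota ltnn.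
Qed.

(** A root of X times the product of the X - a, plus 1, is none of the a; the extra factor X keeps
    the degree positive when the list is empty. *)
Lemma finset_avoid_closed (F : closedFieldType) (l : seq F) : exists x, x \notin l.
Proof.
have p0 : \prod_(a <- l) ('X - a%:P) != 0 :> {poly F} by rewrite monic_neq0 ?monic_prod_XsubC.
have [x] : exists x, root (\prod_(a <- l) ('X - a%:P) * 'X + 1%:P) x.
  by apply/closed_rootP; rewrite size_MXaddC (negPf p0) /= eqSS size_poly_eq0.
move=> /rootP; rewrite !hornerE horner_prod => E; exists x; apply/negP => xl.
by move/eqP: E; rewrite (big_rem x) //= !hornerE subrr !mul0r add0r oner_eq0.
Qed.

Lemma half_double (K : fieldType) (x : K) : (2%:R : K) != 0 -> 2^-1 * x + 2^-1 * x = x.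
Proof. by move=> K2; rewrite -mulrDl -mulr2n -[X in X * _]mulr_natr mulVf // mul1r. Qed.

Section CharNot2.
Variables (K : fieldType) (theta : {rmorphism K -> K}).
Hypothesis K2 : (2%:R : K) != 0.

Lemma half_gram (V : vectType K) (B : {hermitian V for false & theta}) (I : finType) (y : I -> V) :
  exists h : I -> I -> K, forall i j, B (y i) (y j) = h i j + (-1) ^+ false * theta (h j i).
Proof.
exists (fun i j => 2^-1 * B (y i) (y j)) => i j.
rewrite expr0 mul1r rmorphM fmorphV rmorph_nat.
have -> : theta (B (y j) (y i)) = B (y i) (y j) by rewrite [RHS]hermC expr0 mul1r.
by rewrite half_double.
Qed.

Lemma opp1_scale : (-1 : K) != 0 /\ (-1 : K) != 1.
Proof. by rewrite oppr_eq0 oner_eq0 eq_sym -subr_eq0 opprK -[1 + 1]/(2%:R : K). Qed.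

Lemma opp1_scale_gram (x : K) : (-1) * theta (-1) * x = x.
Proof. by rewrite rmorphN1 mulrNN mulr1 mul1r. Qed.

End CharNot2.

(** h is the strictly upper triangular part of the Gram matrix: the diagonal vanishes for an
    alternating form, and no division by 2 occurs. *)
Lemma half_alternating (K : fieldType) (V : vectType K) (B : {skew_symmetric V}) (I : finType) (y : I -> V) :
  (forall v, B v v = 0) ->
  exists h : I -> I -> K, forall i j, B (y i) (y j) = h i j + (-1) ^+ true * idfun (h j i).
Proof.
move=> B0; exists (fun i j => if (enum_rank i < enum_rank j)%N then B (y i) (y j) else 0) => i j.
case: (ltngtP (enum_rank i) (enum_rank j)) => [_|_|/ord_inj/enum_rank_inj ->].
- by rewrite /= mulr0 addr0.
- by rewrite add0r [LHS]hermC.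
by rewrite B0 /= mulr0 addr0.
Qed.

Lemma stabilizers_described_Sp (F : fieldType) (V : vectType F) (B : {skew_symmetric V})
    (U W : {vspace V}) r : infinite_set [set: F] -> (forall v, B v v = 0) -> nondegenerate B ->
  orthodecomp B U W -> stabilizers_described B U W r (@dim_over F).
Proof.
move=> /finset_avoid_infinite Finf B0 ndB UW S [isoS _]; split.
- exact: orbit_iso_cosetsP.
- exact: Hstab_description_holds.
have [tau tauP] := Finf [:: 0; 1].
have {tauP}[tau0 tau1] : tau != 0 /\ tau != 1 by move: tauP; rewrite !inE negb_or => /andP[].
(* The factors tau and tau^-1 alternate along the hyperbolic pairs; -1 would be 1 in characteristic
   2. *)
pose scale (_ : unit) n (i : 'I_n) := if odd i then tau^-1 else tau.
(* In characteristic 2 skew symmetry does not give B(v, v) = 0, so this property is carried along to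
   the restrictions of B. *)
pose good (V : vectType F) (B : {skew_symmetric V}) := forall v, B v v = 0.
apply: (@Hstab_dim_formula_holds F F idfun Finf true idfun _ _ 1 (@field_coordinates F)
  (@field_csize F) (full_skew F) unit (fun _ => @alternating_gram F) tau scale _ _ _ good) => //.
- by move=> t n i; rewrite /scale; case: odd; rewrite ?invr_eq1.
- move=> t n i j; rewrite /alternating_gram; case: ifP => [/andP[oi /eqP ij]|_].
    by rewrite /scale ij /= (negPf oi) /= mulfV // mul1r.
  case: ifP => [/andP[oj /eqP ij]|_]; last by rewrite mulr0.
  by rewrite /scale ij /= (negPf oj) /= mulVf // mul1r.
- by move=> V' B' X gB v; exact: gB.
- by move=> V' B' gB I y; exact: half_alternating.
- move=> V' B' gB X nX; exists tt; exact: alternating_basis.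
Qed.

Lemma stabilizers_described_sym (F : fieldType) (neg : bool) (V : vectType F) (B : {symmetric V})
    (U W : {vspace V}) r : (forall l : seq F, exists x, x \notin l) -> (2%:R : F) != 0 ->
  (forall x : F, x != 0 -> exists c (s : bool), c * c * x = (-1) ^+ s /\ (s -> neg)) ->
  nondegenerate B ->
  orthodecomp B U W -> stabilizers_described B U W r (@dim_over F).
Proof.
move=> Finf F2 normalize ndB UW S [isoS _]; split.
- exact: orbit_iso_cosetsP.
- exact: Hstab_description_holds.
apply: (@Hstab_dim_formula_holds F F idfun Finf false idfun _ _ 1 (@field_coordinates F)
  (@field_csize F) (zero_skew F2) nat (@diagonal_gram F) (-1) (fun _ _ _ => -1) _ _ _
  (fun _ _ => True)) => //.
- exact: opp1_scale.
- by move=> t n i; case: (opp1_scale F2).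
- by move=> t n i j; exact: (opp1_scale_gram idfun).
- by move=> V' B' _ I y; exact: half_gram.
- move=> V' B' _ X nX; have [|p [e [_ _ be eE]]] := diagonal_basis (neg := neg) F2 _ nX.
    by move=> x x0 _; exact: normalize.
  by exists p, e.
Qed.

Lemma real_normalize (R : rcfType) (x : R) : x != 0 ->
  exists c (s : bool), c * c * x = (-1) ^+ s /\ (s -> true).
Proof.
move=> x0; exists (Num.sqrt `|x|)^-1, (x < 0); split=> //.
rewrite -invfM -expr2 sqr_sqrtr ?normr_ge0 // {2}[x]realEsign ?num_real // mulrCA.
by rewrite mulVf ?mulr1 // normr_eq0.
Qed.

Lemma complex_normalize (R : rcfType) (x : R[i]) : x != 0 -> Num.conj x = x ->
  exists c (s : bool), c * Num.conj c * x = (-1) ^+ s /\ (s -> true).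
Proof.
case: x => a b x0 /eqP; rewrite eq_complex /= => /andP[_ /eqP b0].
have {b0}b0 : b = 0 by lra.
rewrite b0 in x0 *; have a0 : a != 0 by apply: contra_neq x0 => ->.
have [c [s [cs _]]] := real_normalize a0; exists (real_complex R c), s; split=> //.
transitivity (real_complex R (c * c * a)); last by rewrite cs rmorph_sign.
by apply/eqP; rewrite eq_complex /=; apply/andP; split; apply/eqP; ring.
Qed.

Lemma closed_normalize (F : closedFieldType) (x : F) : x != 0 ->
  exists c (s : bool), c * c * x = (-1) ^+ s /\ (s -> false).
Proof.
move=> x0; have [c] : exists c, root ('X^2 - (x^-1)%:P) c.
  by apply/closed_rootP; rewrite size_XnsubC.
by move=> /rootP; rewrite !hornerE => /eqP; rewrite subr_eq0 => /eqP cc;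
  exists c, false; rewrite -expr2 cc mulVf.
Qed.

Lemma pchar_neq2 (F : fieldType) : 2%N \notin [pchar F] -> (2%:R : F) != 0.
Proof. by rewrite inE. Qed.

Lemma stabilizers_described_herm (R : realType) (V : vectType R[i]) (B : {hermitian_sym V for Num.conj})
    (U W : {vspace V}) r : nondegenerate B ->
  orthodecomp B U W -> stabilizers_described B U W r (@real_dim R).
Proof.
move=> ndB UW S [isoS _].
have F2 : (2%:R : R[i]) != 0 by rewrite pnatr_eq0.
split.
- exact: orbit_iso_cosetsP.
- apply: Hstab_description_holds => //; exact: conjCK.
apply: (@Hstab_dim_formula_holds R R[i] (real_complex R) (@finset_avoid_pchar0 R) false Num.conj _ _ 2
  (@complex_coordinates R)
  (@complex_csize R) (imaginary_skew R) nat (@diagonal_gram R[i]) (-1) (fun _ _ _ => -1) _ _ _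
  (fun _ _ => True)) => //.
- exact: conjCK.
- by move=> x; apply/eqP; rewrite eq_complex /= oppr0 !eqxx.
- exact: opp1_scale.
- by move=> t n i; case: (opp1_scale F2).
- by move=> t n i j; exact: opp1_scale_gram.
- by move=> V' B' _ I y; exact: half_gram.
- move=> V' B' _ X nX; have [|p [e [_ _ be eE]]] := diagonal_basis (neg := true) F2 _ nX.
    exact: complex_normalize.
  by exists p, e.
Qed.

(** * Classification of the orbits *)

Section Classification.
Variables (K : fieldType) (eps : bool) (theta : {rmorphism K -> K}).
Hypothesis thetaK : involutive theta.
Variables (V : vectType K) (B : {hermitian V for eps & theta}).
Hypothesis half : forall (I : finType) (y : I -> V), exists h : I -> I -> K,
  forall i j, B (y i) (y j) = h i j + (-1) ^+ eps * theta (h j i).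
Variables (TT : Type) (J : TT -> forall n, 'I_n -> 'I_n -> K).
Arguments J : clear implicits.
Hypothesis std_basis : forall X : {vspace V}, ndeg B X ->
  exists t (e : 'I_(\dim X) -> V), fbasis X e /\ forall i j, B (e i) (e j) = J t _ i j.
Hypothesis ndB : nondegenerate B.
Variables (U W : {vspace V}).
Hypothesis UW : orthodecomp B U W.

(** Equal invariants give frames with equal block sizes, c and c' being determined by dim U and dim
    W; only the standard forms of the blocks remain to be compared. *)
Lemma same_orbit (S S' : {vspace V}) : isotropic B S -> isotropic B S' ->
  inv_r U S = inv_r U S' -> inv_r W S = inv_r W S' ->
  inv_a B U W S = inv_a B U W S' -> inv_b B U W S = inv_b B U W S' ->
  (forall r r' a b c c' t tU tW s sU sW
     (e e' : frame_index r a b c -> V) (f f' : frame_index r' a b c' -> V),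
     normal_frame B J U W t tU tW S e f -> normal_frame B J U W s sU sW S' e' f' ->
     r = inv_r U S -> a = inv_a B U W S -> b = inv_b B U W S -> r' = inv_r W S ->
     [/\ forall i j, J t b i j = J s b i j, forall i j, J tU c i j = J sU c i j &
         forall i j, J tW c' i j = J sW c' i j]) ->
  Horbit B U W S S'.
Proof.
move=> isoS isoS' rU rW aE bE sameJ.
have [c [c' [t [tU [tW [e [f NF]]]]]]] := normal_frame_exists thetaK half std_basis ndB UW isoS.
have := normal_frame_exists thetaK half std_basis ndB UW isoS'.
rewrite -rU -rW -aE -bE => -[d [d' [s [sU [sW [e' [f' NF']]]]]]].
have [[bU bW] _ _ _] := NF; have [[bU' bW'] _ _ _] := NF'.
have cd : d = c.
  have := fbasis_card bU'; rewrite -(fbasis_card bU) !card_sum !card_ord; clear; lia.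
have cd' : d' = c'.
  have := fbasis_card bW'; rewrite -(fbasis_card bW) !card_sum !card_ord; clear; lia.
subst d d'; have [//|//|//|//|J1 J2 J3] := sameJ _ _ _ _ _ _ _ _ _ _ _ _ _ _ _ _ NF NF'.
exact: (frames_same_orbit UW NF NF' J1 J2 J3).
Qed.

Lemma classified_inv4 r : (forall t s n i j, J t n i j = J s n i j) ->
  classified_by B U W r (inv4 B U W).
Proof.
move=> J1 S S' [isoS _] [isoS' _]; split=> [[h Hh ->]|[rU rW aE bE]].
  by have [h1 h2 h3 h4] := Hgrp_invariants ndB UW S Hh; rewrite /inv4 h1 h2 h3 h4.
by apply: same_orbit => // *; split.
Qed.

End Classification.

(** * Signatures and the indefinite cases *)

Section Signature.
Variables (K : numFieldType) (theta : {rmorphism K -> K}).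
Hypothesis thetaK : involutive theta.
Hypothesis theta_pos : forall k : K, k != 0 -> 0 < k * theta k.
Variables (V : vectType K) (B : {hermitian V for false & theta}).

(** A subspace with the property meets N in 0, so its dimension is at most dim X - dim N, which Y0
    attains. *)
Lemma max_dim (Q : {vspace V} -> Prop) (X Y0 N : {vspace V}) : (Y0 <= X)%VS -> (N <= X)%VS ->
  Q Y0 -> (forall Y, Q Y -> (Y :&: N)%VS = 0%VS) -> (\dim Y0 + \dim N = \dim X)%N ->
  (\max_(d < (\dim X).+1 | `[< exists Y, [/\ (Y <= X)%VS, Q Y & \dim Y = d] >]) d)%N = \dim Y0.
Proof.
move=> Y0X NX QY0 QN dimE; apply/eqP; rewrite eqn_leq; apply/andP; split.
  apply/bigmax_leqP => d /asboolP[Y [YX QY <-]].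
  have YN : (Y + N <= X)%VS by rewrite subv_add YX.
  have := dimvS YN; rewrite dimv_disjoint_sum ?QN //; move: dimE; clear; lia.
have lt : (\dim Y0 < (\dim X).+1)%N by rewrite ltnS dimvS.
apply: (@leq_bigmax_cond _ _ _ (Ordinal lt)); apply/asboolP; by exists Y0.
Qed.

Section OrthogonalBasis.
Variables (X : {vspace V}) (I : finType) (g : I -> V) (d : I -> K).
Hypothesis bg : fbasis X g.
Hypothesis gram : forall i j, B (g i) (g j) = (i == j)%:R * d i.

Lemma form_orthogonal (k : I -> K) :
  B (\sum_i k i *: g i) (\sum_i k i *: g i) = \sum_i k i * theta (k i) * d i.
Proof.
rewrite form_suml; apply: eq_bigr => i _; rewrite form_sumr (bigD1 i) //= gram eqxx mul1r.
by rewrite big1 ?addr0 ?mulrA // => j; rewrite eq_sym gram => /negPf ->; rewrite mul0r mulr0.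
Qed.

Definition subspan (P : pred I) : {vspace V} := fspan (fun i => (P i)%:R *: g i).

Lemma subspanP (P : pred I) v : v \in subspan P ->
  exists k : I -> K, v = \sum_i k i *: g i /\ forall i, ~~ P i -> k i = 0.
Proof.
move=> /fspanP[k ->]; exists (fun i => k i * (P i)%:R); split.
  by apply: eq_bigr => i _; rewrite scalerA.
by move=> i /negPf ->; rewrite mulr0.
Qed.

Lemma mem_subspan (P : pred I) i : P i -> g i \in subspan P.
Proof. by move=> Pi; have := mem_fspan (fun i => (P i)%:R *: g i) i; rewrite /= Pi scale1r. Qed.

Lemma subspan_sub (P : pred I) : (subspan P <= X)%VS.
Proof. by apply: fspan_sub => i; rewrite rpredZ // -(proj2 bg) mem_fspan. Qed.

Lemma subspan_cap (P : pred I) : (subspan P :&: subspan (predC P))%VS = 0%VS.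
Proof.
apply/eqP; rewrite -subv0; apply/subvP => v /memv_capP[/subspanP[k [-> k0]] /subspanP[l [kl l0]]].
rewrite memv0; apply/eqP; apply: big1 => i _.
suff -> : k i = 0 by rewrite scale0r.
have [Pi|/k0 //] := boolP (P i); have kl0 : \sum_i (k i - l i) *: g i = 0.
  by rewrite -[RHS](subrr (\sum_i k i *: g i)) {2}kl -sumrB; apply: eq_bigr => j _; rewrite scalerBl.
have := (proj1 bg) _ kl0 i; rewrite l0 ?subr0 //=; by rewrite Pi.
Qed.

Lemma subspan_dims (P : pred I) : (\dim (subspan P) + \dim (subspan (predC P)))%N = \dim X.
Proof.
rewrite -dimv_disjoint_sum ?subspan_cap //; congr (\dim _); apply/eqP; rewrite eqEsubv.
rewrite subv_add !subspan_sub /= -(proj2 bg); apply: fspan_sub => i.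
have [Pi|Pi] := boolP (P i).
  by apply: (subvP (addvSl _ _)); exact: mem_subspan.
by apply: (subvP (addvSr _ _)); apply: mem_subspan.
Qed.

Lemma dim_subspan_le (P : pred I) : (\dim (subspan P) <= #|P|)%N.
Proof.
rewrite /subspan /fspan; apply: leq_trans; first exact: dimv_leq_sum.
rewrite -sum1_card [X in (_ <= X)%N]big_mkcond /=.
apply: leq_sum => i _; rewrite dim_vline -topredE /=; case: (P i); first by case: eqP.
by rewrite scale0r eqxx.
Qed.

Lemma dim_subspan (P : pred I) : \dim (subspan P) = #|P|.
Proof.
have := dim_subspan_le P; have := dim_subspan_le (predC P); have := subspan_dims P.
have -> : #|predC P| = #|[predC P]| by apply: eq_card.
rewrite -(fbasis_card bg) -(cardC P); move: #|P| #|[predC P]| (\dim _) (\dim _); clear; lia.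
Qed.

Hypothesis d_real : forall i, d i \is Num.real.

Let normP k : 0 <= k * theta k.
Proof. by have [->|/theta_pos/ltW //] := eqVneq k 0; rewrite mul0r. Qed.

Variable s : K.
Hypothesis s_real : s \is Num.real.
Local Notation P := (fun i => 0 < s * d i).

Lemma definite_subspan v : v \in subspan P -> v != 0 -> 0 < s * B v v.
Proof.
move=> /subspanP[k [-> k0]] v0; rewrite form_orthogonal mulr_sumr.
have [i ki] : exists i, k i != 0.
  apply: contrapT => none; case/eqP: v0; apply: big1 => i _.
  suff -> : k i = 0 by rewrite scale0r.
  by apply/eqP; apply: contrapT => /negP ki; apply: none; exists i.
have terms j : 0 <= s * (k j * theta (k j) * d j).
  have [dj|/k0 ->] := boolP (0 < s * d j); last by rewrite !mul0r mulr0.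
  by rewrite mulrCA mulr_ge0 ?normP // ltW.
rewrite lt_def sumr_ge0 // andbT psumr_neq0 //; apply/hasP; exists i; rewrite ?mem_index_enum //=.
by rewrite mulrCA pmulr_rgt0 ?theta_pos //; apply: contraNT ki => /k0 ->.
Qed.

Lemma semidefinite_subspan v : v \in subspan (predC P) -> s * B v v <= 0.
Proof.
move=> /subspanP[k [-> k0]]; rewrite form_orthogonal mulr_sumr; apply: sumr_le0 => j _.
have [dj|dj] := boolP (0 < s * d j); first by rewrite k0 ?mul0r ?mulr0 //= dj.
by rewrite mulrCA; apply: mulr_ge0_le0; rewrite ?normP // real_leNgt ?real0 // realM.
Qed.

(** s = 1 gives the positive index and s = -1 the negative one. The g_i with s d_i > 0 span a
    definite subspace, and the others span a complement that meets every definite subspace in 0: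
    Sylvester's law. *)
Lemma index_orthogonal (Q : {vspace V} -> Prop) :
  (forall Y, Q Y <-> forall v, v \in Y -> v != 0 -> 0 < s * B v v) ->
  (\max_(e < (\dim X).+1 | `[< exists Y, [/\ (Y <= X)%VS, Q Y & \dim Y = e] >]) e)%N
    = #|[pred i | 0 < s * d i]|.
Proof.
move=> QE; rewrite -(dim_subspan P).
apply: (max_dim (N := subspan (predC P))); rewrite ?subspan_sub ?subspan_dims //.
  by apply/QE; exact: definite_subspan.
move=> Y /QE posY; apply/eqP; rewrite -subv0; apply/subvP => v /memv_capP[vY /semidefinite_subspan vN].
rewrite memv0; apply: contrapT => /negP v0.
by have := posY v vY v0; rewrite (le_gtF vN).
Qed.

End OrthogonalBasis.

Lemma signature_orthogonal (X : {vspace V}) (I : finType) (g : I -> V) (d : I -> K) :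
  fbasis X g -> (forall i j, B (g i) (g j) = (i == j)%:R * d i) -> (forall i, d i \is Num.real) ->
  pos_index B X = #|[pred i | 0 < d i]| /\ neg_index B X = #|[pred i | d i < 0]|.
Proof.
move=> bg gram dr; split.
  rewrite /pos_index (index_orthogonal bg gram dr (s := 1)) ?real1 //.
    by apply: eq_card => i; rewrite !inE mul1r.
  by move=> Y; split=> posY v vY v0; have := posY v vY v0; rewrite mul1r.
rewrite /neg_index (index_orthogonal bg gram dr (s := -1)) ?realN ?real1 //.
  by apply: eq_card => i; rewrite !inE mulN1r oppr_gt0.
by move=> Y; split=> posY v vY v0; have := posY v vY v0; rewrite mulN1r oppr_gt0.
Qed.

Lemma signature_img (h : 'End(V)) X : lker h == 0%VS -> isometry B B h ->
  pos_index B (h @: X) = pos_index B X /\ neg_index B (h @: X) = neg_index B X.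
Proof.
move=> kh ih.
have imgE (Q : {vspace V} -> Prop) : (forall Y, Q (h @: Y)%VS <-> Q Y) ->
    forall d, (exists Y, [/\ (Y <= h @: X)%VS, Q Y & \dim Y = d]) <->
              exists Y, [/\ (Y <= X)%VS, Q Y & \dim Y = d].
  move=> hQ d; split=> -[Y [YX QY dY]]; last first.
    by exists (h @: Y)%VS; split; [exact: limgS|exact/hQ|rewrite dim_img0].
  have YE : (h @: (h^-1%VF @: Y))%VS = Y.
    by rewrite -limg_comp lker0_compfV // lim1g.
  exists (h^-1%VF @: Y)%VS; split.
  - by rewrite -(lim1g X) -(lker0_compVf kh) limg_comp limgS.
  - by apply/hQ; rewrite YE.
  - by rewrite -(dim_img0 _ kh) YE.
rewrite /pos_index /neg_index dim_img0 //.
have h0 v : (h v == 0) = (v == 0) by rewrite -memv_ker (eqP kh) memv0.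
have hpos Y : pos_definite B (h @: Y)%VS <-> pos_definite B Y.
  split=> [pY v vY v0|pY _ /memv_imgP[v vY ->]]; last by rewrite h0 ih; exact: pY.
  by rewrite -ih pY ?memv_img ?h0.
have hneg Y : neg_definite B (h @: Y)%VS <-> neg_definite B Y.
  split=> [pY v vY v0|pY _ /memv_imgP[v vY ->]]; last by rewrite h0 ih; exact: pY.
  by rewrite -ih pY ?memv_img ?h0.
split; apply: eq_bigl => d; apply/asboolP/asboolP => H.
- exact/(imgE _ hpos).
- exact/(imgE _ hpos).
- exact/(imgE _ hneg).
- exact/(imgE _ hneg).
Qed.

Lemma ffree_orthogonal (I : finType) (g : I -> V) (d : I -> K) :
  (forall i j, B (g i) (g j) = (i == j)%:R * d i) -> (forall i, d i != 0) -> ffree g.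
Proof.
move=> gram d0 k k0 i; have := form_suml B k g (g i); rewrite k0 linear0l (bigD1 i) //= gram eqxx mul1r.
rewrite big1 ?addr0 => [/esym/eqP|j /negPf ji]; last by rewrite gram ji mul0r mulr0.
by rewrite mulf_eq0 (negPf (d0 i)) orbF => /eqP.
Qed.

Definition sign_lt (t i : nat) : K := if (i < t)%N then 1 else -1.

Lemma sign_lt_gt0 t i : (0 < sign_lt t i) = (i < t)%N.
Proof. by rewrite /sign_lt; case: ifP => _; rewrite ?oppr_gt0 ?ltr01 ?ltr10. Qed.

Lemma sign_lt_lt0 t i : (sign_lt t i < 0) = (t <= i)%N.
Proof. by rewrite /sign_lt [RHS]leqNgt; case: ifP => _; rewrite ?oppr_lt0 ?ltr01 ?ltr10. Qed.

Lemma sign_lt_real t i : sign_lt t i \is Num.real.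
Proof. by rewrite /sign_lt; case: ifP => _; rewrite ?realN real1. Qed.

Lemma sum_lt (t n : nat) : (\sum_(i < n) (i < t) = minn t n)%N.
Proof.
elim: n => [|n IHn]; first by rewrite big_ord0 minn0.
by rewrite big_ord_recr /= IHn; case: ltnP; lia.
Qed.

Lemma sum_ge (t n : nat) : (\sum_(i < n) (t <= i) = n - minn t n)%N.
Proof.
elim: n => [|n IHn]; first by rewrite big_ord0.
by rewrite big_ord_recr /= IHn; case: leqP; lia.
Qed.

Variables (U W : {vspace V}).
Hypothesis ndB : nondegenerate B.
Hypothesis UW : orthodecomp B U W.
Local Notation J := (@diagonal_gram K).

Section FrameSignature.
Variables (S : {vspace V}) (r r' a b c c' t tU tW : nat).
Variables (e : frame_index r a b c -> V) (f : frame_index r' a b c' -> V).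
Hypothesis NF : normal_frame B J U W t tU tW S e f.

(** A hyperbolic pair x, y is replaced by x + y and x - y, of values 2 and -2, which makes the frame
    orthogonal. *)
Definition diagonalized r1 c1 (x : frame_index r1 a b c1 -> V) (i : frame_index r1 a b c1) : V :=
  match i with
  | inr (inl (inl i)) => x (inr (inl (inl i))) + x (inr (inl (inr i)))
  | inr (inl (inr i)) => x (inr (inl (inl i))) - x (inr (inl (inr i)))
  | i => x i
  end.

Definition diagonal_value (s : K) (t1 r1 c1 : nat) (i : frame_index r1 a b c1) : K :=
  match i with
  | inl i => s * sign_lt t i
  | inr (inl (inl i)) => 2
  | inr (inl (inr i)) => -2
  | inr (inr i) => sign_lt t1 i
  end.

(** Each hyperbolic pair contributes one positive direction, and the block b has its signs reversed
    when s = -1. As the index belongs to X alone, it determines min(t1, c1) once min(t, b) is known;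
    minima appear because a label may exceed the size of its block. *)
Lemma frame_signature (s : K) r1 c1 t1 (X : {vspace V}) (x : frame_index r1 a b c1 -> V) :
  s = 1 \/ s = -1 -> fbasis X x -> (forall i j, B (x i) (x j) = frame_gram false J s t t1 i j) ->
  pos_index B X = ((if (0 < s)%R then minn t b else b - minn t b) + (r1 + a) + minn t1 c1)%N.
Proof.
move=> s1 bx gram.
have s0 : s != 0 by case: s1 => ->; rewrite ?oppr_eq0 oner_eq0.
have g0 : forall i j, B (diagonalized x i) (diagonalized x j) = (i == j)%:R * diagonal_value s t1 i.
  case=> [i|[[i|i]|i]] [j|[[j|j]|j]] /=;
    rewrite ?linearDl ?linearBl /= ?linearD ?linearB /= ?linearNl /= ?linearNr /=
      ?gram /= ?gram /= ?expr0 ?mul1r ?opprK ?oppr0 ?add0r ?addr0 ?subr0 ?sub0r;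
    first [by rewrite mul0r | by rewrite mul0r addNr | by rewrite mul0r oppr0 | by rewrite mul0r subrr
      | by rewrite mul0r addrC subrr | by rewrite -[inl i == inl j]/(i == j) /diagonal_gram mulrCA
      | by rewrite -[RHS]/((i == j)%:R * 2) mulr_natr mulr2n
      | by rewrite -[RHS]/((i == j)%:R * -2) mulrN mulr_natr mulr2n opprD addrC | by []].
have d0 (i : frame_index r1 a b c1) : diagonal_value s t1 i != 0.
  case: i => [i|[[i|i]|i]] /=; rewrite ?mulf_eq0 ?(negPf s0) /sign_lt ?oppr_eq0 ?pnatr_eq0 //;
    by case: ifP => _; rewrite /= ?oppr_eq0 ?oner_eq0.
have bg : fbasis X (diagonalized x).
  apply: fbasis_free_card; first exact: ffree_orthogonal g0 d0.
    move=> i; have xX j : x j \in X by rewrite -(proj2 bx) mem_fspan.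
    by case: i => [i|[[i|i]|i]] /=; rewrite ?rpredD ?rpredN // xX.
  exact: fbasis_card bx.
have dr (i : frame_index r1 a b c1) : diagonal_value s t1 i \is Num.real.
  case: i => [i|[[i|i]|i]] /=; rewrite ?realN ?realn ?sign_lt_real //.
  by rewrite realM ?sign_lt_real //; case: s1 => ->; rewrite ?realN real1.
rewrite (signature_orthogonal bg g0 dr).1 -sum1_card big_mkcond !big_sumType /=.
have ifb n (P : 'I_n -> bool) : (\sum_(i < n) (if P i then 1 else 0) = \sum_(i < n) P i)%N.
  by apply: eq_bigr => i _; case: (P i).
rewrite !ifb -[RHS]addnA; congr (_ + _)%N.
  case: s1 => -> /=.
    by rewrite ltr01 -sum_lt; apply: eq_bigr => i _; rewrite inE /= mul1r sign_lt_gt0.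
  rewrite oppr_gt0 ltr10 -sum_ge; apply: eq_bigr => i _.
  by rewrite inE /= mulN1r oppr_gt0 sign_lt_lt0.
congr (_ + _)%N; last by rewrite -sum_lt; apply: eq_bigr => i _; rewrite inE /= sign_lt_gt0.
have two n (P : 'I_n -> bool) : (forall i, P i) -> (\sum_(i < n) P i = n)%N.
  by move=> Pi; rewrite (eq_bigr (fun=> 1%N)) => [|i _]; rewrite ?Pi // sum_nat_const card_ord muln1.
have none n (P : 'I_n -> bool) : (forall i, ~~ P i) -> (\sum_(i < n) P i = 0)%N.
  by move=> Pi; rewrite big1 // => i _; rewrite (negPf (Pi i)).
rewrite -[RHS]addn0; congr (_ + _)%N.
  by rewrite !two // => i; exact: (ltr0n K 2).
have neg2 : ~~ (0 < - 2 :> K) by rewrite oppr_gt0 ltrn0.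
by rewrite !none // => i; exact: neg2.
Qed.

(** The r and a vectors span the radical of P_U S and contribute to neither index, so both are read
    from the block b. *)
Lemma Proj_signature : isotropic B S -> r = inv_r U S -> a = inv_a B U W S -> b = inv_b B U W S ->
  pos_index B (Proj U W S) = minn t b /\ neg_index B (Proj U W S) = (b - minn t b)%N.
Proof.
move=> isoS rE aE bE.
have [[[fe eU] [_ fW]] gU _ SE] := NF.
have eUin i : e i \in U by rewrite -eU mem_fspan.
have fWin i : f i \in W by rewrite -fW mem_fspan.
pose g := sumf (sumf (frame_r e) (frame_a e)) (frame_b e).
pose d (i : ('I_r + 'I_a) + 'I_b) : K := if i is inr i then sign_lt t i else 0.
have gram i j : B (g i) (g j) = (i == j)%:R * d i.
  case: i => [[i|i]|i]; case: j => [[j|j]|j]; rewrite /g /frame_r /frame_a /frame_b /= gU /= ?mulr0 ?mul0r //.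
  by rewrite mul1r.
have fg : ffree g.
  move=> k k0.
  pose k' (i : frame_index r a b c) : K := match i with
    | inl i => k (inr i) | inr (inl (inl (inl i))) => k (inl (inl i))
    | inr (inl (inl (inr i))) => k (inl (inr i)) | _ => 0 end.
  have k'0 : \sum_i k' i *: e i = 0.
    have z n (x : 'I_n -> V) : \sum_i (0 : K) *: x i = 0 by rewrite big1 // => i _; rewrite scale0r.
    by rewrite -[RHS]k0 !big_sumType /= !z !addr0 addrC.
  have ke := fe _ k'0.
  by case=> [[i|i]|i]; [exact: (ke (inr (inl (inl (inl i)))))|exact: (ke (inr (inl (inl (inr i)))))|exact: (ke (inl i))].
have bg : fbasis (Proj U W S) g.
  apply: fbasis_free_card => //; last by rewrite (dim_Proj_inv UW isoS) !card_sum !card_ord -rE -aE -bE.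
  have memS x : x \in S -> forall u w, u \in U -> w \in W -> x = u + w -> u \in Proj U W S.
    by move=> xS u w uU wW xE; apply/mem_Proj; split=> //; exists w; rewrite // -xE.
  have inS i : isotropic_family e f i \in S by rewrite SE mem_fspan.
  case=> [[i|i]|i].
  - by apply: (memS _ (inS (inl (inl i))) _ 0); rewrite ?mem0v ?addr0 //; exact: eUin.
  - exact: (memS _ (inS (inr (inl i))) _ _ (eUin _) (fWin _) erefl).
  - exact: (memS _ (inS (inr (inr i))) _ _ (eUin _) (fWin _) erefl).
have dr i : d i \is Num.real by case: i => [i|i] /=; [exact: real0|exact: sign_lt_real].
have [-> ->] := signature_orthogonal bg gram dr.
have cardE (P : pred ('I_r + 'I_a + 'I_b)) : (forall i, ~~ P (inl i)) ->
    #|[pred i | P i]| = (\sum_(i < b) P (inr i))%N.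
  move=> Pl; rewrite -sum1_card big_mkcond big_sumType /= big1 => [|i _]; last first.
    by rewrite inE (negPf (Pl i)).
  by rewrite add0n; apply: eq_bigr => i _; rewrite inE; case: (P _).
rewrite !cardE; [|by move=> i; rewrite /= ltxx..].
split; first by rewrite -sum_lt; apply: eq_bigr => i _ /=; rewrite sign_lt_gt0.
by rewrite -sum_ge; apply: eq_bigr => i _ /=; rewrite sign_lt_lt0.
Qed.

End FrameSignature.

Hypothesis half : forall (I : finType) (y : I -> V), exists h : I -> I -> K,
  forall i j, B (y i) (y j) = h i j + (-1) ^+ false * theta (h j i).
Hypothesis std_basis : forall X : {vspace V}, ndeg B X ->
  exists t (e : 'I_(\dim X) -> V), fbasis X e /\ forall i j, B (e i) (e j) = diagonal_gram K t i j.

Lemma diagonal_gram_minn t s n : minn t n = minn s n ->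
  forall i j : 'I_n, diagonal_gram K t i j = diagonal_gram K s i j.
Proof.
move=> ts i j; have its : (i < t)%N = (i < s)%N by have := ltn_ord i; lia.
by rewrite /diagonal_gram its.
Qed.

Lemma classified_inv5 r : classified_by B U W r (inv5 B U W).
Proof.
move=> S S' [isoS dS] [isoS' dS']; split=> [[h Hh ->]|[rU rW aE bU _]].
  have [h1 h2 h3 _] := Hgrp_invariants ndB UW S Hh; have [kh [ih _ _]] := (Hgrp_lker0 ndB UW Hh, (HgrpP UW h).1 Hh).
  rewrite /inv5 /inv_bU /inv_bW h1 h2 h3 (Hgrp_Proj ndB UW S Hh).1.
  by rewrite !(signature_img _ kh ih).1 !(signature_img _ kh ih).2.
(* dim S = r_U + r_W + a + b, and S and S' have the same dimension. *)
have bE : inv_b B U W S = inv_b B U W S'.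
  move: dS dS'; rewrite (dim_isotropic_inv UW isoS) (dim_isotropic_inv UW isoS') rU rW aE; clear; lia.
apply: (same_orbit thetaK half std_basis ndB UW) => //.
move=> r1 r1' a b c c' t tU tW s sU sW e e' f f' NF NF' r1E aE1 bE1 r1'E.
have [t1 _] := Proj_signature NF isoS r1E aE1 bE1.
have [s1 _] : pos_index B (Proj U W S') = minn s b /\ neg_index B (Proj U W S') = (b - minn s b)%N.
  by apply: (Proj_signature NF' isoS'); rewrite ?r1E ?aE1 ?bE1.
have tb : minn t b = minn s b by rewrite -t1 -s1.
have [[bU1 bW1] gU1 gW1 _] := NF; have [[bU2 bW2] gU2 gW2 _] := NF'.
(* The index of U is computed in the frame of S on one side and in that of S' on the other;
   comparison gives min(tU, c) = min(sU, c). The same is then done for W. *)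
have eU : pos_index B U = pos_index B U by [].
rewrite {1}(frame_signature (or_introl erefl) bU1 gU1) (frame_signature (or_introl erefl) bU2 gU2) tb in eU.
have eW : pos_index B W = pos_index B W by [].
rewrite {1}(frame_signature (or_intror erefl) bW1 gW1) (frame_signature (or_intror erefl) bW2 gW2) tb in eW.
by split; apply: diagonal_gram_minn => //; [move: eU|move: eW]; clear; lia.
Qed.

End Signature.

Theorem theorem1p1 :
  (* (Sp) *)
  (forall (F : fieldType) (V : vectType F) (B : {skew_symmetric V})
      (U W : {vspace V}) (n m r : nat),
    infinite_set [set: F] ->
    (forall v, B v v = 0) -> nondegenerate B ->
    \dim {:V} = (2 * n)%N -> \dim U = (2 * m)%N -> (0 < m < n)%N ->
    orthodecomp B U W ->
    (2 * r <= \dim {:V})%N ->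
    classified_by B U W r (inv4 B U W) /\
    stabilizers_described B U W r (@dim_over F)) /\
  (* (O) *)
  (forall (F : closedFieldType) (V : vectType F) (B : {symmetric V})
      (U W : {vspace V}) (n m r : nat),
    2%N \notin [pchar F] ->
    nondegenerate B ->
    \dim {:V} = n -> \dim U = m -> (0 < m < n)%N ->
    orthodecomp B U W ->
    (2 * r <= \dim {:V})%N ->
    classified_by B U W r (inv4 B U W) /\
    stabilizers_described B U W r (@dim_over F)) /\
  (* (R) *)
  (forall (R : realType) (V : vectType R) (B : {symmetric V})
      (U W : {vspace V}) (p q p1 q1 r : nat),
    nondegenerate B ->
    has_signature B fullv p q ->
    has_signature B U p1 q1 -> has_signature B W (p - p1) (q - q1) ->
    (0 < p1 < p)%N -> (0 < q1 < q)%N ->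
    orthodecomp B U W ->
    (r <= minn p q)%N ->
    classified_by B U W r (inv5 B U W) /\
    stabilizers_described B U W r (@dim_over R)) /\
  (* (U) *)
  (forall (R : realType) (V : vectType R[i])
      (B : {hermitian_sym V for Num.conj})
      (U W : {vspace V}) (p q p1 q1 r : nat),
    nondegenerate B ->
    has_signature B fullv p q ->
    has_signature B U p1 q1 -> has_signature B W (p - p1) (q - q1) ->
    (0 < p1 < p)%N -> (0 < q1 < q)%N ->
    orthodecomp B U W ->
    (r <= minn p q)%N ->
    classified_by B U W r (inv5 B U W) /\
    stabilizers_described B U W r (@real_dim R)).
Proof.
split; [|split; [|split]].
- move=> F V B U W n m r Finf B0 ndB _ _ _ UW _; split; last exact: stabilizers_described_Sp.
  apply: (@classified_inv4 F true idfun _ V B _ unit (fun _ => @alternating_gram F)) => //.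
    by move=> I y; exact: half_alternating.
  by move=> X nX; exists tt; exact: alternating_basis.
- move=> F V B U W n m r /pchar_neq2 F2 ndB _ _ _ UW _.
  split; last first.
    apply: (stabilizers_described_sym (neg := false)) => //; first exact: finset_avoid_closed.
    by move=> x; exact: closed_normalize.
  (* All signs are plus over an algebraically closed field, so each dimension has a single standard
     form. *)
  apply: (@classified_inv4 F false idfun _ V B _ unit (fun _ n => @diagonal_gram F n n)) => //.
    by move=> I y; exact: half_gram.
  move=> X nX; exists tt.
  have [x x0 _|p [e [_ pE be eE]]] := diagonal_basis (neg := false) F2 _ nX; first exact: closed_normalize.
  by exists e; split=> // i j; rewrite eE pE.
- move=> R V B U W p q p1 q1 r ndB _ _ _ _ _ UW _.
  have R2 : (2%:R : R) != 0 by rewrite pnatr_eq0.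
  split; last first.
    apply: (stabilizers_described_sym (neg := true)) => //; first exact: finset_avoid_pchar0.
    by move=> x; exact: real_normalize.
  apply: classified_inv5 => //.
  + by move=> k k0; rewrite /= -expr2 exprn_even_gt0.
  + by move=> I y; exact: half_gram.
  move=> X nX; have [x x0 _|t [e [_ _ be eE]]] := diagonal_basis (neg := true) R2 _ nX; first exact: real_normalize.
  by exists t, e.
move=> R V B U W p q p1 q1 r ndB _ _ _ _ _ UW _.
have C2 : (2%:R : R[i]) != 0 by rewrite pnatr_eq0.
split; last exact: stabilizers_described_herm.
apply: classified_inv5 => //; first exact: conjCK.
- by move=> k k0; rewrite mul_conjC_gt0.
- by move=> I y; exact: half_gram.
move=> X nX; have [x x0 xx|t [e [_ _ be eE]]] := diagonal_basis (neg := true) C2 _ nX; first exact: complex_normalize.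
by exists t, e.
Qed.
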